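(* There is a global constant $k\in\mathbb{C}$ with $k^6=-1$ such that, with $s=2k\pi\frac{\sqrt[3]{2}}{\sqrt{3}}$, on every chart domain $U_\alpha\subset\mathbf{T}^*$ the flat coordinate $z_\alpha$ and the hyperbolic coordinate $\tau_\alpha$ are related by $$\frac{dz_\alpha}{d\tau_\alpha}=s\,\eta^4(\tau_\alpha),$$ and hence on every intersection $U_\alpha\cap U_\beta$ $$dz_\alpha=s\,\eta^4(\tau_\alpha)\,d\tau_\alpha=s\,\eta^4(\tau_\beta)\,d\tau_\beta=dz_\beta .$$
   Context: $H$ is the upper half-plane, $\Gamma=SL_2(\mathbb{Z})$, $\Gamma'=[\Gamma,\Gamma]$, $N=[\Gamma',\Gamma']$; all act on $H$ by Möbius transformations. $\eta$ is the Dedekind eta function, $\rho=e^{2\pi i/3}$, $[a,b]=\mathbb{Z}a+\mathbb{Z}b$. For a lattice $L$, $g_2(L)=60\sum_{w\in L\setminus 0}w^{-4}$, $g_3(L)=140\sum_{w\in L\setminus 0}w^{-6}$. $L_0=c[1,\rho]$, $c>0$, is the lattice normalized by $g_3(L_0)=1$ (and $g_2(L_0)=0$). The punctured torus $\mathbf{T}^*=H/\Gamma'$ is analytically isomorphic to $(\mathbb{C}-L_0)/L_0$, and $H/N$ to $\mathbb{C}-L_0$. The map $p:H\to\mathbb{C}-L_0$ is the corresponding holomorphic covering map, whose fibres are exactly the $N$-orbits and for which the $\Gamma'$-orbits correspond to the classes $z+L_0$. It is normalized by $p(\tau)\to 0$ as $\mathrm{Im}\,\tau\to\infty$ and $p(iy)<0$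 for all sufficiently large real $y$. $\{(U_\alpha,\tau_\alpha)\}$ is an atlas on $\mathbf{T}^*$ coming from local inverses of the universal covering $H\to H/\Gamma'=\mathbf{T}^*$ (so $\tau_\beta=\gamma\tau_\alpha$ for some $\gamma\in\Gamma'$ on overlaps), and $\{(U_\alpha,z_\alpha)\}$ is the atlas with $z_\alpha=p(\tau_\alpha)$, coming from the projection $\mathbb{C}-L_0\to(\mathbb{C}-L_0)/L_0\cong\mathbf{T}^*$ (so $z_\beta=z_\alpha+w$ for some $w\in L_0$ on overlaps); the chart domains are taken small enough (connected overlaps) for this. *)

(* Defs.v *)
From HB Require Import structures.
From mathcomp Require Import all_boot all_order all_algebra.
From mathcomp Require Import generic_quotient finmap complex.
From mathcomp Require Import all_classical all_reals all_analysis.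
From mathcomp Require Import ring.

Set Implicit Arguments.
Unset Strict Implicit.
Unset Printing Implicit Defensive.

Import Order.TTheory GRing.Theory Num.Theory.
Import numFieldNormedType.Exports.

Local Open Scope classical_set_scope.
Local Open Scope ring_scope.
Local Open Scope complex_scope.
Local Open Scope quotient_scope.

(* [R[i]^o] is [R[i]] with its topology and its structure of normed space over
   itself, so that [derivable] and [is_derive] in the direction [1] express complex
   differentiability.  The order on [R[i]] is partial: [x < y] says that
   [y - x] is a positive real. *)
Notation CC R := (R[i]^o).

Section ComplexFunctions.
Variable R : realType.
Local Notation C := (CC R).

Definition expC (z : C) : C :=
  (expR (complex.Re z))%:C * (cos (complex.Im z) +i* sin (complex.Im z)).

Definition dedekind_eta (tau : C) : C :=
  let q := expC (2 * (trigo.pi : R)%:C * 'i%C * tau) in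
  expC ((trigo.pi : R)%:C * 'i%C * tau / 12) *
    limn (fun n => \prod_(1 <= m < n.+1) (1 - q ^+ m) : C).

Definition rho : C := expC (2 * (trigo.pi : R)%:C * 'i%C / 3).

Definition lattice (a b : C) : set C :=
  [set z | exists m n : int, z = m%:~R * a + n%:~R * b].

(* The finite sets of indices, directed by inclusion: limits along this filter
   are unordered sums. *)
Definition finite_subsets (I : choiceType) : set_system {fset I} :=
  filter_from setT (fun A : {fset I} => [set B : {fset I} | (A `<=` B)%fset]).

Definition lattice_sum (L : set C) (k : nat) : C :=
  lim ((fun B : {fset C} =>
          \sum_(w <- B | w \in L `\ 0) w ^- k : C) @ @finite_subsets C).

Definition g2 (L : set C) : C := 60 * lattice_sum L 4.
Definition g3 (L : set C) : C := 140 * lattice_sum L 6.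

End ComplexFunctions.

(* Subgroups of SL_2(Z) are sets of matrices; on such sets the inverse of the
   ring ['M[int]_2] is the group inverse. *)
Definition SL2Z : set 'M[int]_2 := [set g | \det g = 1].

Definition group_closed_set (K : set 'M[int]_2) : Prop :=
  [/\ K 1, forall g h, K g -> K h -> K (g * h) & forall g, K g -> K g^-1].

Definition derived (G : set 'M[int]_2) : set 'M[int]_2 :=
  smallest group_closed_set
    [set x | exists g h, [/\ G g, G h & x = g * h * g^-1 * h^-1]].

Definition Gamma' : set 'M[int]_2 := derived SL2Z.
Definition GammaN : set 'M[int]_2 := derived Gamma'.

Section HalfPlane.
Variable R : realType.
Local Notation C := (CC R).

Definition upper : set C := [set z | 0 < complex.Im z].

Definition mobius (g : 'M[int]_2) (tau : C) : C :=
  ((g 0 0)%:~R * tau + (g 0 1)%:~R) / ((g 1 0)%:~R * tau + (g 1 1)%:~R).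

Definition same_orbit (G : set 'M[int]_2) (tau tau' : C) : Prop :=
  exists2 g, G g & tau' = mobius g tau.

Lemma derived_closed G : group_closed_set (derived G).
Proof.
split=> [K [[]]//|g h Gg Gh K KP|g Gg K KP].
  have [[_ KM _] _] := KP; apply: KM; [exact: Gg|exact: Gh].
have [[_ _ KV] _] := KP; apply: KV; exact: Gg.
Qed.

Lemma SL2Z_closed : group_closed_set SL2Z.
Proof.
split=> [|g h|g]; rewrite /SL2Z /=; first exact: det1.
  by move=> dg dh; rewrite det_mulmx dg dh mulr1.
by move=> dg; rewrite -[g^-1]/(invmx g) det_inv dg invr1.
Qed.

Lemma Gamma'_SL2Z : Gamma' `<=` SL2Z.
Proof.
apply: smallest_sub; first exact: SL2Z_closed.
have [_ SM SV] := SL2Z_closed.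
by move=> _ [g [h [Sg Sh ->]]]; do 2![apply: (SM); last exact: SV]; exact: SM.
Qed.

Lemma SL2Z_det g : SL2Z g -> g 0 0 * g 1 1 - g 0 1 * g 1 0 = 1.
Proof.
rewrite /SL2Z /= (expand_det_row _ 0) !big_ord_recl big_ord0 addr0 /cofactor.
rewrite !det_mx11 !mxE /= (_ : lift 0 0 = 1 :> 'I_2); last exact: val_inj.
rewrite (_ : lift 1 0 = 0 :> 'I_2); last exact: val_inj.
by rewrite expr0 expr1 mul1r mulN1r mulrN.
Qed.

Lemma mobius_denom_neq0 g (tau : C) : SL2Z g -> upper tau ->
  (g 1 0)%:~R * tau + (g 1 1)%:~R != 0.
Proof.
move=> /SL2Z_det dg; rewrite /upper /=; case: tau => x y /= y0.
apply/eqP => /eqP; rewrite eq_complex.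
rewrite -!(rmorph_int (@real_complex R)) /= !(mul0r, mulr0, addr0, subr0, add0r).
case/andP=> e1 /eqP/eqP; rewrite mulf_eq0 (gt_eqF y0) orbF intr_eq0 => /eqP c0.
move: e1; rewrite c0 mul0r add0r intr_eq0 => /eqP d0.
by move: dg; rewrite c0 d0 !mulr0 subr0.
Qed.

Lemma mobius1 (tau : C) : mobius 1 tau = tau.
Proof. by rewrite /mobius !mxE /= mul1r addr0 mul0r add0r divr1. Qed.

Lemma mobiusM g h (tau : C) : SL2Z g -> SL2Z h -> upper tau ->
  mobius (g * h) tau = mobius g (mobius h tau).
Proof.
move=> Sg Sh Ht; have [_ SM _] := SL2Z_closed.
have dh := mobius_denom_neq0 Sh Ht.
have := mobius_denom_neq0 (SM _ _ Sg Sh) Ht.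
rewrite /mobius -!mulmxE !mxE !big_ord_recl !big_ord0 !addr0.
rewrite (_ : lift ord0 ord0 = 1 :> 'I_2); last exact: val_inj.
rewrite !intrD !intrM.
move: (tau : R[i]) dh.
move: (g 0 0) (g 0 1) (g 1 0) (g 1 1) (h 0 0) (h 0 1) (h 1 0) (h 1 1).
move=> a b c d a' b' c' d' z dh dgh.
have e : c%:~R * ((a'%:~R * z + b'%:~R) / (c'%:~R * z + d'%:~R)) + d%:~R =
  ((c%:~R * a'%:~R + d%:~R * c'%:~R) * z +
   (c%:~R * b'%:~R + d%:~R * d'%:~R)) / (c'%:~R * z + d'%:~R) by field.
by rewrite e; field; rewrite dh dgh.
Qed.

Definition orbit_rel (x y : upper) : bool := `[< same_orbit Gamma' (val x) (val y) >].

Lemma orbit_rel_equiv : equiv_class_of orbit_rel.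
Proof.
have [G1 GM GV] := derived_closed SL2Z.
have sym x y : same_orbit Gamma' (val (x : upper)) (val (y : upper)) ->
    same_orbit Gamma' (val y) (val x).
  move=> [g Gg xy]; exists g^-1; first exact: GV.
  have Sg := Gamma'_SL2Z Gg; have [_ _ SV] := SL2Z_closed.
  rewrite xy -mobiusM ?mulVr ?mobius1 //; first last.
  - exact: (set_valP x).
  - exact: SV.
  - by rewrite -[_ \is a _]/(g \in unitmx) unitmxE Sg unitr1.
split.
- by move=> x; apply/asboolP; exists 1; rewrite ?mobius1.
- by move=> x y; apply/idP/idP => /asboolP xy; apply/asboolP; exact: sym.
- move=> y x z /asboolP[g Gg xy] /asboolP[h Gh yz]; apply/asboolP.
  exists (h * g); first exact: GM.
  rewrite yz xy mobiusM //; [exact: Gamma'_SL2Z..|exact: (set_valP x)].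
Qed.

Canonical orbit_equiv := EquivRelPack orbit_rel_equiv.

(* The punctured torus [H / Gamma'], with the quotient topology. *)
Definition Tstar : Type := quotient_topology {eq_quot orbit_equiv}.

Definition Tstar_proj : upper -> Tstar := \pi_Tstar.

(* [p] restricts to a covering map from [D] onto [E], both open in [C]. *)
Definition covering_map (D E : set C) (p : C -> C) : Prop :=
  p @` D = E /\
  forall z, E z -> exists V : set C,
    [/\ open V, V z, V `<=` E &
     exists (I : Type) (W : I -> set C),
       [/\ forall i, open (W i), trivIset setT W,
           \bigcup_i W i = D `&` p @^-1` V &
           forall i, [/\ set_bij (W i) V p,
             {within W i, continuous p} &
             forall O, open O -> O `<=` W i -> open (p @` O)]]].

(* The isomorphisms [H / GammaN = C - L0] and [H / Gamma' = (C - L0) / L0]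
   enter as the descriptions of the fibres of [p] and of [p] modulo [L0]. *)
Record flat_covering (L0 : set C) (p : C -> C) : Prop := FlatCovering {
  flat_covering_holomorphic : forall tau, upper tau -> derivable p tau 1;
  flat_covering_map : covering_map upper (~` L0) p;
  flat_covering_fibre : forall tau tau', upper tau -> upper tau' ->
    p tau = p tau' <-> same_orbit GammaN tau tau';
  flat_covering_orbit : forall tau tau', upper tau -> upper tau' ->
    L0 (p tau' - p tau) <-> same_orbit Gamma' tau tau';
  flat_covering_cusp : forall e : R, 0 < e ->
    \forall Y \near +oo, forall tau : C, Y < complex.Im tau -> `|p tau| < e%:C;
  flat_covering_real : \forall y \near +oo, p ('i%C * (y : R)%:C) < 0
}.

(* A continuous section over [U] of the covering [upper -> Tstar]; since the
   latter is a local homeomorphism, [val \o t] is a chart on [U]. *)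
Definition local_inverse (U : set Tstar) (t : Tstar -> upper) : Prop :=
  [/\ open U, forall x, U x -> Tstar_proj (t x) = x &
      forall x, U x -> {for x, continuous t}].

Definition chart_coord (t : Tstar -> upper) (x : Tstar) : C := val (t x).

Record hyperbolic_atlas (A : Type) (U : A -> set Tstar)
    (tau : A -> Tstar -> upper) : Prop := HyperbolicAtlas {
  hyperbolic_atlas_cover : \bigcup_a U a = setT;
  hyperbolic_atlas_chart : forall a, local_inverse (U a) (tau a);
  hyperbolic_atlas_overlap : forall a b, a <> b -> connected (U a `&` U b)
}.

(* [df/du = l] at [x], for a coordinate [u] on [U]: the derivative at [u x] of
   [f \o u^-1].  The default value of the partial inverse is irrelevant. *)
Definition is_deriv_coord (U : set Tstar) (u f : Tstar -> C) (x : Tstar)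
    (l : C) : Prop :=
  is_derive (u x) (1 : C) (f \o 'pinv_(fun=> x) U u) l.

(* Equality at [x] of the 1-forms [g df] and [h de]: they have the same
   coefficient [g df/dt = h de/dt] in every local coordinate [t] of [Tstar]. *)
Definition form_eq (x : Tstar) (g f h e : Tstar -> C) : Prop :=
  forall (V : set Tstar) (t : Tstar -> upper), local_inverse V t -> V x ->
    exists l m : C, [/\ is_deriv_coord V (chart_coord t) f x l,
      is_deriv_coord V (chart_coord t) e x m & g x * l = h x * m].

End HalfPlane.

Arguments upper R : clear implicits.

(* Main.v *)
Require Import Defs.
From HB Require Import structures.
From mathcomp Require Import all_boot all_order all_algebra.
From mathcomp Require Import generic_quotient finmap complex.
From mathcomp Require Import all_classical all_reals all_analysis.
From mathcomp Require Import ring lra zify.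

Set Implicit Arguments.
Unset Strict Implicit.
Unset Printing Implicit Defensive.

Import Order.TTheory GRing.Theory Num.Theory.
Import numFieldNormedType.Exports.

Local Open Scope classical_set_scope.
Local Open Scope ring_scope.
Local Open Scope complex_scope.

(** The form [eta^4 dtau] is multiplied by a constant under each element of
    [SL_2(Z)]; these constants form a character, so the form is invariant under
    [Gamma']. So is [dp], because [p] changes under [Gamma'] by lattice vectors.
    At the cusp [eta^4] vanishes to order 1 in [t = e^(2 pi i tau / 6)], and the
    derivative of [p] vanishes too. The quotient of the two forms is therefore a
    holomorphic function on the compactified torus, a constant [s]. It remains
    to compute [s^6].

    Cauchy's theory is developed on the cylinder [C / Z], where a period
    rectangle replaces the circle: Goursat's theorem gives [Cauchy_cylinder] and
    the Laurent expansion with explicit remainders ([Laurent_cylinder],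
    [Fourier_cusp]); composing with [w |-> z0 + rho e^(2 pi i w)] turns discs
    into half-cylinders and gives the Taylor estimates [Taylor2], hence
    [Weierstrass] and [holo_derivative].

    The modularity of [eta] comes from a theta function, whose derivative at 0
    contains [eta] by the product formula. Its transform under
    [tau |-> -1/tau] has the same quasi-periods, so it is a multiple of it
    ([theta_inversion]); the derivative at 0 and the values at the three points
    of order 2 determine the cube of the factor, which gives
    [eta(-1/tau)^6 = i tau^3 eta(tau)^6] ([eta_inversion]) and the
    transformation of [eta^4] under [Gamma'] ([f4_Gamma']).

    A [Gamma']-invariant holomorphic function on the half-plane with a limit at
    the cusp is constant ([rigid]). This uses that every [Gamma']-orbit meets
    [Im tau >= 1/2], because [Gamma'] and the translations generate [SL_2(Z)],
    and that [tau |-> tau + 6] comes from [Gamma']. It even comes from [N], so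
    that [p] itself is a power series in [t].

    The constant is found by comparing expansions. With [a = 6 s / (2 pi i)] they
    are [eta^4 = t - 4 t^7 + ...] and [p = a (t - (4/7) t^7 + ...)]. The bracket
    [3 f'^2 - 2 f f''] of [f = eta^4] has weight 8, so its quotient [X] by [f^4]
    is a function on the torus; normalised, it is [t^(-2) (1 + 248 t^6 + ...)].
    The sum [Z4(z)] of [(z - w)^(-4)] over the lattice is
    [z^(-4) + (1/14) z^2 + ...], because [g_2 = 0] and [g_3 = 1]. By rigidity
    [a^4 Z4(p) = X^2], and the coefficients of [t^2] give
    [16/7 + a^6/14 = 496], that is [a^6 = 6912] ([fl_factor_pow6]), which amounts
    to [k^6 = -1].

    Finally, two local inverses of the covering differ by elements of [Gamma'],
    and near a point a local inverse is the inverse of the projection, since [p]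
    is injective on a sheet of the covering. So in the coordinate given by one
    local inverse, [p] composed with any other one is a translate of [p]
    ([lift_near]), and all the forms in question have the same coefficient
    [s eta^4]. *)

(** * Complex differentiability *)

Section ComplexCalculus.
Variable R : realType.
Implicit Types (z w l : R[i]) (f g : R[i] -> R[i]) (e d : R).

(** The modulus as a real number: the norm of [R[i]] takes its values in [R[i]],
    whose order is partial. *)
Definition nm (z : R[i]) : R := Normc.normc z.

Lemma normc_nm z : `|z| = (nm z)%:C.
Proof. by rewrite normc_def /nm /Normc.normc; case: z. Qed.

Lemma nmE z : nm z = Num.sqrt (complex.Re z ^+ 2 + complex.Im z ^+ 2).
Proof. by rewrite /nm /Normc.normc; case: z. Qed.

Lemma nm_ge0 z : 0 <= nm z. Proof. by rewrite nmE sqrtr_ge0. Qed.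
Lemma nm0 : nm 0 = 0. Proof. exact: Normc.normc0. Qed.
Lemma nm1 : nm 1 = 1. Proof. exact: Normc.normc1. Qed.
Lemma nmM z w : nm (z * w) = nm z * nm w. Proof. exact: Normc.normcM. Qed.
Lemma nmV z : nm z^-1 = (nm z)^-1. Proof. exact: Normc.normcV. Qed.
Lemma nmN z : nm (- z) = nm z. Proof. exact: normcN. Qed.
Lemma nmD z w : nm (z + w) <= nm z + nm w. Proof. exact: le_normcD. Qed.
Lemma nm_distC z w : nm (z - w) = nm (w - z). Proof. by rewrite -nmN opprB. Qed.
Lemma nmB z w : nm (z - w) <= nm z + nm w. Proof. by rewrite -(nmN w) nmD. Qed.
Lemma nm_div z w : nm (z / w) = nm z / nm w. Proof. by rewrite nmM nmV. Qed.
Lemma nmX z n : nm (z ^+ n) = nm z ^+ n.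
Proof. by elim: n => [|n IH]; rewrite ?nm1 // !exprS nmM IH. Qed.
Lemma nm_eq0 z : (nm z == 0) = (z == 0).
Proof. by apply/eqP/eqP => [|->]; [exact: Normc.eq0_normc|exact: nm0]. Qed.
Lemma nm_gt0 z : (0 < nm z) = (z != 0).
Proof. by rewrite lt_def nm_eq0 nm_ge0 andbT. Qed.
Lemma nm_real (x : R) : nm x%:C = `|x|.
Proof. by rewrite nmE /= expr0n addr0 sqrtr_sqr. Qed.
Lemma nm_nat n : nm n%:R = n%:R.
Proof. by rewrite -[n%:R]/(n%:R) -(rmorph_nat (real_complex R)) nm_real normr_nat. Qed.
Lemma nm_i : nm 'i = 1. Proof. by rewrite nmE /= expr0n add0r expr1n sqrtr1. Qed.
Lemma ler_nm_dist z w : nm z - nm w <= nm (z - w).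
Proof. by rewrite lerBlDr (le_trans _ (nmD _ _)) // subrK. Qed.
Lemma nm_dist_dist z w : `|nm z - nm w| <= nm (z - w).
Proof. by rewrite ler_norml ler_nm_dist andbT lerNl opprB nm_distC ler_nm_dist. Qed.
Lemma nm_sqr z : nm z ^+ 2 = complex.Re z ^+ 2 + complex.Im z ^+ 2.
Proof. by rewrite nmE sqr_sqrtr // addr_ge0 // sqr_ge0. Qed.
Lemma Re_le_nm z : `|complex.Re z| <= nm z.
Proof. by rewrite -sqrtr_sqr nmE ler_wsqrtr // lerDl sqr_ge0. Qed.
Lemma Im_le_nm z : `|complex.Im z| <= nm z.
Proof. by rewrite -sqrtr_sqr nmE ler_wsqrtr // lerDr sqr_ge0. Qed.
Lemma nm_le_ReIm z : nm z <= `|complex.Re z| + `|complex.Im z|.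
Proof.
rewrite [z in nm z]complexE (le_trans (nmD _ _)) // nm_real nmM nm_real.
by rewrite nm_i mul1r.
Qed.
Lemma nm_trans z y w : nm (z - w) <= nm (z - y) + nm (y - w).
Proof. by have := nmD (z - y) (y - w); rewrite addrA subrK. Qed.

Lemma nm_sum (I : Type) (s : seq I) (P : pred I) (F : I -> R[i]) :
  nm (\sum_(i <- s | P i) F i) <= \sum_(i <- s | P i) nm (F i).
Proof.
elim/big_ind2: _ => [|x1 x2 y1 y2 h1 h2|//]; first by rewrite nm0.
by rewrite (le_trans (nmD _ _)) // lerD.
Qed.

Lemma nm_eq0P z : (forall e, 0 < e -> nm z <= e) -> z = 0.
Proof.
move=> h; apply/eqP; rewrite -nm_eq0; apply/negPn/negP => z0.
have p : 0 < nm z by rewrite lt_def z0 nm_ge0.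
have := h (nm z / 2) (divr_gt0 p (ltr0Sn _ 1)); lra.
Qed.

Lemma minr_pos (a b : R) : 0 < a -> 0 < b -> exists k : R, [/\ 0 < k, k <= a & k <= b].
Proof.
by move=> a0 b0; exists (Num.min a b); rewrite lt_min a0 b0 !ge_min !lexx orbT.
Qed.

Definition ccont f z := forall e, 0 < e ->
  exists2 d : R, 0 < d & forall w, nm (w - z) < d -> nm (f w - f z) < e.

Lemma ccont_cst (a : R[i]) z : ccont (fun=> a) z.
Proof. by move=> e e0; exists 1 => // w _; rewrite subrr nm0. Qed.
Lemma ccont_id z : ccont id z.
Proof. by move=> e e0; exists e. Qed.
Lemma ccontD f g z : ccont f z -> ccont g z -> ccont (fun w => f w + g w) z.
Proof.
move=> fz gz e e0; have e20 : 0 < e / 2 by lra.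
have [d1 d10 d1P] := fz _ e20; have [d2 d20 d2P] := gz _ e20.
exists (Num.min d1 d2); first by rewrite lt_min d10.
move=> w; rewrite lt_min => /andP[/d1P h1 /d2P h2].
by rewrite opprD addrACA (le_lt_trans (nmD _ _)) //; lra.
Qed.
Lemma ccontN f z : ccont f z -> ccont (fun w => - f w) z.
Proof.
by move=> fz e /fz[d d0 dP]; exists d => // w /dP; rewrite -opprD nmN.
Qed.
Lemma ccontM f g z : ccont f z -> ccont g z -> ccont (fun w => f w * g w) z.
Proof.
move=> fz gz e e0; set A := nm (f z) + nm (g z).
have A0 : 0 <= A by rewrite addr_ge0 ?nm_ge0.
pose k := Num.min 1 (e / (2 + A)).
have k0 : 0 < k by rewrite lt_min ltr01 divr_gt0 //; lra.
have k1 : k <= 1 by rewrite ge_min lexx.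
have ke : k * (2 + A) <= e.
  by rewrite -ler_pdivlMr; [rewrite ge_min lexx orbT|lra].
have [d1 d10 d1P] := fz _ k0; have [d2 d20 d2P] := gz _ k0.
exists (Num.min d1 d2); first by rewrite lt_min d10.
move=> w; rewrite lt_min => /andP[/d1P h1 /d2P h2].
have -> : f w * g w - f z * g z =
  (f w - f z) * (g w - g z) + ((f w - f z) * g z + f z * (g w - g z)) by ring.
have q1 := nmD ((f w - f z) * (g w - g z)) ((f w - f z) * g z + f z * (g w - g z)).
have q2 := nmD ((f w - f z) * g z) (f z * (g w - g z)).
rewrite !nmM in q1 q2.
have ef := nm_ge0 (f z); have eg := nm_ge0 (g z).
have a0 := nm_ge0 (f w - f z); have b0 := nm_ge0 (g w - g z).
move: A0 ke; rewrite /A; nra.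
Qed.
Lemma ccontV f z : f z != 0 -> ccont f z -> ccont (fun w => (f w)^-1) z.
Proof.
move=> fz0 fz e e0; have p : 0 < nm (f z) by rewrite nm_gt0.
set A := nm (f z) in p *.
pose k := Num.min (A / 2) (e * A ^+ 2 / 2).
have k0 : 0 < k by rewrite lt_min !divr_gt0 // mulr_gt0 // exprn_gt0.
have k1 : k <= A / 2 by rewrite ge_min lexx.
have k2 : k <= e * A ^+ 2 / 2 by rewrite ge_min lexx orbT.
have [d d0 dP] := fz _ k0; exists d => // w /dP h.
have q : A / 2 < nm (f w).
  by have := ler_nm_dist (f z) (f w); rewrite nm_distC -/A; lra.
have fw0 : f w != 0 by rewrite -nm_gt0; lra.
have -> : (f w)^-1 - (f z)^-1 = - (f w - f z) / (f w * f z).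
  by field; rewrite ?fw0 ?fz0.
rewrite nm_div nmN nmM -/A ltr_pdivrMr ?mulr_gt0 //; last by lra.
rewrite (lt_le_trans h) // (le_trans k2) // expr2.
have : 0 < e * A by rewrite mulr_gt0.
nra.
Qed.
Lemma ccont_comp f g z : ccont g z -> ccont f (g z) -> ccont (fun w => f (g w)) z.
Proof.
move=> gz fz e e0; have [d d0 dP] := fz _ e0; have [d' d'0 d'P] := gz _ d0.
by exists d' => // w /d'P/dP.
Qed.
Lemma ccont_ext f g z d : 0 < d ->
  (forall w, nm (w - z) < d -> f w = g w) -> ccont f z -> ccont g z.
Proof.
move=> d0 fg fz e e0; have Ez : f z = g z by apply: fg; rewrite subrr nm0. have [d' d'0 d'P] := fz _ e0.
exists (Num.min d d'); first by rewrite lt_min d0.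
by move=> w; rewrite lt_min -Ez => /andP[/fg <- /d'P].
Qed.

(** Complex differentiability, in the form of Caratheodory: the usual rules are
    then algebraic identities between slopes. *)
Definition cder f z l := exists phi : R[i] -> R[i],
  [/\ forall w, f w - f z = phi w * (w - z), phi z = l & ccont phi z].

Lemma cderP f z l : cder f z l <-> forall e, 0 < e -> exists2 d : R, 0 < d &
  forall w, nm (w - z) < d -> nm (f w - f z - l * (w - z)) <= e * nm (w - z).
Proof.
split=> [[phi [fE <- c]] e e0|h].
  have [d d0 dP] := c _ e0; exists d => // w /dP h.
  by rewrite fE -mulrBl nmM ler_wpM2r ?nm_ge0 // ltW.
pose phi w := if w == z then l else (f w - f z) / (w - z).
have phiz : phi z = l by rewrite /phi eqxx.
exists phi; split=> // [w|e e0].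
  rewrite /phi; case: eqP => [->|/eqP wz]; first by rewrite !subrr mulr0.
  by rewrite mulfVK // subr_eq0.
have e20 : 0 < e / 2 by rewrite divr_gt0.
have [d d0 dP] := h _ e20; exists d => // w wd.
rewrite phiz /phi; case: eqP => [_|/eqP wz]; first by rewrite subrr nm0.
have wz0 : w - z != 0 by rewrite subr_eq0.
have -> : (f w - f z) / (w - z) - l = (f w - f z - l * (w - z)) / (w - z).
  by field.
have p : 0 < nm (w - z) by rewrite nm_gt0.
by rewrite nm_div ltr_pdivrMr // (le_lt_trans (dP _ wd)) // ltr_pM2r //; lra.
Qed.

Lemma cder_cont f z l : cder f z l -> ccont f z.
Proof.
case=> phi [fE _ c].
apply: (@ccont_ext (fun w => phi w * (w - z) + f z) f z 1) => [|w _|]; first exact: ltr01.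
  by rewrite -fE subrK.
apply: ccontD; last exact: ccont_cst.
apply: ccontM => //; by apply: ccontD; [exact: ccont_id|exact: ccont_cst].
Qed.

Lemma cder_eq f z l l' : cder f z l -> l = l' -> cder f z l'.
Proof. by move=> ? <-. Qed.
Lemma cder_cst (a : R[i]) z : cder (fun=> a) z 0.
Proof.
by exists (fun=> 0); split=> // [w|]; [rewrite subrr mul0r|exact: ccont_cst].
Qed.
Lemma cder_id z : cder id z 1.
Proof. by exists (fun=> 1); split=> // [w|]; [rewrite mul1r|exact: ccont_cst]. Qed.
Lemma cderD f g z l m : cder f z l -> cder g z m ->
  cder (fun w => f w + g w) z (l + m).
Proof.
move=> [u [fE <- cu]] [v [gE <- cv]]; exists (fun w => u w + v w); split=> //.
  by move=> w; rewrite mulrDl -fE -gE; ring.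
exact: ccontD.
Qed.
Lemma cderM f g z l m : cder f z l -> cder g z m ->
  cder (fun w => f w * g w) z (l * g z + f z * m).
Proof.
move=> fd; have cf := @cder_cont _ _ _ fd; case: fd => [u [fE <- cu]].
move=> [v [gE <- cv]]; exists (fun w => u w * g z + f w * v w); split=> //.
  by move=> w; rewrite mulrDl mulrAC -fE -mulrA -gE; ring.
by apply: ccontD; apply: ccontM => //; exact: ccont_cst.
Qed.
Lemma cderZ (a : R[i]) f z l : cder f z l -> cder (fun w => a * f w) z (a * l).
Proof.
move=> fz; have := cderM (cder_cst a z) fz.
by rewrite mul0r add0r.
Qed.
Lemma cderN f z l : cder f z l -> cder (fun w => - f w) z (- l).
Proof.
move=> /(cderZ (-1)); rewrite mulN1r.
by have -> : (fun w => -1 * f w) = (fun w => - f w) by apply/funext => w; rewrite mulN1r.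
Qed.
Lemma cderB f g z l m : cder f z l -> cder g z m ->
  cder (fun w => f w - g w) z (l - m).
Proof. by move=> h1 /cderN; exact: cderD. Qed.
Lemma cderV f z l : f z != 0 -> cder f z l ->
  cder (fun w => (f w)^-1) z (- l / f z ^+ 2).
Proof.
move=> fz fd; have cf := @cder_cont _ _ _ fd; case: fd => [u [fE ul cu]].
apply/cderP => e e0.
have cphi : ccont (fun w => - u w / (f w * f z)) z.
  apply: ccontM; first exact: ccontN.
  by apply: ccontV; [rewrite mulf_neq0|apply: ccontM => //; exact: ccont_cst].
have [d1 d10 d1P] := cphi _ e0.
have p : 0 < nm (f z) by rewrite nm_gt0.
have [d2 d20 d2P] := cf _ p.
exists (Num.min d1 d2); first by rewrite lt_min d10.
move=> w; rewrite lt_min => /andP[/d1P h1 /d2P h2].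
have fw : f w != 0.
  by apply/negP => /eqP fw; move: h2; rewrite fw add0r nmN ltxx.
have -> : (f w)^-1 - (f z)^-1 - - l / f z ^+ 2 * (w - z) =
   (- u w / (f w * f z) - - u z / (f z * f z)) * (w - z).
  rewrite mulrBl -ul; have -> : - u w / (f w * f z) * (w - z) =
     - (f w - f z) / (f w * f z) by rewrite fE; field; rewrite ?fw ?fz.
  by field; rewrite ?fw ?fz.
by rewrite nmM ler_wpM2r ?nm_ge0 // ltW.
Qed.
Lemma cder_comp f g z l m : cder g z m -> cder f (g z) l ->
  cder (fun w => f (g w)) z (l * m).
Proof.
move=> gd; have cg := @cder_cont _ _ _ gd; case: gd => [v [gE <- cv]].
move=> [u [fE <- cu]]; exists (fun w => u (g w) * v w); split=> //.
  by move=> w; rewrite fE gE mulrA.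
by apply: ccontM => //; exact: ccont_comp.
Qed.
Lemma cderX f z l n : cder f z l ->
  cder (fun w => f w ^+ n) z (n%:R * f z ^+ n.-1 * l).
Proof.
move=> fz; elim: n => [|n IH]; first by rewrite mul0r mul0r; exact: cder_cst.
have -> : (fun w => f w ^+ n.+1) = (fun w => f w * f w ^+ n).
  by apply/funext => w; rewrite exprS.
apply: (cder_eq (cderM fz IH)) => /=.
case: n {IH} => [|n] /=; first by rewrite expr0; ring.
by rewrite -[n.+2]addn1 natrD exprS; ring.
Qed.
Lemma cder_ext f g z l d : 0 < d ->
  (forall w, nm (w - z) < d -> f w = g w) -> cder f z l -> cder g z l.
Proof.
move=> d0 fg /cderP fz; have Ez : f z = g z by apply: fg; rewrite subrr nm0.
apply/cderP => e e0; have [d' d'0 d'P] := fz _ e0.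
exists (Num.min d d'); first by rewrite lt_min d0.
by move=> w; rewrite lt_min -Ez => /andP[/fg <- /d'P].
Qed.
Lemma cder_unique f z l m : cder f z l -> cder f z m -> l = m.
Proof.
move=> /cderP h1 /cderP h2; apply/eqP; rewrite -subr_eq0; apply/eqP.
apply: nm_eq0P => e e0; have e20 : 0 < e / 2 by lra.
have [d1 d10 d1P] := h1 _ e20; have [d2 d20 d2P] := h2 _ e20.
pose h := Num.min d1 d2 / 2; have h0 : 0 < h by rewrite divr_gt0 // lt_min d10.
have hn : nm (z + h%:C - z) = h by rewrite addrAC subrr add0r nm_real gtr0_norm.
have : h < Num.min d1 d2 by move: h0; rewrite /h; lra.
rewrite lt_min => /andP[hd1 hd2].
have := d1P (z + h%:C); have := d2P (z + h%:C); rewrite hn => /(_ hd2) q2 /(_ hd1) q1.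
have : nm ((l - m) * h%:C) <= e * h.
  have -> : (l - m) * h%:C = (f (z + h%:C) - f z - m * (z + h%:C - z)) -
     (f (z + h%:C) - f z - l * (z + h%:C - z)) by ring.
  rewrite (le_trans (nmB _ _)) //. by lra.
by rewrite nmM nm_real gtr0_norm // ler_pM2r.
Qed.

Lemma is_deriveP f z l :
  is_derive (z : CC R) (1 : CC R) (f : CC R -> CC R) l <-> cder f z l.
Proof.
have key h : nm ((h : R[i])^-1 * (f (h + z) - f z) - l) * nm h =
    nm (f (h + z) - f z - l * h) \/ h = 0.
  case: (eqVneq h 0) => [|h0]; [by right|left].
  by rewrite -nmM; congr nm; field.
split.
  move=> H; have := @ex_derive _ _ _ _ _ _ _ H; have := @derive_val _ _ _ _ _ _ _ H.
  rewrite /derive => lE dz.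
  have : (fun h : R[i] => h^-1 *: ((f (h *: 1 + z) : CC R) - f z)) @ (0 : CC R)^' --> (l : CC R).
    by rewrite -lE; exact: dz.
  move=> /cvgrPdist_lt c; apply/cderP => e e0.
  have /c : 0 < e%:C by rewrite ltcR.
  rewrite /dnbhs /within /= => /nbhs_normP[d /=].
  rewrite ltcE /= => /andP[/eqP d1 d0] dP; exists (complex.Re d) => // w wz.
  case: (eqVneq w z) => [->|wz0]; first by rewrite !subrr mulr0 subr0 nm0 mulr0.
  have h0 : w - z != 0 by rewrite subr_eq0.
  have := dP (w - z); rewrite /= sub0r normrN normc_nm ltcE /= d1 eqxx.
  move=> /(_ wz h0); rewrite distrC -[_ *: _]/(_ * _) -[(w - z) *: 1]/((w-z) * 1).
  rewrite mulr1 normc_nm ltcR => /ltW le.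
  case: (key (w - z)) => [E|/eqP]; last by rewrite (negPf h0).
  by rewrite subrK in E le; rewrite -E ler_wpM2r // nm_ge0.
move=> /cderP c.
have cv : (fun h : R[i] => h^-1 *: ((f (h *: 1 + z) : CC R) - f z)) @ (0 : CC R)^' --> (l : CC R).
  apply/cvgrPdist_lt => e; rewrite ltcE /= => /andP[/eqP e1 e0].
  have e20 : 0 < complex.Re e / 2 by lra.
  have [d d0 dP] := c _ e20.
  rewrite /dnbhs /within /=; apply/(@nbhs_normP _ (CC R)); exists d%:C; first by rewrite /= ltcR.
  move=> h /=; rewrite sub0r normrN normc_nm ltcR => hd h0.
  rewrite distrC -[_ *: _]/(_ * _) -[h *: 1]/(h * 1) mulr1 normc_nm.
  rewrite ltcE /= e1 eqxx /=.
  have p : 0 < nm h by rewrite nm_gt0.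
  case: (key h) => [E|/eqP]; last by rewrite (negPf h0).
  rewrite -(ltr_pM2r p) E.
  have := dP (h + z); rewrite addrK => /(_ hd) q.
  by rewrite (le_lt_trans q) // ltr_pM2r //; lra.
by apply: DeriveDef; [apply/cvg_ex; exists l|exact/cvg_lim].
Qed.

End ComplexCalculus.

Arguments nm : simpl never.

(** * The complex exponential *)

Section RealDerivative.
Variable R : realType.
Implicit Types (f : R -> R) (x y l : R).

Lemma rderP f x l : is_derive x (1 : R) f l <-> forall e, 0 < e -> exists2 d : R, 0 < d &
  forall y, `|y - x| < d -> `|f y - f x - l * (y - x)| <= e * `|y - x|.
Proof.
have key h : h != 0 -> `|h^-1 * (f (h + x) - f x) - l| * `|h| = `|f (h + x) - f x - l * h|.
  by move=> h0; rewrite -normrM; congr (`|_|); field.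
split.
  move=> H; have := @ex_derive _ _ _ _ _ _ _ H; have := @derive_val _ _ _ _ _ _ _ H.
  rewrite /derive => lE dz.
  have : (fun h : R => h^-1 *: (f (h *: 1 + x) - f x)) @ (0 : R)^' --> l.
    by rewrite -lE; exact: dz.
  move=> /cvgrPdist_lt c e /c.
  rewrite /dnbhs /within /= => /nbhs_normP[d /= d0 dP]; exists d => // y yx.
  case: (eqVneq y x) => [->|yx0]; first by rewrite !subrr mulr0 subr0 normr0 mulr0.
  have h0 : y - x != 0 by rewrite subr_eq0.
  have := dP (y - x); rewrite /= sub0r normrN => /(_ yx h0).
  rewrite distrC -[_ *: _]/(_ * _) -[(y - x) *: 1]/((y-x) * 1) mulr1 => /ltW le.
  by rewrite -[in leLHS](subrK x y) addrK -key // ler_wpM2r.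
move=> c.
have cv : (fun h : R => h^-1 *: (f (h *: 1 + x) - f x)) @ (0 : R)^' --> l.
  apply/cvgrPdist_lt => e e0; have e20 : 0 < e / 2 by lra.
  have [d d0 dP] := c _ e20.
  rewrite /dnbhs /within /=; apply/nbhs_normP; exists d => //.
  move=> h /=; rewrite sub0r normrN => hd h0.
  rewrite distrC -[_ *: _]/(_ * _) -[h *: 1]/(h * 1) mulr1.
  have p : 0 < `|h| by rewrite normr_gt0.
  rewrite -(ltr_pM2r p) key //.
  have := dP (h + x); rewrite addrK => /(_ hd) q.
  by rewrite (le_lt_trans q) // ltr_pM2r //; lra.
by apply: DeriveDef; [apply/cvg_ex; exists l|exact/cvg_lim].
Qed.

Lemma rder_cont f x l : is_derive x (1 : R) f l -> {for x, continuous f}.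
Proof.
move=> H; apply: differentiable_continuous.
by apply/derivable1_diffP; exact: (@ex_derive _ _ _ _ _ _ _ H).
Qed.

End RealDerivative.

Section ComplexExponential.
Variable R : realType.
Implicit Types (z w : R[i]).
Notation expc := (fun z => (@expC R z : R[i])).

Lemma expCE z : (expC z : R[i]) =
  (expR (complex.Re z) * cos (complex.Im z)) +i* (expR (complex.Re z) * sin (complex.Im z)).
Proof. by rewrite /expC; simpc. Qed.

Lemma expC0 : (expC 0 : R[i]) = 1.
Proof. by rewrite expCE /= expR0 cos0 sin0 !mul1r. Qed.

Lemma expCD z w : (expC (z + w) : R[i]) = (expC z : R[i]) * (expC w : R[i]).
Proof.
rewrite !expCE; case: z => a b; case: w => a' b' /=.
by rewrite expRD cosD sinD; simpc; apply/eqP; rewrite eq_complex /=;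
  apply/andP; split; apply/eqP; ring.
Qed.

Lemma nm_expC z : nm (expC z) = expR (complex.Re z).
Proof.
rewrite nmE expCE /= !exprMn -mulrDr cos2Dsin2 mulr1 sqrtr_sqr.
by rewrite ger0_norm // expR_ge0.
Qed.

Lemma expC_neq0 z : (expC z : R[i]) != 0.
Proof. by rewrite -nm_gt0 nm_expC expR_gt0. Qed.

Lemma expCN z : (expC (- z) : R[i]) = (expC z : R[i])^-1.
Proof.
apply: (mulfI (expC_neq0 z)); rewrite -expCD subrr expC0 mulfV //.
exact: expC_neq0.
Qed.

Lemma expCMn z n : (expC (n%:R * z) : R[i]) = (expC z : R[i]) ^+ n.
Proof.
elim: n => [|n IH]; first by rewrite mul0r expC0.
by rewrite -addn1 natrD mulrDl mul1r expCD IH exprD expr1.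
Qed.

Lemma expC_imag (y : R) : (expC (y%:C * 'i) : R[i]) = cos y +i* sin y.
Proof.
have -> : y%:C * 'i = 0 +i* y by apply/eqP; rewrite eq_complex /= !mulr0 mul0r mulr1 subr0 addr0 !eqxx.
by rewrite expCE /= expR0 !mul1r.
Qed.

Lemma expC_pi : (expC ((pi : R)%:C * 'i) : R[i]) = -1.
Proof. by rewrite expC_imag cospi sinpi; apply/eqP; rewrite eq_complex /= oppr0 !eqxx. Qed.

Lemma expC_2pi : (expC (2 * (pi : R)%:C * 'i) : R[i]) = 1.
Proof. by rewrite -mulrA -[2]/(2%:R) expCMn expC_pi sqrrN expr1n. Qed.

Lemma expC_2piz (m : int) : (expC (2 * (pi : R)%:C * 'i * m%:~R) : R[i]) = 1.
Proof.
case: m => n; first by rewrite mulrC expCMn expC_2pi expr1n.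
by rewrite NegzE mulrNz mulrN expCN mulrC expCMn expC_2pi expr1n invr1.
Qed.

Lemma expC_pihalf : (expC ((pi : R)%:C * 'i / 2) : R[i]) = 'i.
Proof.
have -> : (pi : R)%:C * 'i / 2 = (pi / 2)%:C * 'i.
  by rewrite rmorphM fmorphV rmorph_nat; ring.
by rewrite expC_imag cos_pihalf sin_pihalf.
Qed.

(** With [z = x + i y]: the differentiability of the real functions exp, cos and
    sin at 0 controls [e^x cos y - 1 - x] and [e^x sin y - y]; the addition
    formula then moves the result to any point. *)
Lemma cder_expC0 : cder expc 0 1.
Proof.
apply/cderP => e e0; have e10 : 0 < e / 10 by lra.
have [k [k0 k1 k2]] := minr_pos ltr01 e10.
have /rderP/(_ _ k0)[d1 d10 d1P] := is_derive_expR (0 : R).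
have /rderP/(_ _ k0)[d2 d20 d2P] := is_derive_cos (0 : R).
have /rderP/(_ _ k0)[d3 d30 d3P] := is_derive_sin (0 : R).
exists (Num.min (Num.min d1 k) (Num.min d2 d3)); first by rewrite !lt_min d10 k0 d20.
move=> z; rewrite subr0 !lt_min => /andP[/andP[h1 h4] /andP[h2 h3]].
have hx := Re_le_nm z; have hy := Im_le_nm z.
move: (d1P (complex.Re z)) (d2P (complex.Im z)) (d3P (complex.Im z)).
rewrite !subr0 expR0 cos0 sin0 oppr0 mul0r mul1r !subr0.
move=> /(_ (le_lt_trans hx h1)) q1 /(_ (le_lt_trans hy h2)) q2 /(_ (le_lt_trans hy h3)) q3.
rewrite expC0 expCE mul1r; have N0 := nm_ge0 z.
apply: (le_trans (nm_le_ReIm _)); move: N0 hx hy q1 q2 q3 h4; case: z {h1 h2 h3} => x y /=.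
move: (nm _) (expR x) (cos y) (sin y) (cos_max y) => N E c s cm N0 hx hy q1 q2 q3 h4.
rewrite ?addr0 ?mul1r in q3; rewrite subr0.
rewrite ler_norml in q1; rewrite ler_norml in q2; rewrite ler_norml in q3.
have [x0 y0] : 0 <= `|x| /\ 0 <= `|y| by [].
have kx : k * `|x| <= k * N by rewrite ler_pM2l.
have ky : k * `|y| <= k * N by rewrite ler_pM2l.
have kN : k * N <= N by nra.
have A1 : `|E - 1 - x| <= k * N by rewrite ler_norml; lra.
have A2 : `|c - 1| <= k * N by rewrite ler_norml; lra.
have A3 : `|s - y| <= k * N by rewrite ler_norml; lra.
have A4 : `|E - 1| <= 2 * k.
  rewrite (_ : E - 1 = (E - 1 - x) + x); last by ring.
  by rewrite (le_trans (ler_normD _ _)) //; nra.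
have A5 : `|s| <= 2 * N.
  rewrite (_ : s = (s - y) + y); last by ring.
  by rewrite (le_trans (ler_normD _ _)) //; nra.
have A6 : `|(E - 1) * (c - 1)| <= 2 * k * N.
  by rewrite normrM ler_pM //; nra.
have A7 : `|(E - 1) * s| <= 4 * k * N.
  by rewrite normrM (_ : 4 * k * N = (2 * k) * (2 * N)); [rewrite ler_pM|ring].
have B1 : `|E * c - 1 - x| <= 4 * k * N.
  rewrite (_ : E * c - 1 - x = (E - 1 - x) + ((E - 1) * (c - 1) + (c - 1))); last by ring.
  by rewrite (le_trans (ler_normD _ _)) // (le_trans (lerD (lexx _) (ler_normD _ _))) //; lra.
have B2 : `|E * s - y| <= 5 * k * N.
  rewrite (_ : E * s - y = (E - 1) * s + (s - y)); last by ring.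
  by rewrite (le_trans (ler_normD _ _)) //; lra.
have : k * N <= e / 10 * N by rewrite ler_wpM2r.
move: B1 B2; nra.
Qed.

Lemma cder_expC z : cder expc z (expC z).
Proof.
have E : expc = fun w => (expC z : R[i]) * (expC (w - z) : R[i]).
  by apply/funext => w; rewrite -expCD addrC subrK.
rewrite {1}E; apply: (cder_eq (l := (expC z : R[i]) * (1 * 1))); last by rewrite !mulr1.
apply: cderZ; apply: (cder_comp (f := expc) (g := fun w => w - z)).
  by apply: (cder_eq (cderB (cder_id z) (cder_cst z z))); rewrite subr0.
by rewrite subrr; exact: cder_expC0.
Qed.

Lemma cder_expC_lin a z : cder (fun w => (expC (a * w) : R[i])) z (a * expC (a * z)).
Proof.
rewrite mulrC; apply: (cder_comp (f := expc) (g := fun w => a * w)).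
  by apply: (cder_eq (cderZ a (cder_id z))); rewrite mulr1.
exact: cder_expC.
Qed.

End ComplexExponential.

(** * Integration along lines *)

Section ComplexIntegral.
Variable R : realType.
Local Notation mu := (@lebesgue_measure R).
Implicit Types (f g : R -> R[i]) (a b c x y : R).

Definition rint (u : R -> R) a b : R := \int[mu]_(x in `[a, b]) u x.

Definition cint f a b : R[i] :=
  rint (fun x => complex.Re (f x)) a b +i* rint (fun x => complex.Im (f x)) a b.

Definition contp f x := forall e : R, 0 < e ->
  exists2 d : R, 0 < d & forall y, `|y - x| < d -> nm (f y - f x) < e.

Definition contseg f a b := forall x, a <= x <= b -> contp f x.

Lemma contp_Re f x : contp f x -> {for x, continuous (fun y => complex.Re (f y))}.
Proof.
move=> fx; apply/cvgrPdist_lt => e /fx[d d0 dP].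
apply/nbhs_normP; exists d => // y /=; rewrite distrC => /dP; apply: le_lt_trans.
by rewrite distrC; have := Re_le_nm (f y - f x); rewrite raddfB.
Qed.

Lemma contp_Im f x : contp f x -> {for x, continuous (fun y => complex.Im (f y))}.
Proof.
move=> fx; apply/cvgrPdist_lt => e /fx[d d0 dP].
apply/nbhs_normP; exists d => // y /=; rewrite distrC => /dP; apply: le_lt_trans.
by rewrite distrC; have := Im_le_nm (f y - f x); rewrite raddfB.
Qed.

Lemma cont_integrable (u : R -> R) a b :
  (forall x, a <= x <= b -> {for x, continuous u}) ->
  mu.-integrable `[a, b] (EFin \o u).
Proof.
move=> ux; apply: continuous_compact_integrable; first exact: segment_compact.
by apply: continuous_in_subspaceT => x; rewrite inE /= in_itv /= => /ux.
Qed.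

Lemma cint_integrable f a b : contseg f a b ->
  mu.-integrable `[a, b] (EFin \o (fun x => complex.Re (f x))) /\
  mu.-integrable `[a, b] (EFin \o (fun x => complex.Im (f x))).
Proof.
move=> fc; split; apply: cont_integrable => x /fc.
  exact: contp_Re.
exact: contp_Im.
Qed.

Lemma contpZ (k : R[i]) f x : contp f x -> contp (fun y => k * f y) x.
Proof.
move=> fx e e0; have p : 0 < nm k + 1 by rewrite ltr_wpDl ?nm_ge0.
have [d d0 dP] := fx _ (divr_gt0 e0 p); exists d => // y /dP.
rewrite ltr_pdivlMr // => h; rewrite -mulrBr nmM; apply: le_lt_trans h.
by rewrite mulrC ler_wpM2l ?nm_ge0 // lerDl.
Qed.

Lemma contsegZ (k : R[i]) f a b : contseg f a b -> contseg (fun y => k * f y) a b.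
Proof. by move=> fc x xab; apply: contpZ; exact: fc. Qed.

Lemma cintD f g a b : contseg f a b -> contseg g a b ->
  cint (fun x => f x + g x) a b = cint f a b + cint g a b.
Proof.
move=> /cint_integrable[f1 f2] /cint_integrable[g1 g2].
rewrite /cint /rint; apply/eqP; rewrite eq_complex /= -!RintegralD //.
by apply/andP; split; apply/eqP; apply: eq_Rintegral => x _; rewrite raddfD.
Qed.

Lemma eq_cint f g a b : (forall x, a <= x <= b -> f x = g x) -> cint f a b = cint g a b.
Proof.
move=> fg; rewrite /cint /rint; congr (_ +i* _); apply: eq_Rintegral => x;
  by rewrite inE /= in_itv /= => /fg ->.
Qed.

Lemma cintZ (k : R[i]) f a b : contseg f a b ->
  cint (fun x => k * f x) a b = k * cint f a b.
Proof.
move=> fc; have [f1 f2] := cint_integrable fc; case: k => k1 k2.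
have i1 k : mu.-integrable `[a, b] (EFin \o (fun x => k * complex.Re (f x))).
  apply: cont_integrable => x /fc/contp_Re h.
  by apply: cvgM; [exact: cvg_cst|exact: h].
have i2 k : mu.-integrable `[a, b] (EFin \o (fun x => k * complex.Im (f x))).
  apply: cont_integrable => x /fc/contp_Im h.
  by apply: cvgM; [exact: cvg_cst|exact: h].
rewrite /cint /rint; apply/eqP; rewrite eq_complex /= -!RintegralZl //.
rewrite -RintegralB // -RintegralD //.
apply/andP; split; apply/eqP; apply: eq_Rintegral => x _; case: (f x) => u v //=.
Qed.

Lemma rint_FTC (u U : R -> R) a b : a <= b ->
  (forall x, a <= x <= b -> {for x, continuous u}) ->
  (forall x, a <= x <= b -> is_derive x (1 : R) U (u x)) ->
  rint u a b = U b - U a.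
Proof.
rewrite le_eqVlt => /orP[/eqP <- _ _|ab uc Ud].
  by rewrite /rint set_itv1 Rintegral_set1 subrr.
rewrite /rint /Rintegral (@continuous_FTC2 _ u U) //.
- by apply: continuous_in_subspaceT => x; rewrite inE /= in_itv /= => /uc.
- have Uc x : a <= x <= b -> {for x, continuous U}.
    by move=> /Ud/rder_cont.
  split=> [x|//|//].
  + by rewrite in_itv /= => /andP[h1 h2]; apply: (@ex_derive _ _ _ _ _ _ _ (Ud x _)); rewrite !ltW.
  + by apply: cvg_at_right_filter; apply: Uc; rewrite lexx ltW.
  + by apply: cvg_at_left_filter; apply: Uc; rewrite lexx ltW.
- move=> x; rewrite in_itv /= => /andP[h1 h2]; rewrite derive1E.
  by apply: (@derive_val _ _ _ _ _ _ _ (Ud x _)); rewrite !ltW.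
Qed.

Lemma rint_bound (u : R -> R) a b M : a <= b ->
  (forall x, a <= x <= b -> {for x, continuous u}) ->
  (forall x, a <= x <= b -> u x <= M) -> rint u a b <= M * (b - a).
Proof.
move=> ab uc uM; have mab : measurable (`[a, b] : set R) by [].
have E : rint (fun=> M) a b = M * (b - a).
  rewrite mulrBr; apply: (@rint_FTC (fun=> M) (fun x => M * x)) => // x _.
    exact: cvg_cst.
  apply/rderP => e e0; exists 1 => // y _.
  by rewrite -mulrBr subrr normr0 mulr_ge0 // ltW.
rewrite -E; apply: le_Rintegral => //.
- exact: cont_integrable.
- by apply: cont_integrable => x _; exact: cvg_cst.
Qed.

(** Rotating the integral onto the positive real axis bounds it by the integral
    of a real part, hence with the constant 1. *)
Lemma cint_bound f a b M : a <= b -> contseg f a b ->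
  (forall x, a <= x <= b -> nm (f x) <= M) -> nm (cint f a b) <= M * (b - a).
Proof.
move=> ab fc fM; set I := cint f a b.
have M0 : 0 <= M by apply: le_trans (nm_ge0 (f a)) (fM a _); rewrite lexx.
case: (eqVneq I 0) => [->|I0]; first by rewrite nm0 mulr_ge0 // subr_ge0.
have p : 0 < nm I by rewrite nm_gt0.
pose k : R[i] := complex.Re I -i* complex.Im I.
have nk : nm k = nm I by rewrite !nmE /= sqrrN.
have E : complex.Re (k * I) = nm I ^+ 2.
  by rewrite nm_sqr /k; case: I {p I0 nk} k => u v _ /=; ring.
rewrite -(ler_pM2l p) -expr2 -E -cintZ //= mulrA.
apply: rint_bound => // x xab.
  by apply: contp_Re; apply: contpZ; exact: fc.
rewrite (le_trans (ler_norm _)) // (le_trans (Re_le_nm _)) // nmM nk.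
by rewrite ler_pM2l // fM.
Qed.

Lemma rint_chasles (u : R -> R) a c b : a <= c <= b ->
  (forall x, a <= x <= b -> {for x, continuous u}) ->
  rint u a b = rint u a c + rint u c b.
Proof.
move=> /andP[ac cb] uc; rewrite /rint.
have I1 := cont_integrable uc.
have I2 : mu.-integrable `]c, b] (EFin \o u).
  apply: integrableS I1 => //.
  by apply: subset_itvr; rewrite bnd_simp.
have := @Rintegral_itvB _ u (BLeft a) (BRight b) c I1.
rewrite !bnd_simp => /(_ ac cb) /eqP; rewrite subr_eq addrC => /eqP ->.
by rewrite Rintegral_itv_obnd_cbnd.
Qed.

Lemma cint_chasles f a c b : a <= c <= b -> contseg f a b ->
  cint f a b = cint f a c + cint f c b.
Proof.
move=> acb fc; rewrite /cint.
rewrite !(rint_chasles acb) // => x /fc; [exact: contp_Im|exact: contp_Re].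
Qed.

(** Complex functions are integrated along the lines x |-> z + x * v. *)
Definition line (z v : R[i]) x : R[i] := z + x%:C * v.

Lemma line_sub z v x y : line z v y - line z v x = (y - x)%:C * v.
Proof. by rewrite /line rmorphB; ring. Qed.

Lemma contp_line (F : R[i] -> R[i]) z v x :
  ccont F (line z v x) -> contp (fun y => F (line z v y)) x.
Proof.
move=> Fc e /Fc[d d0 dP]; have p : 0 < nm v + 1 by rewrite ltr_wpDl ?nm_ge0.
exists (d / (nm v + 1)); first by rewrite divr_gt0.
move=> y; rewrite ltr_pdivlMr // => yx; apply: dP; rewrite line_sub nmM nm_real.
by apply: le_lt_trans yx; rewrite ler_wpM2l // lerDl.
Qed.

Lemma cint_FTC (G g : R[i] -> R[i]) z v a b : a <= b ->
  (forall x, a <= x <= b -> cder G (line z v x) (g (line z v x))) ->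
  (forall x, a <= x <= b -> ccont g (line z v x)) ->
  v * cint (fun x => g (line z v x)) a b = G (line z v b) - G (line z v a).
Proof.
move=> ab Gd gc.
have gs : contseg (fun x => g (line z v x)) a b by move=> x /gc; exact: contp_line.
rewrite -cintZ // /cint.
have D x (e : R) : a <= x <= b -> 0 < e -> exists2 d : R, 0 < d & forall y, `|y - x| < d ->
    nm (G (line z v y) - G (line z v x) - v * g (line z v x) * (y - x)%:C)
    <= e * `|y - x|.
  move=> /Gd/cderP h e0; have p : 0 < nm v + 1 by rewrite ltr_wpDl ?nm_ge0.
  have [d d0 dP] := h _ (divr_gt0 e0 p).
  exists (d / (nm v + 1)); first by rewrite divr_gt0.
  move=> y; rewrite ltr_pdivlMr // => yx.
  have : nm (line z v y - line z v x) < d.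
    rewrite line_sub nmM nm_real.
    by apply: le_lt_trans yx; rewrite ler_wpM2l // lerDl.
  move=> /dP; rewrite line_sub; set A := nm _ => q.
  rewrite (_ : nm _ = A); last by congr nm; ring.
  rewrite (le_trans q) // nmM nm_real -mulrA ler_pM2l // mulrC -ler_pdivlMr.
    by rewrite invrK ler_wpM2l // lerDl.
  by rewrite invr_gt0.
have vs := @contsegZ v _ _ _ gs.
have gr x : a <= x <= b -> {for x, continuous (fun x => complex.Re (v * g (line z v x)))}.
  by move=> /vs; exact: contp_Re.
have gi x : a <= x <= b -> {for x, continuous (fun x => complex.Im (v * g (line z v x)))}.
  by move=> /vs; exact: contp_Im.
have E1 : rint (fun x => complex.Re (v * g (line z v x))) a b =
    complex.Re (G (line z v b)) - complex.Re (G (line z v a)).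
  apply: (@rint_FTC _ (fun x => complex.Re (G (line z v x)))) => // x xab.
  apply/rderP => e e0; have [d d0 dP] := D x e xab e0.
  exists d => // y /dP; apply: le_trans; rewrite (le_trans _ (Re_le_nm _)) //.
  rewrite !raddfB /=; case: (v * _) => p q /=.
  by rewrite subrr mulr0 subr0.
have E2 : rint (fun x => complex.Im (v * g (line z v x))) a b =
    complex.Im (G (line z v b)) - complex.Im (G (line z v a)).
  apply: (@rint_FTC _ (fun x => complex.Im (G (line z v x)))) => // x xab.
  apply/rderP => e e0; have [d d0 dP] := D x e xab e0.
  exists d => // y /dP; apply: le_trans; rewrite (le_trans _ (Im_le_nm _)) //.
  rewrite !raddfB /=; case: (v * _) => p q /=.
  by rewrite subrr mulr0 add0r.
rewrite E1 E2; by case: (G _) => u1 u2; case: (G _) => v1 v2.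
Qed.

End ComplexIntegral.

(** * Goursat's theorem for rectangles *)

Section Goursat.
Variable R : realType.
Implicit Types (F : R[i] -> R[i]) (a b c d x y : R).

(** The integral of [F] along the boundary of the rectangle [[a, b] x [c, d]].
    *)
Definition rectint F a b c d : R[i] :=
  cint (fun x => F (x +i* c)) a b - cint (fun x => F (x +i* d)) a b +
  'i * (cint (fun y => F (b +i* y)) c d - cint (fun y => F (a +i* y)) c d).

Lemma horizontalE x y : x +i* y = line (0 +i* y) 1 x.
Proof. by rewrite /line mulr1; simpc. Qed.

Lemma verticalE x y : x +i* y = line (x +i* 0) 'i y.
Proof. by rewrite /line; simpc. Qed.

Lemma cont_horizontal F a b y : (forall x, a <= x <= b -> ccont F (x +i* y)) ->
  contseg (fun x => F (x +i* y)) a b.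
Proof.
move=> Fc x /Fc; rewrite horizontalE => /contp_line.
rewrite (_ : (fun x => F (x +i* y)) = (fun t => F (line (0 +i* y) 1 t))) //.
by apply/funext => t; rewrite horizontalE.
Qed.

Lemma cont_vertical F x c d : (forall y, c <= y <= d -> ccont F (x +i* y)) ->
  contseg (fun y => F (x +i* y)) c d.
Proof.
move=> Fc y /Fc; rewrite verticalE => /contp_line.
rewrite (_ : (fun y => F (x +i* y)) = (fun t => F (line (x +i* 0) 'i t))) //.
by apply/funext => t; rewrite verticalE.
Qed.

Definition contrect F a b c d :=
  forall x y, a <= x <= b -> c <= y <= d -> ccont F (x +i* y).

Lemma contrect_sides F a b c d : a <= b -> c <= d -> contrect F a b c d ->
  [/\ contseg (fun x => F (x +i* c)) a b, contseg (fun x => F (x +i* d)) a b,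
      contseg (fun y => F (a +i* y)) c d & contseg (fun y => F (b +i* y)) c d].
Proof.
move=> ab cd Fc; split; first [apply: cont_horizontal|apply: cont_vertical];
  by move=> t tab; apply: Fc => //; rewrite ?lexx ?ab ?cd.
Qed.

Lemma contrectS F a b c d a' b' c' d' : contrect F a b c d ->
  a <= a' -> b' <= b -> c <= c' -> d' <= d -> contrect F a' b' c' d'.
Proof.
move=> Fc h1 h2 h3 h4 x y /andP[q1 q2] /andP[q3 q4]; apply: Fc; lra.
Qed.

Lemma rectint_hsplit F a m b c d : a <= m <= b -> c <= d -> contrect F a b c d ->
  rectint F a b c d = rectint F a m c d + rectint F m b c d.
Proof.
move=> amb cd Fc; have ab : a <= b by lra.
have [s1 s2 _ _] := contrect_sides ab cd Fc.
by rewrite /rectint (cint_chasles amb s1) (cint_chasles amb s2); ring.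
Qed.

Lemma rectint_vsplit F a b c m d : a <= b -> c <= m <= d -> contrect F a b c d ->
  rectint F a b c d = rectint F a b c m + rectint F a b m d.
Proof.
move=> ab cmd Fc; have cd : c <= d by lra.
have [_ _ s1 s2] := contrect_sides ab cd Fc.
by rewrite /rectint (cint_chasles cmd s1) (cint_chasles cmd s2); ring.
Qed.

Lemma rectintD F G a b c d : a <= b -> c <= d ->
  contrect F a b c d -> contrect G a b c d ->
  rectint (fun z => F z + G z) a b c d = rectint F a b c d + rectint G a b c d.
Proof.
move=> ab cd Fc Gc; have [s1 s2 s3 s4] := contrect_sides ab cd Fc.
have [t1 t2 t3 t4] := contrect_sides ab cd Gc.
by rewrite /rectint !cintD //; ring.
Qed.

Lemma rectint_bound F a b c d M : a <= b -> c <= d -> contrect F a b c d ->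
  (forall x y, a <= x <= b -> c <= y <= d -> nm (F (x +i* y)) <= M) ->
  nm (rectint F a b c d) <= 2 * M * ((b - a) + (d - c)).
Proof.
move=> ab cd Fc FM; have [s1 s2 s3 s4] := contrect_sides ab cd Fc.
have B1 : nm (cint (fun x => F (x +i* c)) a b) <= M * (b - a).
  by apply: cint_bound => // x h; apply: FM; rewrite ?lexx.
have B2 : nm (cint (fun x => F (x +i* d)) a b) <= M * (b - a).
  by apply: cint_bound => // x h; apply: FM; rewrite ?lexx ?andbT.
have B3 : nm (cint (fun y => F (b +i* y)) c d) <= M * (d - c).
  by apply: cint_bound => // x h; apply: FM; rewrite ?lexx ?andbT.
have B4 : nm (cint (fun y => F (a +i* y)) c d) <= M * (d - c).
  by apply: cint_bound => // x h; apply: FM; rewrite ?lexx ?ab.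
rewrite /rectint; set I1 := cint _ a b in B1 *; set I2 := cint _ a b in B2 *.
set I3 := cint _ c d in B3 *; set I4 := cint _ c d in B4 *.
have := nmD (I1 - I2) ('i * (I3 - I4)); rewrite nmM nm_i mul1r => q.
by have := nmB I1 I2; have := nmB I3 I4; lra.
Qed.

(** An affine function has a quadratic primitive. *)
Lemma rectint_affine (p q z0 : R[i]) a b c d : a <= b -> c <= d ->
  rectint (fun z => p + q * (z - z0)) a b c d = 0.
Proof.
move=> ab cd; pose g (z : R[i]) := p + q * (z - z0).
pose G (z : R[i]) := p * z + q / 2 * (z - z0) ^+ 2.
have sub1 w : cder (fun z => z - z0) w 1.
  by apply: (cder_eq (cderB (cder_id w) (cder_cst z0 w))); rewrite subr0.
have Gd w : cder G w (g w).
  apply: (cder_eq (cderD (cderZ p (cder_id w)) (cderZ (q / 2) (cderX 2 (sub1 w))))).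
  by rewrite /g /= expr1; field.
have gc w : ccont g w.
  apply: (@cder_cont _ g w (0 + q * 1)).
  by apply: cderD; [exact: cder_cst|exact: cderZ].
have H y : cint (fun x => g (x +i* y)) a b = G (b +i* y) - G (a +i* y).
  have := @cint_FTC _ G g (0 +i* y) 1 a b ab (fun x _ => Gd _) (fun x _ => gc _).
  rewrite mul1r -!horizontalE => <-.
  by apply: eq_cint => x _; rewrite horizontalE.
have V x : 'i * cint (fun y => g (x +i* y)) c d = G (x +i* d) - G (x +i* c).
  have := @cint_FTC _ G g (x +i* 0) 'i c d cd (fun x _ => Gd _) (fun x _ => gc _).
  rewrite -!verticalE => <-; congr (_ * _).
  by apply: eq_cint => y _; rewrite verticalE.
by rewrite /rectint mulrBr !H !V; ring.
Qed.

Lemma exp2_lt (A e : R) : 0 < e -> exists n, A / 2 ^+ n < e.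
Proof.
move=> e0; exists (Num.truncn (`|A| / e)).+1.
have p : 0 < (2 : R) ^+ (Num.truncn (`|A| / e)).+1 by rewrite exprn_gt0.
rewrite ltr_pdivrMr // (le_lt_trans (ler_norm A)) // mulrC -ltr_pdivrMr //.
apply: lt_le_trans (truncnS_gt _) _.
by rewrite -natrX ler_nat ltnW // ltn_expl.
Qed.

Definition crect F a b c d := forall x y, a <= x <= b -> c <= y <= d ->
  exists l, cder F (x +i* y) l.

Lemma crect_cont F a b c d : crect F a b c d -> contrect F a b c d.
Proof. by move=> h x y hx hy; have [l /cder_cont] := h x y hx hy. Qed.

(** Bisection: the rectangles [a_n, a_n + (b - a)/2^n] x [c_n, c_n + (d - c)/2^n]
    keep a proportion 1/4^n of the integral, which an affine approximation of
    [F] at their common point makes arbitrarily small compared to 1/4^n. *)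
Theorem Goursat F a b c d : a <= b -> c <= d -> crect F a b c d ->
  rectint F a b c d = 0.
Proof.
move=> ab cd Fd; have Fc := @crect_cont _ _ _ _ _ Fd.
pose L := b - a; pose H := d - c.
have L0 : 0 <= L by rewrite subr_ge0. have H0 : 0 <= H by rewrite subr_ge0.
pose N n u v := nm (rectint F u (u + L / 2 ^+ n) v (v + H / 2 ^+ n)).
pose step n (p : R * R) : R * R := let: (u, v) := p in
  let u' := u + L / 2 ^+ n.+1 in let v' := v + H / 2 ^+ n.+1 in
  if N n u v <= 4 * N n.+1 u v then (u, v)
  else if N n u v <= 4 * N n.+1 u' v then (u', v)
  else if N n u v <= 4 * N n.+1 u v' then (u, v') else (u', v').
pose s := fix s n := if n is m.+1 then step m (s m) else (a, c).
pose A n := (s n).1; pose C n := (s n).2.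
have AS n : A n.+1 = (step n (A n, C n)).1 by rewrite /A /C /=; case: (s n).
have CS n : C n.+1 = (step n (A n, C n)).2 by rewrite /A /C /=; case: (s n).
have half (x : R) n : x / 2 ^+ n = x / 2 ^+ n.+1 + x / 2 ^+ n.+1.
  by rewrite exprS; field; rewrite expf_neq0.
have pos (x : R) n : 0 <= x -> 0 <= x / 2 ^+ n.
  by move=> x0; rewrite divr_ge0 // exprn_ge0.
have quad n u v : a <= u -> u + L / 2 ^+ n <= b -> c <= v -> v + H / 2 ^+ n <= d ->
   N n u v <= N n.+1 u v + N n.+1 (u + L / 2 ^+ n.+1) v +
     N n.+1 u (v + H / 2 ^+ n.+1) + N n.+1 (u + L / 2 ^+ n.+1) (v + H / 2 ^+ n.+1).
  move=> h1 h2 h3 h4; rewrite /N.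
  have := half L n; have := half H n; have := pos L n.+1 L0; have := pos H n.+1 H0.
  move: h2 h4; set l := L / 2 ^+ n; set l' := L / 2 ^+ n.+1.
  set h := H / 2 ^+ n; set h' := H / 2 ^+ n.+1 => h2 h4 l'0 h'0 hE lE.
  rewrite (@rectint_vsplit _ _ _ _ (v + h')); [|lra|lra|].
  2: by apply: (contrectS Fc); lra.
  rewrite (@rectint_hsplit _ u (u + l') _ v); [|lra|lra|].
  2: by apply: (contrectS Fc); lra.
  rewrite (@rectint_hsplit _ u (u + l') _ (v + h')); [|lra|lra|].
  2: by apply: (contrectS Fc); lra.
  rewrite (_ : u + l = u + l' + l'); last by rewrite lE addrA.
  rewrite (_ : v + h = v + h' + h'); last by rewrite hE addrA.
  rewrite (le_trans (nmD _ _)) // (le_trans (lerD (nmD _ _) (nmD _ _))) //.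
  by rewrite !addrA.
have inv n : [/\ a <= A n, A n + L / 2 ^+ n <= b, c <= C n, C n + H / 2 ^+ n <= d
    & N 0 a c <= 4 ^+ n * N n (A n) (C n)].
  elim: n => [|n [h1 h2 h3 h4 h5]].
    rewrite /A /C /= !expr0 !divr1 mul1r !lexx; split=> //; rewrite /L /H; lra.
  have q := quad n _ _ h1 h2 h3 h4.
  have e4 : 0 < (4 : R) ^+ n by rewrite exprn_gt0.
  have pL := pos L n.+1 L0; have pH := pos H n.+1 H0.
  have hL := half L n; have hH := half H n.
  have fin x : N n (A n) (C n) <= 4 * x -> N 0 a c <= 4 ^+ n.+1 * x.
    by move=> hx; rewrite exprSr -mulrA (le_trans h5) // ler_pM2l.
  rewrite AS CS; move: (A n) (C n) h1 h2 h3 h4 h5 q fin => u v h1 h2 h3 h4 h5 q fin.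
  have [g1 g2 g3] : [/\ a <= u + L / 2 ^+ n.+1, u + L / 2 ^+ n.+1 <= b &
      u + L / 2 ^+ n.+1 + L / 2 ^+ n.+1 <= b].
    clear -h1 h2 pL hL; move: h2 pL hL.
    by move: (L / _) (L / _) => l l' ? ? ?; split; lra.
  have [g4 g5 g6] : [/\ c <= v + H / 2 ^+ n.+1, v + H / 2 ^+ n.+1 <= d &
      v + H / 2 ^+ n.+1 + H / 2 ^+ n.+1 <= d].
    clear -h3 h4 pH hH; move: h4 pH hH.
    by move: (H / _) (H / _) => h h' ? ? ?; split; lra.
  rewrite /step; case: ifPn => [k1|]; first by split=> //=; exact: fin.
  rewrite -ltNge => k1; case: ifPn => [k2|]; first by split=> //=; exact: fin.
  rewrite -ltNge => k2; case: ifPn => [k3|]; first by split=> //=; exact: fin.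
  rewrite -ltNge => k3; split=> //=; apply: fin; clear -q k1 k2 k3; move: q k1 k2 k3.
  move: (N n u v) (N _ _ _) (N _ _ _) (N _ _ _) (N _ _ _) => N0 N1 N2 N3 N4; lra.
have mono n : [/\ A n <= A n.+1, A n.+1 + L / 2 ^+ n.+1 <= A n + L / 2 ^+ n,
   C n <= C n.+1 & C n.+1 + H / 2 ^+ n.+1 <= C n + H / 2 ^+ n].
  have pL := pos L n.+1 L0; have pH := pos H n.+1 H0.
  have hL := half L n; have hH := half H n.
  rewrite AS CS /step; move: (A n) (C n) => u v.
  clear -pL pH hL hH; move: pL pH hL hH (N _ _ _ <= _) (N _ _ _ <= _) (N _ _ _ <= _).
  move: (L / _) (L / _) (H / _) (H / _) => l l' h h' ? ? ? ? b1 b2 b3.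
  by case: b3; [|case: b2; [|case: b1]] => /=; split; lra.
have monoA n k : A n <= A (n + k)%N /\ A (n + k)%N + L / 2 ^+ (n + k) <= A n + L / 2 ^+ n.
  elim: k => [|k [i1 i2]]; first by rewrite addn0 !lexx.
  by rewrite addnS; have [m1 m2 _ _] := mono (n + k)%N; split; lra.
have monoC n k : C n <= C (n + k)%N /\ C (n + k)%N + H / 2 ^+ (n + k) <= C n + H / 2 ^+ n.
  elim: k => [|k [i1 i2]]; first by rewrite addn0 !lexx.
  by rewrite addnS; have [_ _ m1 m2] := mono (n + k)%N; split; lra.
have ubA m : ubound (range A) (A m + L / 2 ^+ m).
  move=> _ [n _ <-]; case/orP: (leq_total m n) => mn.
    have [_] := monoA m (n - m)%N; rewrite subnKC //.
    by have := pos L n L0; lra.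
  have [h _] := monoA n (m - n)%N; rewrite subnKC // in h.
  by have := pos L m L0; lra.
have ubC m : ubound (range C) (C m + H / 2 ^+ m).
  move=> _ [n _ <-]; case/orP: (leq_total m n) => mn.
    have [_] := monoC m (n - m)%N; rewrite subnKC //.
    by have := pos H n H0; lra.
  have [h _] := monoC n (m - n)%N; rewrite subnKC // in h.
  by have := pos H m H0; lra.
pose X := sup (range A); pose Y := sup (range C).
have X1 n : A n <= X.
  by apply: (ub_le_sup (E := range A)); [exists (A 0%N + L / 2 ^+ 0); exact: ubA|exists n].
have X2 n : X <= A n + L / 2 ^+ n.
  by apply: ge_sup; [exists (A 0%N); exists 0%N|exact: ubA].
have Y1 n : C n <= Y.
  by apply: (ub_le_sup (E := range C)); [exists (C 0%N + H / 2 ^+ 0); exact: ubC|exists n].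
have Y2 n : Y <= C n + H / 2 ^+ n.
  by apply: ge_sup; [exists (C 0%N); exists 0%N|exact: ubC].
have [a0 b0 c0 d0 _] := inv 0%N.
have [l Fl] : exists l, cder F (X +i* Y) l.
  by apply: Fd; have := X1 0%N; have := X2 0%N; have := Y1 0%N; have := Y2 0%N; lra.
apply: nm_eq0P => e e0.
pose S := L + H; have S0 : 0 <= S by rewrite addr_ge0.
have p : 0 < 2 * S ^+ 2 + 1 by rewrite ltr_pwDr // mulr_ge0 // exprn_ge0.
have [del del0 delP] := (cderP _ _ _).1 Fl _ (divr_gt0 e0 p).
have [n nP] := exp2_lt S del0.
have [h1 h2 h3 h4 h5] := inv n.
have -> : rectint F a b c d = rectint F a (a + L / 2 ^+ 0) c (c + H / 2 ^+ 0).
  by rewrite expr0 !divr1 /L /H !(addrC _ (_ - _)) !subrK.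
rewrite -/(N 0%N a c) (le_trans h5) //.
set z0 := X +i* Y in Fl delP.
pose g z := F z0 + l * (z - z0); pose r z := F z - g z.
set u := A n in h1 h2 h5 *; set v := C n in h3 h4 h5 *.
have pL := pos L n L0; have pH := pos H n H0.
have Qc : contrect F u (u + L / 2 ^+ n) v (v + H / 2 ^+ n).
  by apply: (contrectS Fc).
have gc z : ccont g z.
  apply: ccontD; first exact: ccont_cst.
  apply: ccontM; first exact: ccont_cst.
  by apply: ccontD; [exact: ccont_id|exact: ccont_cst].
have rc : contrect r u (u + L / 2 ^+ n) v (v + H / 2 ^+ n).
  by move=> x y hx hy; apply: ccontD; [exact: Qc|apply: ccontN; exact: gc].
have E : rectint F u (u + L / 2 ^+ n) v (v + H / 2 ^+ n) =
         rectint r u (u + L / 2 ^+ n) v (v + H / 2 ^+ n).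
  have FE : F = fun z => r z + g z by apply/funext => z; rewrite /r subrK.
  have uL : u <= u + L / 2 ^+ n by rewrite lerDl.
  have vH : v <= v + H / 2 ^+ n by rewrite lerDl.
  rewrite [in LHS]FE rectintD //.
  by rewrite [X in _ + X]rectint_affine // addr0.
have B : N n u v <= 2 * (e / (2 * S ^+ 2 + 1) * (S / 2 ^+ n)) * (S / 2 ^+ n).
  rewrite /N E.
  have -> : S / 2 ^+ n = (u + L / 2 ^+ n - u) + (v + H / 2 ^+ n - v).
    by rewrite /S; ring.
  apply: rectint_bound; rewrite ?lerDl //; move=> x y /andP[x1 x2] /andP[y1 y2].
  have -> : (u + L / 2 ^+ n - u) + (v + H / 2 ^+ n - v) = S / 2 ^+ n.
    by rewrite /S; ring.
  have dz : nm ((x +i* y) - z0) <= S / 2 ^+ n.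
    rewrite (le_trans (nm_le_ReIm _)) //= /S mulrDl lerD // ler_norml.
      by have := X1 n; have := X2 n; rewrite -/u; lra.
    by have := Y1 n; have := Y2 n; rewrite -/v; lra.
  have := delP _ (le_lt_trans dz nP); rewrite /r /g opprD addrA => /le_trans -> //.
  by rewrite ler_wpM2l // divr_ge0 ?ltW.
have e4 : 0 < (4 : R) ^+ n by rewrite exprn_gt0.
rewrite -(ler_pM2l e4) in B; rewrite (le_trans B) //.
have -> : 4 ^+ n * (2 * (e / (2 * S ^+ 2 + 1) * (S / 2 ^+ n)) * (S / 2 ^+ n)) =
    e * ((2 * S ^+ 2) / (2 * S ^+ 2 + 1)).
  rewrite (_ : 4 = 2 * 2 :> R) ?exprMn; last by ring.
  by field; rewrite expf_neq0 //= gt_eqF.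
by rewrite ler_piMr ?ltW // ltr_pdivrMr // mul1r ltrDl.
Qed.

(** An interior point where [F] is only continuous is cut out in a small square. *)
Theorem Goursat_except F a b c d x0 y0 : a < x0 < b -> c < y0 < d ->
  contrect F a b c d ->
  (forall x y, a <= x <= b -> c <= y <= d -> x +i* y <> x0 +i* y0 ->
    exists l, cder F (x +i* y) l) ->
  rectint F a b c d = 0.
Proof.
move=> /andP[ax xb] /andP[cy yd] Fc Fd; apply: nm_eq0P => e e0.
have [del del0 delP] := Fc x0 y0 ltac:(lra) ltac:(lra) 1 ltr01.
have M0 : 0 < nm (F (x0 +i* y0)) + 1 by rewrite ltr_wpDl ?nm_ge0.
set M := nm _ + 1 in M0.
have pe : 0 < e / (8 * M) by rewrite divr_gt0 // mulr_gt0.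
have pd : 0 < del / 3 by lra.
have [k1 [k10 h1 h2]] := minr_pos pe pd.
have [k2 [k20 h3 h4]] : exists k : R, [/\ 0 < k, k <= x0 - a & k <= b - x0].
  by apply: minr_pos; lra.
have [k3 [k30 h5 h6]] : exists k : R, [/\ 0 < k, k <= y0 - c & k <= d - y0].
  by apply: minr_pos; lra.
have [k4 [k40 h7 h8]] := minr_pos k20 k30.
have [k [k0 h9 h10]] := minr_pos k10 k40.
have G a' b' c' d' : a' <= b' -> c' <= d' -> a <= a' -> b' <= b -> c <= c' -> d' <= d ->
   (b' < x0 \/ x0 < a' \/ d' < y0 \/ y0 < c') -> rectint F a' b' c' d' = 0.
  move=> q1 q2 q3 q4 q5 q6 q7; apply: Goursat => // x y /andP[x1 x2] /andP[y1 y2].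
  by apply: Fd; [lra|lra|move=> [ex ey]; subst x y; case: q7 => [|[|[]]]; lra].
rewrite (@rectint_hsplit _ a (x0 - k / 2) b); [|lra|lra|exact: Fc].
rewrite (@rectint_hsplit _ (x0 - k / 2) (x0 + k / 2) b); [|lra|lra|].
2: by apply: (contrectS Fc); lra.
rewrite (@rectint_vsplit _ (x0 - k / 2) _ c (y0 - k / 2)); [|lra|lra|].
2: by apply: (contrectS Fc); lra.
rewrite (@rectint_vsplit _ (x0 - k / 2) _ (y0 - k / 2) (y0 + k / 2)); [|lra|lra|].
2: by apply: (contrectS Fc); lra.
rewrite (G a (x0 - k / 2)); [|lra..].
rewrite (G (x0 + k / 2) b); [|lra..].
rewrite (G (x0 - k / 2) _ c); [|lra..].
rewrite (G (x0 - k / 2) _ (y0 + k / 2)); [|lra..].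
rewrite !addr0 !add0r.
have B : nm (rectint F (x0 - k / 2) (x0 + k / 2) (y0 - k / 2) (y0 + k / 2)) <=
   2 * M * ((x0 + k / 2 - (x0 - k / 2)) + (y0 + k / 2 - (y0 - k / 2))).
  apply: rectint_bound; [lra|lra|by apply: (contrectS Fc); lra|].
  move=> x y /andP[x1 x2] /andP[y1 y2].
  have : nm ((x +i* y) - (x0 +i* y0)) < del.
    rewrite (le_lt_trans (nm_le_ReIm _)) //=.
    have : `|x - x0| <= k by rewrite ler_norml; lra.
    have : `|y - y0| <= k by rewrite ler_norml; lra.
    lra.
  move=> /delP; have := ler_nm_dist (F (x +i* y)) (F (x0 +i* y0)); rewrite /M; lra.
have : k <= e / (8 * M) by lra.
rewrite ler_pdivlMr ?mulr_gt0 //; lra.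
Qed.

End Goursat.

(** * Cauchy's formula and Laurent series on the cylinder *)

Section Periodic.
Variable R : realType.
Implicit Types (F G : R[i] -> R[i]) (w z : R[i]) (a b x y r s M : R).

Lemma rint_translate (u : R -> R) a b s : a <= b ->
  (forall x, a + s <= x <= b + s -> {for x, continuous u}) ->
  rint u (a + s) (b + s) = rint (fun x => u (x + s)) a b.
Proof.
move=> ab uc; pose F x := x + s.
have Fd x : is_derive x (1 : R) F 1.
  apply/rderP => e e0; exists 1 => // y _.
  have -> : F y - F x - 1 * (y - x) = 0 by rewrite /F; ring.
  by rewrite normr0 mulr_ge0 // ltW.
have F1 : derive1 F = (fun=> 1).
  by apply/funext => x; rewrite derive1E; exact: (@derive_val _ _ _ _ _ _ _ (Fd x)).
have Fc x : {for x, continuous F} by exact: (rder_cont (Fd x)).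
rewrite /rint /Rintegral -[a + s]/(F a) -[b + s]/(F b).
rewrite integration_by_substitution_increasing //; first last.
- by apply: continuous_in_subspaceT => x; rewrite inE /= in_itv /= => /uc.
- split=> [x _| |]; first exact: (@ex_derive _ _ _ _ _ _ _ (Fd x)).
  + by apply: cvg_at_right_filter; exact: Fc.
  + by apply: cvg_at_left_filter; exact: Fc.
- by rewrite F1; exact: is_cvg_cst.
- by rewrite F1; exact: is_cvg_cst.
- by rewrite F1 => x _; exact: cvg_cst.
- by move=> x y _ _; rewrite /F ltrD2r.
by congr fine; apply: eq_integral => x _ /=; rewrite F1 mulr1.
Qed.

Lemma cint_translate (f : R -> R[i]) a b s : a <= b -> contseg f (a + s) (b + s) ->
  cint f (a + s) (b + s) = cint (fun x => f (x + s)) a b.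
Proof.
move=> ab fc; rewrite /cint !rint_translate // => x /fc; [exact: contp_Im|exact: contp_Re].
Qed.

Lemma cint_periodic (f : R -> R[i]) a : (forall x, contp f x) ->
  (forall x, f (x + 1) = f x) -> cint f a (a + 1) = cint f 0 1.
Proof.
move=> fc f1; have fs u v : contseg f u v by move=> x _; exact: fc.
have fN (k : nat) x : f (x + k%:R) = f x.
  by elim: k => [|k IH]; rewrite ?addr0 // -addn1 natrD addrA f1.
have fZ m x : f (x + m%:~R) = f x.
  case: m => k; first exact: fN.
  by rewrite NegzE mulrNz -[in RHS](subrK (k.+1%:R) x) fN.
pose m := Num.floor a; pose s := a - m%:~R.
have s0 : 0 <= s by rewrite subr_ge0 floor_le_tmp.
have s1 : s <= 1 by rewrite lerBlDr addrC -intrD1 ltW // floorD1_gt.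
have -> : cint f a (a + 1) = cint f s (s + 1).
  have -> : a = s + m%:~R by rewrite subrK.
  rewrite (_ : s + m%:~R + 1 = s + 1 + m%:~R); last by ring.
  rewrite cint_translate //; last by rewrite lerDl.
  by apply: eq_cint => x _; rewrite fZ.
rewrite (@cint_chasles _ f s 1 (s + 1)) //; last by rewrite s1 lerDr.
rewrite [in X in _ + X](addrC s 1) (_ : cint f 1 (1 + s) = cint f 0 s); last first.
  rewrite -[X in cint f X _](add0r 1) (addrC 1 s) cint_translate //.
  exact: eq_cint.
by rewrite addrC -cint_chasles // s0.
Qed.

(** The characters of the cylinder C / Z. *)
Definition chi (n : int) w : R[i] := expC (2 * (pi : R)%:C * 'i * n%:~R * w).

Lemma chiD (m n : int) w : chi (m + n) w = chi m w * chi n w.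
Proof. by rewrite /chi -expCD intrD; congr (expC _ : R[i]); ring. Qed.
Lemma chi_add n w z : chi n (w + z) = chi n w * chi n z.
Proof. by rewrite /chi mulrDr expCD. Qed.
Lemma chi_opp n w : chi n (- w) = chi (- n) w.
Proof. by rewrite /chi intrN; congr (expC _ : R[i]); ring. Qed.
Lemma chi0 w : chi 0 w = 1. Proof. by rewrite /chi mulr0z mulr0 mul0r expC0. Qed.
Lemma chi_0 n : chi n 0 = 1. Proof. by rewrite /chi mulr0 expC0. Qed.
Lemma chi_int (n m : int) : chi n m%:~R = 1.
Proof. by rewrite /chi -mulrA -intrM expC_2piz. Qed.
Lemma chi_1 n : chi n 1 = 1. Proof. exact: (chi_int n 1). Qed.
Lemma chi_per n w : chi n (w + 1) = chi n w.
Proof. by rewrite chi_add chi_1 mulr1. Qed.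
Lemma chi_neq0 n w : chi n w != 0. Proof. exact: expC_neq0. Qed.
Lemma chiV n w : (chi n w)^-1 = chi (- n) w.
Proof.
apply: (mulfI (chi_neq0 n w)); rewrite -chiD subrr chi0 mulfV //.
exact: chi_neq0.
Qed.
Lemma chiX (n : nat) w : chi n w = chi 1 w ^+ n.
Proof. by rewrite /chi -expCMn; congr (expC _ : R[i]); rewrite -pmulrn; ring. Qed.
Lemma nm_chi n w : nm (chi n w) = expR (- (2 * pi * n%:~R * complex.Im w)).
Proof.
rewrite nm_expC; congr expR; case: w => u v.
rewrite (_ : _ * _ = (2 * pi * n%:~R)%:C * 'i * (u +i* v)) /=; first by ring.
by rewrite !rmorphM rmorph_int rmorph_nat; ring.
Qed.
Lemma nm_chi1 w : nm (chi 1 w) = expR (- (2 * pi * complex.Im w)).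
Proof. by rewrite nm_chi (_ : 1%:~R = 1 :> R) // (mulr1 (2 * pi)). Qed.
Lemma cder_chi n w : cder (chi n) w (2 * (pi : R)%:C * 'i * n%:~R * chi n w).
Proof. exact: cder_expC_lin. Qed.
Lemma ccont_chi n w : ccont (chi n) w.
Proof. by have /cder_cont := cder_chi n w. Qed.

Lemma pi_neq0 : (pi : R) != 0. Proof. by rewrite gt_eqF ?pi_gt0. Qed.

Lemma twopii_neq0 : 2 * (pi : R)%:C * 'i != 0 :> R[i].
Proof.
rewrite -nm_eq0 !nmM nm_i nm_real nm_nat mulr1 mulf_neq0 //.
by rewrite normr_eq0 pi_neq0.
Qed.

Lemma sin_eq0_small x : `|x| < pi -> sin x = 0 -> x = 0 :> R.
Proof.
move=> xpi sx; case: (ltrgtP x 0) => // x0.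
  have := @sin_gt0_pi R (- x); rewrite sinN sx oppr0 ltxx.
  by rewrite oppr_gt0 x0 -[- x]gtr0_norm ?oppr_gt0 // normrN xpi => /(_ isT).
have := @sin_gt0_pi R x; rewrite sx ltxx x0 -[x]gtr0_norm // xpi.
by move=> /(_ isT).
Qed.

(** Makes the point [w0] the only pole, in a period, of the kernel of Cauchy's
    formula. *)
Lemma chi1_eq1 w : `|complex.Re w| < 1 -> chi 1 w = 1 -> w = 0.
Proof.
move=> w1 E; have : nm (chi 1 w) = 1 by rewrite E nm1.
rewrite nm_chi1 => /eqP; rewrite -[X in _ == X]expR0 => /eqP/expR_inj/eqP.
rewrite oppr_eq0 mulf_eq0 mulf_eq0 (negPf pi_neq0) pnatr_eq0 /= => /eqP w0.
case: w w0 w1 E => x y /= -> x1; rewrite /chi complexr0 (_ : 1%:~R = 1 :> R[i]) // (mulr1 (2 * _ * _)).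
have -> : 2 * (pi : R)%:C * 'i * x%:C = (2 * pi * x)%:C * 'i :> R[i].
  by rewrite !rmorphM rmorph_nat; ring.
rewrite expC_imag => -[c _].
rewrite (_ : 2 * pi * x = (pi * x) *+ 2) in c; last by rewrite mulr2n; ring.
have s0 : sin (pi * x) = 0.
  apply/eqP; rewrite -sqrf_eq0; apply/eqP.
  by move: c (cos2Dsin2 (pi * x)); rewrite cos_mulr2n mulr2n; lra.
have := sin_eq0_small _ s0; rewrite normrM gtr0_norm ?pi_gt0 //.
rewrite -[ltRHS]mulr1 ltr_pM2l ?pi_gt0 // => /(_ x1)/eqP.
by rewrite mulf_eq0 (negPf pi_neq0) /= => /eqP ->.
Qed.

Definition per1 G := forall w, G (w + 1) = G w.

Definition strip_holo G y1 y2 := forall w, y1 <= complex.Im w <= y2 -> exists l, cder G w l.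

(** The integral of [G] over a period on the horizontal line [Im w = y]. *)
Definition hint G y a := cint (fun x => G (x +i* y)) a (a + 1).

(** The Fourier coefficients on a horizontal line. *)
Definition fcoef G y (n : int) := hint (fun w => G w * chi (- n) w) y 0.

Lemma shift1 x y : (x + 1) +i* y = (x +i* y) + 1 :> R[i].
Proof. by apply/eqP; rewrite eq_complex /= addr0 !eqxx. Qed.

Lemma hint_start G y a : per1 G -> (forall x, ccont G (x +i* y)) ->
  hint G y a = hint G y 0.
Proof.
move=> G1 Gc; rewrite /hint add0r; apply: cint_periodic; last first.
  by move=> x; rewrite shift1 G1.
by move=> x; apply: (@cont_horizontal _ G x x y (fun t _ => Gc t) x); rewrite lexx.
Qed.

(** Goursat's theorem on a period rectangle, whose vertical sides cancel. *)
Lemma hint_indep G y1 y2 a : y1 <= y2 -> per1 G -> strip_holo G y1 y2 ->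
  hint G y1 a = hint G y2 a.
Proof.
move=> y12 G1 Gh; have := @Goursat _ G a (a + 1) y1 y2.
rewrite lerDl ler01 y12 => /(_ isT isT) H.
have : rectint G a (a + 1) y1 y2 = 0 by apply: H => x y hx hy; exact: Gh.
rewrite /rectint (_ : cint _ y1 y2 = cint (fun y => G (a +i* y)) y1 y2).
  by rewrite subrr mulr0 addr0 => /eqP; rewrite subr_eq0 => /eqP.
by apply: eq_cint => y _; rewrite shift1 G1.
Qed.

Lemma hint_chi n y a : n != 0 -> hint (chi n) y a = 0.
Proof.
move=> n0; have n0' : n%:~R != 0 :> R[i] by rewrite intr_eq0.
pose k : R[i] := (2 * (pi : R)%:C * 'i * n%:~R)^-1.
have k0 : 2 * (pi : R)%:C * 'i * n%:~R != 0 :> R[i].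
  by rewrite mulf_neq0 // twopii_neq0.
have D w : cder (fun w => k * chi n w) w (chi n w).
  by apply: (cder_eq (cderZ k (cder_chi n w))); rewrite mulrA mulVf // mul1r.
have a1 : a <= a + 1 by rewrite lerDl.
have := @cint_FTC _ _ (chi n) (0 +i* y) 1 a (a + 1) a1 (fun x _ => D _) (fun x _ => ccont_chi n _).
rewrite mul1r -!horizontalE shift1 chi_per subrr => E.
by rewrite /hint -[RHS]E; apply: eq_cint => x _; rewrite horizontalE.
Qed.

Lemma hint_bound G y a M : (forall x, ccont G (x +i* y)) ->
  (forall x, nm (G (x +i* y)) <= M) -> nm (hint G y a) <= M.
Proof.
move=> Gc GM; have a1 : a <= a + 1 by rewrite lerDl.
have := @cint_bound _ (fun x => G (x +i* y)) a (a + 1) M a1.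
rewrite (_ : M * (a + 1 - a) = M); last by ring.
by apply=> [|x _]; [apply: cont_horizontal => x _; exact: Gc|exact: GM].
Qed.

Lemma hintD F G y a : (forall x, ccont F (x +i* y)) -> (forall x, ccont G (x +i* y)) ->
  hint (fun w => F w + G w) y a = hint F y a + hint G y a.
Proof. by move=> Fc Gc; apply: cintD; apply: cont_horizontal => x _. Qed.

Lemma hintZ (k : R[i]) G y a : (forall x, ccont G (x +i* y)) ->
  hint (fun w => k * G w) y a = k * hint G y a.
Proof. by move=> Gc; apply: cintZ; apply: cont_horizontal => x _. Qed.

Lemma eq_hint F G y a : (forall x, F (x +i* y) = G (x +i* y)) -> hint F y a = hint G y a.
Proof. by move=> FG; apply: eq_cint => x _; exact: FG. Qed.

(** Integrals against the geometric kernel X^N / (1 - X), where |X| is constant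
    along the line: the N-th one is the remainder of the Fourier series. *)
Definition geo G X (N : nat) y a := hint (fun w => G w * (X w ^+ N / (1 - X w))) y a.

Lemma one_sub_neq0 w r : nm w = r -> r < 1 -> 1 - w != 0.
Proof.
move=> wr r1; rewrite subr_eq0; apply/eqP => E.
by move: r1; rewrite -wr -E nm1 ltxx.
Qed.

Section Geo.
Variables (G X : R[i] -> R[i]) (y a r : R).
Hypotheses (Gc : forall x, ccont G (x +i* y)) (Xc : forall x, ccont X (x +i* y)).
Hypotheses (Xr : forall x, nm (X (x +i* y)) = r) (r1 : r < 1).

Let X1 x : 1 - X (x +i* y) != 0. Proof. exact: one_sub_neq0 (Xr x) r1. Qed.

Lemma ccontX F w (n : nat) : ccont F w -> ccont (fun z => F z ^+ n) w.
Proof.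
move=> Fc; elim: n => [|n IH]; first exact: ccont_cst.
rewrite (_ : (fun z => _) = (fun z => F z * F z ^+ n)); first exact: ccontM.
by apply/funext => z; rewrite exprS.
Qed.

Lemma geo_cont N x : ccont (fun w => G w * (X w ^+ N / (1 - X w))) (x +i* y).
Proof.
apply: ccontM => //; apply: ccontM; first exact: ccontX.
by apply: ccontV => //; apply: ccontD; [exact: ccont_cst|exact: ccontN].
Qed.

Lemma geo_step N : geo G X N y a = hint (fun w => G w * X w ^+ N) y a + geo G X N.+1 y a.
Proof.
rewrite /geo -hintD; first by apply: eq_hint => x; have := X1 x; move=> h; rewrite exprS; field.
  by move=> x; apply: ccontM => //; exact: ccontX.
by move=> x; exact: geo_cont.
Qed.

Lemma geo_bound N M : (forall x, nm (G (x +i* y)) <= M) ->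
  nm (geo G X N y a) <= M * (r ^+ N / (1 - r)).
Proof.
move=> GM; apply: hint_bound => x; first exact: geo_cont.
have r0 : 0 <= r by rewrite -(Xr 0) nm_ge0.
rewrite nmM ler_pM ?nm_ge0 // nm_div nmX Xr ler_wpM2l ?exprn_ge0 // lef_pV2.
- by have := ler_nm_dist 1 (X (x +i* y)); rewrite nm1 Xr.
- by rewrite posrE nm_gt0.
- by rewrite posrE subr_gt0.
Qed.

End Geo.

Lemma pow_small (r C e : R) : 0 <= r < 1 -> 0 < e -> 0 <= C ->
  exists N : nat, C * r ^+ N <= e.
Proof.
move=> /andP[r0 r1] e0 C0; have : (fun n => C * r ^+ n) @ \oo --> (0 : R).
  rewrite -(mulr0 C); apply: cvgM; first exact: cvg_cst.
  by apply: cvg_expr; rewrite ger0_norm.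
move=> /cvgrPdist_lt/(_ _ e0)[N _ NP]; exists N.
by have := NP N (leqnn N); rewrite /= sub0r normrN => /ltW; apply: le_trans; rewrite ler_norm.
Qed.

Section CauchyCylinder.
Variables (G : R[i] -> R[i]) (y1 y2 : R) (w0 : R[i]).
Hypotheses (G1 : per1 G) (Gh : strip_holo G y1 y2).
Hypotheses (w01 : y1 < complex.Im w0) (w02 : complex.Im w0 < y2).

Let y12 : y1 < y2. Proof. exact: lt_trans w01 w02. Qed.
Let a := complex.Re w0 - 1 / 2.
Let Xd w := chi 1 (w0 - w).
Let Xu w := chi 1 (w - w0).

Let Xd_cont w : ccont Xd w.
Proof.
apply: (@ccont_comp _ (chi 1) (fun w => w0 - w)); last exact: ccont_chi.
by apply: ccontD; [exact: ccont_cst|apply: ccontN; exact: ccont_id].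
Qed.

Let Xu_cont w : ccont Xu w.
Proof.
apply: (@ccont_comp _ (chi 1) (fun w => w - w0)); last exact: ccont_chi.
by apply: ccontD; [exact: ccont_id|exact: ccont_cst].
Qed.

Let r1 := expR (- (2 * pi * (complex.Im w0 - y1))).
Let r2 := expR (- (2 * pi * (y2 - complex.Im w0))).

Let r1_lt1 : r1 < 1.
Proof. by rewrite expR_lt1 oppr_lt0 !mulr_gt0 ?pi_gt0 // subr_gt0. Qed.
Let r2_lt1 : r2 < 1.
Proof. by rewrite expR_lt1 oppr_lt0 !mulr_gt0 ?pi_gt0 // subr_gt0. Qed.

Let Xd_nm x : nm (Xd (x +i* y1)) = r1.
Proof. by rewrite nm_chi1 raddfB. Qed.
Let Xu_nm x : nm (Xu (x +i* y2)) = r2.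
Proof. by rewrite nm_chi1 raddfB. Qed.

Let Gcont w : y1 <= complex.Im w <= y2 -> ccont G w.
Proof. by move=> /Gh[l /cder_cont]. Qed.

Let hint_powd (n : nat) : hint (fun w => 1 * Xd w ^+ n.+1) y1 a = 0.
Proof.
rewrite (@eq_hint _ (fun w => chi n.+1%:Z w0 * chi (- n.+1%:Z) w)); last first.
  by move=> x; rewrite mul1r /Xd -chiX chi_add chi_opp.
rewrite hintZ ?hint_chi ?mulr0 // => x; exact: ccont_chi.
Qed.

Let hint_powu (n : nat) : hint (fun w => 1 * Xu w ^+ n.+1) y2 a = 0.
Proof.
rewrite (@eq_hint _ (fun w => chi (- n.+1%:Z) w0 * chi n.+1%:Z w)); last first.
  by move=> x; rewrite mul1r /Xu -chiX chi_add chi_opp mulrC.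
rewrite hintZ ?hint_chi ?mulr0 // => x; exact: ccont_chi.
Qed.

Let one_cont y x : ccont (fun=> 1 : R[i]) (x +i* y). Proof. exact: ccont_cst. Qed.

Let geo1d : geo (fun=> 1) Xd 1 y1 a = 0.
Proof.
have c x : ccont Xd (x +i* y1) by exact: Xd_cont.
have E N : geo (fun=> 1) Xd 1 y1 a = geo (fun=> 1) Xd N.+1 y1 a.
  elim: N => // N ->.
  by rewrite (geo_step a (one_cont y1) c Xd_nm r1_lt1) hint_powd add0r.
apply: nm_eq0P => e e0.
have r0 : 0 <= r1 by exact: expR_ge0.
have q : 0 < 1 - r1 by rewrite subr_gt0.
have [N NP] : exists N, (1 - r1)^-1 * r1 ^+ N <= e.
  by apply: pow_small; rewrite ?r0 ?invr_ge0 ?ltW.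
rewrite (E N) (le_trans (geo_bound a (one_cont y1) c Xd_nm r1_lt1 N.+1 (M := 1) _)) //.
  by move=> x; rewrite nm1.
rewrite mul1r (le_trans _ NP) // mulrC ler_wpM2l ?invr_ge0 ?(ltW q) //.
by rewrite exprS ler_piMl ?exprn_ge0 // ltW.
Qed.

Let geo1u : geo (fun=> 1) Xu 0 y2 a = 1.
Proof.
have c x : ccont Xu (x +i* y2) by exact: Xu_cont.
have E N : geo (fun=> 1) Xu 1 y2 a = geo (fun=> 1) Xu N.+1 y2 a.
  elim: N => // N ->.
  by rewrite (geo_step a (one_cont y2) c Xu_nm r2_lt1) hint_powu add0r.
have -> : geo (fun=> 1) Xu 0 y2 a = 1 + geo (fun=> 1) Xu 1 y2 a.
  rewrite (geo_step a (one_cont y2) c Xu_nm r2_lt1); congr (_ + _).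
  have a1 : a <= a + 1 by rewrite lerDl.
  have := @cint_FTC _ id (fun=> 1) (0 +i* y2) 1 a (a + 1) a1 (fun x _ => cder_id _)
    (fun x _ => ccont_cst _ _).
  rewrite mul1r -!horizontalE shift1 (_ : a +i* y2 + 1 - (a +i* y2) = 1) => [E1|]; last by ring.
  by rewrite -[RHS]E1; apply: eq_cint => x _; rewrite expr0 mulr1.
rewrite -[RHS]addr0; congr (_ + _).
apply: nm_eq0P => e e0.
have r0 : 0 <= r2 by exact: expR_ge0.
have q : 0 < 1 - r2 by rewrite subr_gt0.
have [N NP] : exists N, (1 - r2)^-1 * r2 ^+ N <= e.
  by apply: pow_small; rewrite ?r0 ?invr_ge0 ?ltW.
rewrite (E N) (le_trans (geo_bound a (one_cont y2) c Xu_nm r2_lt1 N.+1 (M := 1) _)) //.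
  by move=> x; rewrite nm1.
rewrite mul1r (le_trans _ NP) // mulrC ler_wpM2l ?invr_ge0 ?(ltW q) //.
by rewrite exprS ler_piMl ?exprn_ge0 // ltW.
Qed.

(** Cauchy's formula on the cylinder: the kernel X / (1 - X), X = e(w0 - w), has
    one pole in a period, and the integral of (G w - G w0) X / (1 - X), regular
    there, over the boundary of a period rectangle vanishes. *)
Lemma Cauchy_cylinder : G w0 = geo G Xd 1 y1 a + geo G Xu 0 y2 a.
Proof.
have hw0 : y1 <= complex.Im w0 <= y2 by rewrite (ltW w01) (ltW w02).
have [l] := Gh hw0.
case=> phi [phiE _ phic].
have dX : cder (fun w => 1 - Xd w) w0 (2 * (pi : R)%:C * 'i).
  apply: (cder_eq (cderB (cder_cst 1 w0) (cder_comp (f := chi 1)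
    (g := fun w => w0 - w) (cderB (cder_cst w0 w0) (cder_id w0)) (cder_chi 1 _)))).
  by rewrite subrr chi_0; ring.
case: dX => psi [psiE psi0 psic].
have Xw0 : Xd w0 = 1 by rewrite /Xd subrr chi_0.
have psiE' w : 1 - Xd w = psi w * (w - w0) by rewrite -psiE Xw0 subrr subr0.
have Xneq w : `|complex.Re w - complex.Re w0| < 1 -> w != w0 -> 1 - Xd w != 0.
  move=> h ww0; rewrite subr_eq0 eq_sym; apply/eqP => E.
  have := chi1_eq1 _ E; rewrite raddfB distrC => /(_ h)/eqP.
  by rewrite subr_eq0 eq_sym (negPf ww0).
(* K is the extension of (G w - G w0) X / (1 - X) to w0: G w - G w0 and 1 - X are
   multiples of w - w0 by the continuous functions phi and psi. *)
pose K w := phi w * (Xd w / psi w).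
have KE w : `|complex.Re w - complex.Re w0| < 1 -> w != w0 ->
    K w = (G w - G w0) * (Xd w / (1 - Xd w)).
  move=> h ww0; have := Xneq w h ww0; rewrite /K phiE psiE' => X0.
  move: X0; rewrite mulf_eq0 negb_or => /andP[p0 q0]; field; by rewrite p0 q0.
have ain x : a <= x <= a + 1 -> `|x - complex.Re w0| < 1.
  by rewrite /a => h; rewrite ltr_norml; lra.
have Kd x y : a <= x <= a + 1 -> y1 <= y <= y2 -> x +i* y != w0 -> exists l, cder K (x +i* y) l.
  move=> hx hy ww0; have [m Gm] := Gh (w := x +i* y) hy.
  have X0 := Xneq (x +i* y) (ain _ hx) ww0.
  have dXd : cder Xd (x +i* y) ((2 * (pi : R)%:C * 'i * 1%:~R * chi 1 (w0 - (x +i* y))) * (0 - 1)).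
    by apply: (cder_comp (f := chi 1) (g := fun w => w0 - w));
      [exact: cderB (cder_cst _ _) (cder_id _)|exact: cder_chi].
  have [m' d0] : exists m', cder (fun w => (G w - G w0) * (Xd w * (1 - Xd w)^-1)) (x +i* y) m'.
    eexists; apply: cderM; first exact: (cderB Gm (cder_cst _ _)).
    apply: cderM; first exact: dXd.
    by apply: cderV => //; exact: (cderB (cder_cst _ _) dXd).
  have p1 : 0 < 1 - `|x - complex.Re w0| by rewrite subr_gt0 ain.
  have p2 : 0 < nm (x +i* y - w0) by rewrite nm_gt0 subr_eq0.
  have [d [d'0 h1 h2]] := minr_pos p1 p2.
  exists m'; apply: (@cder_ext _ _ _ _ _ d _ _ d0) => // w wd; rewrite KE //.
    have := Re_le_nm (w - (x +i* y)); rewrite raddfB /= => h3.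
    rewrite (_ : _ - _ = (complex.Re w - x) + (x - complex.Re w0)); last by ring.
    by rewrite (le_lt_trans (ler_normD _ _)) //; lra.
  apply/eqP => E; move: wd; rewrite E nm_distC; lra.
have Kc0 : ccont K w0.
  apply: ccontM => //; apply: ccontM; first exact: Xd_cont.
  by apply: ccontV => //; rewrite psi0 twopii_neq0.
have w0E : w0 = complex.Re w0 +i* complex.Im w0 by case: (w0).
have Kc : contrect K a (a + 1) y1 y2.
  move=> x y hx hy; case: (eqVneq (x +i* y) w0) => [->//|/(Kd x y hx hy)[m]].
  by move=> /cder_cont.
have K0 : rectint K a (a + 1) y1 y2 = 0.
  apply: (@Goursat_except _ _ _ _ _ _ (complex.Re w0) (complex.Im w0)) => //.
  - by rewrite /a; lra.
  - by rewrite w01.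
  - by move=> x y hx hy; rewrite -w0E => /eqP; exact: Kd.
have Kside y : K ((a + 1) +i* y) = K (a +i* y).
  have h1 : `|complex.Re (a +i* y) - complex.Re w0| < 1 by apply: (ain a); rewrite lexx lerDl ler01.
  have h2 : `|complex.Re ((a + 1) +i* y) - complex.Re w0| < 1 by apply: (ain (a + 1)); rewrite lexx lerDl ler01.
  rewrite !KE //.
  - have -> : Xd ((a + 1) +i* y) = Xd (a +i* y).
      by rewrite /Xd shift1 -[LHS]chi_per; congr (chi _ _); ring.
    by rewrite shift1 G1.
  - by apply/eqP => E; move: (congr1 (@complex.Re R) E); rewrite /= /a; lra.
  - by apply/eqP => E; move: (congr1 (@complex.Re R) E); rewrite /= /a; lra.
have : hint K y1 a - hint K y2 a = 0.
  rewrite -K0 /rectint /hint (_ : cint (fun y => K ((a + 1) +i* y)) y1 y2 =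
    cint (fun y => K (a +i* y)) y1 y2) ?subrr ?mulr0 ?addr0 //.
  by apply: eq_cint => y _; exact: Kside.
have c1 x : ccont G (x +i* y1) by apply: Gcont; rewrite /= lexx ltW.
have c2 x : ccont G (x +i* y2) by apply: Gcont; rewrite /= lexx ltW.
have cXd x : ccont Xd (x +i* y1) by exact: Xd_cont.
have cXu x : ccont Xu (x +i* y2) by exact: Xu_cont.
have -> : hint K y1 a = geo G Xd 1 y1 a - G w0 * geo (fun=> 1) Xd 1 y1 a.
  rewrite /geo -mulN1r mulrA -hintZ -?hintD.
  - apply: eq_cint => x hx; rewrite KE ?ain //; first by rewrite expr1; ring.
    by apply/eqP => E; move: w01; rewrite -E /= ltxx.
  - by move=> x; exact: (geo_cont c1 cXd Xd_nm r1_lt1).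
  - move=> x; apply: ccontM; first exact: ccont_cst.
    exact: (geo_cont (one_cont y1) cXd Xd_nm r1_lt1).
  - by move=> x; exact: (geo_cont (one_cont y1) cXd Xd_nm r1_lt1).
have -> : hint K y2 a = - geo G Xu 0 y2 a + G w0 * geo (fun=> 1) Xu 0 y2 a.
  rewrite /geo -mulN1r -!hintZ -?hintD.
  - apply: eq_cint => x hx.
    have ww0 : x +i* y2 != w0 by apply/eqP => E; move: w02; rewrite -E /= ltxx.
    rewrite KE ?ain //.
    have E : Xd (x +i* y2) = (Xu (x +i* y2))^-1 by rewrite /Xd -opprB chi_opp chiV.
    have u0 : Xu (x +i* y2) != 0 by exact: chi_neq0.
    have u1 : 1 - Xu (x +i* y2) != 0 by exact: one_sub_neq0 (Xu_nm x) r2_lt1.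
    have u2 : Xu (x +i* y2) - 1 != 0 by rewrite -opprB oppr_eq0.
    by rewrite E expr0; field; rewrite u0 u1 u2.
  - move=> x; apply: ccontM; first exact: ccont_cst.
    exact: (geo_cont c2 cXu Xu_nm r2_lt1).
  - move=> x; apply: ccontM; first exact: ccont_cst.
    exact: (geo_cont (one_cont y2) cXu Xu_nm r2_lt1).
  - by move=> x; exact: (geo_cont c2 cXu Xu_nm r2_lt1).
  - by move=> x; exact: (geo_cont (one_cont y2) cXu Xu_nm r2_lt1).
rewrite geo1d geo1u mulr0 mulr1 subr0 opprD opprK addrA => /eqP.
by rewrite subr_eq0 => /eqP ->.
Qed.

Lemma fcoef_start F y n : per1 F -> (forall x, ccont F (x +i* y)) ->
  hint (fun w => F w * chi (- n) w) y a = fcoef F y n.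
Proof.
move=> F1 Fc; apply: hint_start => [w|x]; first by rewrite F1 chi_per.
by apply: ccontM => //; exact: ccont_chi.
Qed.

(** The Laurent expansion, with the remainders of the two geometric kernels. *)
Lemma Laurent_cylinder M1 M2 N N' : (forall x, nm (G (x +i* y1)) <= M1) ->
  (forall x, nm (G (x +i* y2)) <= M2) ->
  nm (G w0 - (\sum_(1 <= n < N.+1) fcoef G y1 n%:Z * chi n%:Z w0 +
      \sum_(0 <= n < N') fcoef G y2 (- n%:Z) * chi (- n%:Z) w0)) <=
    M1 * (r1 ^+ N.+1 / (1 - r1)) + M2 * (r2 ^+ N' / (1 - r2)).
Proof.
move=> G1M G2M.
have c1 x : ccont G (x +i* y1) by apply: Gcont; rewrite /= lexx ltW.
have c2 x : ccont G (x +i* y2) by apply: Gcont; rewrite /= lexx ltW.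
have cXd x : ccont Xd (x +i* y1) by exact: Xd_cont.
have cXu x : ccont Xu (x +i* y2) by exact: Xu_cont.
have E1 k : geo G Xd 1 y1 a =
    \sum_(1 <= n < k.+1) fcoef G y1 n%:Z * chi n%:Z w0 + geo G Xd k.+1 y1 a.
  elim: k => [|k ->]; first by rewrite big_geq ?add0r.
  rewrite [in RHS]big_nat_recr //= -[RHS]addrA; congr (_ + _).
  rewrite (geo_step a c1 cXd Xd_nm r1_lt1); congr (_ + _).
  rewrite -fcoef_start // mulrC -hintZ; last first.
    by move=> x; apply: ccontM => //; exact: ccont_chi.
  by apply: eq_hint => x; rewrite /Xd -chiX chi_add chi_opp; ring.
have E2 k : geo G Xu 0 y2 a =
    \sum_(0 <= n < k) fcoef G y2 (- n%:Z) * chi (- n%:Z) w0 + geo G Xu k y2 a.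
  elim: k => [|k ->]; first by rewrite big_geq ?add0r.
  rewrite [in RHS]big_nat_recr //= -[RHS]addrA; congr (_ + _).
  rewrite (geo_step a c2 cXu Xu_nm r2_lt1); congr (_ + _).
  rewrite -fcoef_start // mulrC -hintZ; last first.
    by move=> x; apply: ccontM => //; exact: ccont_chi.
  by apply: eq_hint => x; rewrite /Xu -chiX chi_add chi_opp opprK; ring.
rewrite Cauchy_cylinder (E1 N) (E2 N') (_ : _ - _ = geo G Xd N.+1 y1 a + geo G Xu N' y2 a); last by ring.
rewrite (le_trans (nmD _ _)) // lerD //; first exact: (geo_bound a c1 cXd Xd_nm r1_lt1).
exact: (geo_bound a c2 cXu Xu_nm r2_lt1).
Qed.

End CauchyCylinder.

End Periodic.

(** * Expansions at the cusp, Taylor estimates, uniform limits *)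

Section Holomorphic.
Variable R : realType.
Implicit Types (F G : R[i] -> R[i]) (w z h : R[i]) (x y M e rho : R).

Definition holo (U : R[i] -> Prop) F := forall z, U z -> exists l, cder F z l.

Definition upto0 G := forall e, 0 < e -> exists Y : R, forall w, Y < complex.Im w -> nm (G w) <= e.

(** The Taylor expansion at the end of the cylinder, where the coefficients of
    negative index vanish because [G] tends to 0. *)
Theorem Fourier_cusp G b y1 M w N :
  per1 G -> holo (fun z => b < complex.Im z) G -> upto0 G ->
  b < y1 -> y1 < complex.Im w -> (forall x, nm (G (x +i* y1)) <= M) ->
  nm (G w - \sum_(1 <= n < N.+1) fcoef G y1 n%:Z * chi n%:Z w) <=
  M * (expR (- (2 * pi * (complex.Im w - y1))) ^+ N.+1 /
       (1 - expR (- (2 * pi * (complex.Im w - y1))))).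
Proof.
move=> G1 Gh G0 by1 y1w GM; apply/ler_addgt0Pl => e e0.
set K := (1 - expR (- (2 * pi))) : R.
have K0 : 0 < K by rewrite subr_gt0 expR_lt1 oppr_lt0 mulr_gt0 ?pi_gt0.
have [Y YP] := G0 _ (mulr_gt0 e0 K0).
pose y2 := Num.max (Y + 1) (complex.Im w + 1).
have [h1 h2] : Y + 1 <= y2 /\ complex.Im w + 1 <= y2 by rewrite !le_max !lexx orbT.
have Gs : strip_holo G y1 y2 by move=> z /andP[hz _]; apply: Gh; exact: lt_le_trans by1 hz.
have y2w : complex.Im w < y2 by lra.
have G2M x : nm (G (x +i* y2)) <= e * K by apply: YP => /=; lra.
have := Laurent_cylinder G1 Gs y1w y2w N 0 GM G2M.
rewrite [\sum_(0 <= n < 0) _]big_geq // addr0 expr0 => /le_trans -> //; rewrite addrC lerD //.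
have q : 0 < 1 - expR (- (2 * pi * (y2 - complex.Im w))).
  by rewrite subr_gt0 expR_lt1 oppr_lt0 !mulr_gt0 ?pi_gt0 // subr_gt0.
rewrite mulrA mulr1 ler_pdivrMr // ler_wpM2l ?(ltW e0) //.
by rewrite lerD2l lerN2 ler_expR lerN2 -[leLHS]mulr1 ler_pM2l ?mulr_gt0 ?pi_gt0 //; lra.
Qed.

(** Cauchy's estimate for the Fourier coefficients. *)
Lemma fcoef_bound G b y1 M n : holo (fun z => b < complex.Im z) G -> b < y1 ->
  (forall x, nm (G (x +i* y1)) <= M) -> nm (fcoef G y1 n) <= M * expR (2 * pi * n%:~R * y1).
Proof.
move=> Gh by1 GM; apply: hint_bound => x.
  apply: ccontM; last exact: ccont_chi.
  by have [l /cder_cont] := Gh (x +i* y1) by1.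
rewrite nmM nm_chi intrN mulrN mulNr opprK /=.
by apply: ler_pM => //; exact: nm_ge0.
Qed.

(** Every point of a punctured disc around [z0] is of the form [z0 + rho * chi 1
    w]. *)
Lemma polar (u : R[i]) : u != 0 -> exists w, chi 1 w = u.
Proof.
move=> u0; have p : 0 < nm u by rewrite nm_gt0.
have [th thE] : exists th : R, u = (nm u)%:C * (cos th +i* sin th).
  pose v := u / (nm u)%:C; have nu0 : (nm u)%:C != 0 :> R[i] by rewrite -nm_gt0 nm_real gtr0_norm.
  have uE : u = (nm u)%:C * v by rewrite /v mulrC divfK.
  have v1 : nm v = 1 by rewrite nm_div nm_real gtr0_norm // divff // gt_eqF.
  have := nm_sqr v; rewrite v1 expr1n; case: v uE {v1} => c s uE /= cs.
  have c1 : -1 <= c <= 1 by rewrite -ler_norml -(ler_pXn2r (n:=2)) ?nnegrE // expr1n real_normK ?num_real // cs lerDl sqr_ge0.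
  have sE : sin (acos c) = `|s|.
    by rewrite sin_acos // (_ : 1 - c ^+ 2 = s ^+ 2) ?sqrtr_sqr //; rewrite cs; ring.
  have cE : cos (acos c) = c by rewrite acosK // in_itv.
  case: (leP 0 s) => s0.
    by exists (acos c); rewrite cE sE ger0_norm.
  by exists (- acos c); rewrite cosN sinN cE sE ltr0_norm // opprK.
exists ((2 * (pi : R)%:C * 'i)^-1 * ((ln (nm u))%:C + th%:C * 'i)).
have k0 := twopii_neq0 R.
rewrite /chi (_ : 1%:~R = 1 :> R[i]) // (mulr1 (2 * _ * _)) mulrA mulfV // mul1r expCD.
rewrite expC_imag {2}thE; congr (_ * _).
by rewrite expCE /= cos0 sin0 mulr1 mulr0 lnK // posrE.
Qed.

(** Taylor's formula of order 2 with explicit constants, from the expansion at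
    the cusp of z0 + rho * chi 1 w. *)
Theorem Taylor2 F z0 rho M l : 0 < rho ->
  (forall z, nm (z - z0) < rho -> (exists l, cder F z l) /\ nm (F z) <= M) ->
  cder F z0 l ->
  nm l <= 4 * M / rho /\
  forall h, nm h <= rho / 4 -> nm (F (z0 + h) - F z0 - l * h) <= 16 * M / rho ^+ 2 * nm h ^+ 2.
Proof.
move=> rho0 FM Fl; pose G w := F (z0 + rho%:C * chi 1 w) - F z0.
have M0 : 0 <= M by apply: le_trans (nm_ge0 (F z0)) (FM z0 _).2; rewrite subrr nm0.
have nmc w : nm (z0 + rho%:C * chi 1 w - z0) = rho * expR (- (2 * pi * complex.Im w)).
  by rewrite addrAC subrr add0r nmM nm_real gtr0_norm // nm_chi1.
have inb w : 0 < complex.Im w -> nm (z0 + rho%:C * chi 1 w - z0) < rho.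
  move=> hw; rewrite nmc -[ltRHS]mulr1 ltr_pM2l // expR_lt1 oppr_lt0.
  by rewrite !mulr_gt0 ?pi_gt0.
have G1 : per1 G by move=> w; rewrite /G chi_per.
have Gh : holo (fun z => 0 < complex.Im z) G.
  move=> w hw; have [[m Fm] _] := FM _ (inb w hw); eexists.
  apply: cderB; last exact: cder_cst.
  apply: (@cder_comp _ F (fun w => z0 + rho%:C * chi 1 w)); last exact: Fm.
  by apply: cderD; [exact: cder_cst|apply: cderZ; exact: cder_chi].
have G0 : upto0 G.
  move=> e e0; have [d d0 dP] := @cder_cont _ _ _ _ Fl e e0.
  have q : 0 < d / rho by rewrite divr_gt0.
  exists (- ln (d / rho) / (2 * pi)) => w hw; apply: ltW; apply: dP.
  rewrite nmc (mulrC rho) -ltr_pdivlMr // -[ltRHS]lnK ?posrE // ltr_expR ltrNl.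
  by rewrite [ltRHS]mulrC -ltr_pdivrMr ?mulr_gt0 ?pi_gt0.
(* The line Im w = y1 is the circle of radius rho / 2. *)
pose y1 := ln 2 / (2 * pi) : R.
have pi2 : 0 < 2 * pi :> R by rewrite mulr_gt0 ?pi_gt0.
have E2 : expR (2 * pi * y1) = 2 :> R.
  by rewrite /y1 mulrC divfK ?gt_eqF // lnK // posrE.
have y10 : 0 < y1 by rewrite divr_gt0 // ln_gt0 // ltr1n.
have GM x : nm (G (x +i* y1)) <= 2 * M.
  rewrite (le_trans (nmB _ _)) // (_ : 2 * M = M + M) ?lerD //; last by ring.
    by apply: (FM _ _).2; exact: inb.
  by apply: (FM z0 _).2; rewrite subrr nm0.
pose m := fcoef G y1 1 / rho%:C.
have mM : nm m <= 4 * M / rho.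
  rewrite nm_div nm_real gtr0_norm // ler_pM2r ?invr_gt0 //.
  have := @fcoef_bound G 0 y1 (2 * M) 1 Gh y10 GM.
  by rewrite (_ : 1%:~R = 1 :> R) // (mulr1 (2 * _)) E2 => /le_trans -> //; lra.
have key h : nm h <= rho / 4 -> nm (F (z0 + h) - F z0 - m * h) <= 16 * M / rho ^+ 2 * nm h ^+ 2.
  move=> hr; case: (eqVneq h 0) => [->|h0].
    by rewrite addr0 subrr mulr0 subr0 nm0 expr0n mulr0.
  have rC : rho%:C != 0 :> R[i] by rewrite -nm_gt0 nm_real gtr0_norm.
  have [w wE] := @polar (h / rho%:C) (mulf_neq0 h0 (invr_neq0 rC)).
  have nh : nm h = rho * expR (- (2 * pi * complex.Im w)).
    by rewrite -nm_chi1 wE nm_div nm_real gtr0_norm // mulrC divfK // gt_eqF.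
  have q4 : expR (- (2 * pi * complex.Im w)) <= 1 / 4.
    by rewrite -(ler_pM2l rho0) -nh mulrA mulr1.
  have y1w : y1 < complex.Im w.
    rewrite -(ltr_pM2l pi2) -ltr_expR E2; move: q4; rewrite expRN; set E := expR _.
    have E0 : 0 < E := expR_gt0 _.
    by rewrite -[leLHS]mul1r ler_pdivrMr //; lra.
  have := @Fourier_cusp G 0 y1 (2 * M) w 1 G1 Gh G0 y10 y1w GM.
  rewrite big_nat1 /= wE {1}/G wE mulrC divfK //.
  rewrite (_ : fcoef G y1 1 * (h / rho%:C) = m * h); last by rewrite /m; field.
  set r := expR _.
  have rE : r = 2 * nm h / rho.
    by rewrite /r nh mulrBr opprB expRD E2; field; rewrite gt_eqF.
  move=> /le_trans; apply.
  have r2 : r <= 1 / 2 by rewrite rE ler_pdivrMr //; lra.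
  have r0 : 0 <= r by exact: expR_ge0.
  have -> : 16 * M / rho ^+ 2 * nm h ^+ 2 = 2 * M * (r ^+ 2 * 2).
    by rewrite rE; field; rewrite gt_eqF.
  rewrite ler_wpM2l ?mulr_ge0 // ler_wpM2l ?exprn_ge0 //.
  by rewrite -[leRHS]invrK lef_pV2 ?posrE ?invr_gt0 //; lra.
suff -> : l = m by [].
apply: (cder_unique Fl); apply/cderP => e e0.
pose K := 16 * M / rho ^+ 2 + 1.
have K0 : 0 < K.
  by rewrite ltr_wpDl // divr_ge0 ?exprn_ge0 ?(ltW rho0) // mulr_ge0.
have [d [d0 d1 d2]] : exists d : R, [/\ 0 < d, d <= rho / 4 & d <= e / K].
  by apply: minr_pos; rewrite divr_gt0.
exists d => // w wd; have := key (w - z0); rewrite (addrC z0 (w - z0)) subrK => /(_ (ltW (lt_le_trans wd d1))).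
move=> /le_trans; apply; rewrite expr2 mulrA ler_wpM2r ?nm_ge0 //.
have : nm (w - z0) <= e / K by apply: ltW; exact: lt_le_trans wd d2.
rewrite ler_pdivlMr // => h; apply: le_trans h; rewrite mulrC ler_wpM2l ?nm_ge0 //.
by rewrite /K lerDl.
Qed.

Lemma complex_complete (u : nat -> R[i]) :
  (forall e, 0 < e -> exists N : nat, forall n m : nat, (N <= n)%N -> (N <= m)%N -> nm (u n - u m) <= e) ->
  exists l, forall e, 0 < e -> exists N : nat, forall n : nat, (N <= n)%N -> nm (u n - l) <= e.
Proof.
move=> uc.
have key (v : nat -> R) : (forall n m, `|v n - v m| <= nm (u n - u m)) ->
    exists l : R, v @ \oo --> l.
  move=> vu; suff c : cauchy (v @ \oo) by exact/cvg_ex/(R_complete _ c).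
  apply/cauchy_exP => e /= e0.
  have e20 : 0 < e / 2 by lra.
  have [N NP] := uc _ e20; exists (v N); exists N => // n /= Nn.
  rewrite /ball /= /ball_ /=; have := vu N n; have := NP N n (leqnn N) Nn; lra.
have [n m|a aP] := key (fun n => complex.Re (u n)).
  by rewrite -raddfB Re_le_nm.
have [n m|b bP] := key (fun n => complex.Im (u n)).
  by rewrite -raddfB Im_le_nm.
exists (a +i* b) => e e0; have e20 : 0 < e / 2 by lra.
have /cvgrPdist_lt/(_ _ e20)[N1 _ P1] := aP.
have /cvgrPdist_lt/(_ _ e20)[N2 _ P2] := bP.
exists (maxn N1 N2) => n; rewrite geq_max => /andP[/P1 h1 /P2 h2].
rewrite /= distrC in h1; rewrite /= distrC in h2.
by rewrite (le_trans (nm_le_ReIm _)) // !raddfB /=; lra.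
Qed.

(** Weierstrass: by the Cauchy estimates, uniform convergence of holomorphic
    functions entails convergence of the derivatives and a uniform quadratic
    remainder. *)
Theorem Weierstrass (Fn : nat -> R[i] -> R[i]) F z0 rho : 0 < rho ->
  (forall n z, nm (z - z0) < rho -> exists l, cder (Fn n) z l) ->
  (forall e, 0 < e -> exists N : nat, forall n z, (N <= n)%N -> nm (z - z0) < rho ->
     nm (Fn n z - F z) <= e) ->
  exists l, cder F z0 l.
Proof.
move=> rho0 Fh FnF.
have z0in : nm (z0 - z0) < rho by rewrite subrr nm0.
have /choice[l lP] : forall n, exists l, cder (Fn n) z0 l by move=> n; exact: Fh.
have D n m e : (forall z, nm (z - z0) < rho -> nm (Fn n z - Fn m z) <= e) ->
    nm (l n - l m) <= 4 * e / rho /\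
    forall h, nm h <= rho / 4 -> nm (Fn n (z0 + h) - Fn m (z0 + h) - (Fn n z0 - Fn m z0)
       - (l n - l m) * h) <= 16 * e / rho ^+ 2 * nm h ^+ 2.
  move=> H; apply: (@Taylor2 (fun z => Fn n z - Fn m z)) => // [z hz|].
    split; last exact: H.
    have [a Ha] := Fh n z hz; have [b Hb] := Fh m z hz.
    by exists (a - b); exact: cderB.
  exact: cderB.
have cau e : 0 < e -> exists N : nat, forall n m z, (N <= n)%N -> (N <= m)%N ->
    nm (z - z0) < rho -> nm (Fn n z - Fn m z) <= e.
  move=> e0; have e20 : 0 < e / 2 by lra.
  have [N NP] := FnF _ e20; exists N => n m z hn hm hz.
  have h1 := NP n z hn hz; have h2 := NP m z hm hz; rewrite nm_distC in h2.
  by rewrite (le_trans (nm_trans _ (F z) _)) //; lra.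
have [L LP] : exists L, forall e, 0 < e -> exists N : nat, forall n : nat, (N <= n)%N -> nm (l n - L) <= e.
  apply: complex_complete => e e0; have p : 0 < e * rho / 4 by rewrite !mulr_gt0.
  have [N NP] := cau _ p; exists N => n m hn hm.
  have [h _] := D n m _ (fun z hz => NP n m z hn hm hz).
  by apply: (le_trans h); rewrite ler_pdivrMr //; lra.
have [N NP] := cau 1 ltr01.
pose K := 16 * 1 / rho ^+ 2.
have rem h : nm h < rho / 4 ->
    nm (F (z0 + h) - Fn N (z0 + h) - (F z0 - Fn N z0) - (L - l N) * h) <= K * nm h ^+ 2.
  move=> hr; apply/ler_addgt0Pl => e e0.
  have hin : nm (z0 + h - z0) < rho.
    by rewrite addrAC subrr add0r (lt_trans hr) //; lra.
  have p : 0 < nm h + 1 by rewrite ltr_wpDl ?nm_ge0.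
  have e3 : 0 < e / 3 by lra.
  have [N1 P1] := FnF _ e3; have [N2 P2] := LP _ (divr_gt0 e3 p).
  pose n := maxn N (maxn N1 N2).
  have [n1 n2 n3] : [/\ (N <= n)%N, (N1 <= n)%N & (N2 <= n)%N].
    by rewrite !leq_max !leqnn !orbT.
  have [_ /(_ h (ltW hr)) q] := D n N _ (fun z hz => NP n N z n1 (leqnn N) hz).
  have q1 := P1 n _ n2 hin; have q2 := P1 n _ n2 z0in; have q3 := P2 n n3.
  have q4 : nm ((l n - L) * h) <= e / 3.
    rewrite nmM (le_trans (ler_wpM2r (nm_ge0 h) q3)) //.
    by rewrite mulrAC ler_pdivrMr // ler_wpM2l ?(ltW e3) // lerDl.
  have -> : F (z0 + h) - Fn N (z0 + h) - (F z0 - Fn N z0) - (L - l N) * h =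
     (Fn n (z0 + h) - Fn N (z0 + h) - (Fn n z0 - Fn N z0) - (l n - l N) * h)
     + ((Fn n z0 - F z0) + ((l n - L) * h - (Fn n (z0 + h) - F (z0 + h)))) by ring.
  rewrite (le_trans (nmD _ _)) // addrC lerD // (le_trans (nmD _ _)) //.
  by have := nmB ((l n - L) * h) (Fn n (z0 + h) - F (z0 + h)); lra.
have K0 : 0 < K + 1 by rewrite ltr_wpDl // divr_ge0 ?exprn_ge0 // ltW.
have d1 : cder (fun z => F z - Fn N z) z0 (L - l N).
  apply/cderP => e e0.
  have [d [d0 h1 h2]] : exists d : R, [/\ 0 < d, d <= rho / 4 & d <= e / (K + 1)].
    by apply: minr_pos; rewrite divr_gt0.
  exists d => // z zd; have := rem (z - z0); rewrite (addrC z0 (z - z0)) subrK.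
  move=> /(_ (lt_le_trans zd h1))/le_trans; apply.
  rewrite expr2 mulrA ler_wpM2r ?nm_ge0 //.
  have : nm (z - z0) <= e / (K + 1) by apply: ltW; exact: lt_le_trans zd h2.
  rewrite ler_pdivlMr // => h; apply: le_trans h; rewrite mulrC ler_wpM2l ?nm_ge0 //.
  by rewrite lerDl.
exists L; have := cderD d1 (lP N); rewrite subrK.
by rewrite (_ : (fun w => _) = F) //; apply/funext => w; rewrite subrK.
Qed.

(** The derivative is a locally uniform limit of difference quotients. *)
Theorem holo_derivative F F' z0 rho : 0 < rho ->
  (forall z, nm (z - z0) < rho -> cder F z (F' z)) -> exists l, cder F' z0 l.
Proof.
move=> rho0 Fd.
have z0in : nm (z0 - z0) < rho by rewrite subrr nm0.
have [d d0 dP] := @cder_cont _ _ _ _ (Fd z0 z0in) 1 ltr01.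
have [s [s0 sr sd]] := minr_pos rho0 d0.
pose M := nm (F z0) + 1.
have FM z : nm (z - z0) < s -> nm (F z) <= M.
  move=> hz; have := dP _ (lt_le_trans hz sd); have := ler_nm_dist (F z) (F z0).
  by rewrite /M; lra.
have M0 : 0 <= M by rewrite addr_ge0 ?nm_ge0.
pose t := s / 8; have t0 : 0 < t by rewrite divr_gt0.
pose h (n : nat) : R := t / (n.+1)%:R.
have h0 n : 0 < h n by rewrite divr_gt0.
have ht n : h n <= t by rewrite /h ler_piMr ?(ltW t0) // invf_le1 // ler1n.
have nh n : nm (h n)%:C = h n by rewrite nm_real gtr0_norm.
have s20 : 0 < s / 2 by lra.
apply: (@Weierstrass (fun n z => (F (z + (h n)%:C) - F z) / (h n)%:C) F' z0 (s / 2)) => //.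
  move=> n z hz; eexists; apply: cderM; last exact: cder_cst.
  apply: cderB; last by apply: Fd; lra.
  apply: (@cder_comp _ F (fun z => z + (h n)%:C)).
    by apply: cderD; [exact: cder_id|exact: cder_cst].
  apply: Fd; rewrite addrAC (le_lt_trans (nmD _ _)) // nh.
  by have := ht n; rewrite /t; lra.
move=> e e0; pose K := 16 * M / (s / 2) ^+ 2.
have K0 : 0 <= K by rewrite divr_ge0 ?exprn_ge0 ?(ltW s20) // mulr_ge0.
have q : 0 <= K * t / e by rewrite divr_ge0 ?(ltW e0) // mulr_ge0 // ltW.
exists (Num.truncn (K * t / e)) => n z hn hz.
have [_ T] : nm (F' z) <= 4 * M / (s / 2) /\ forall k, nm k <= s / 2 / 4 ->
    nm (F (z + k) - F z - F' z * k) <= 16 * M / (s / 2) ^+ 2 * nm k ^+ 2.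
  apply: Taylor2 => // [w hw|]; last by apply: Fd; lra.
  have h1 : nm (w - z0) < s by rewrite (le_lt_trans (nm_trans _ z _)) //; lra.
  by split; [exists (F' w); apply: Fd; lra|exact: FM].
have hC : (h n)%:C != 0 :> R[i] by rewrite -nm_gt0 nh.
have := T (h n)%:C; rewrite nh => /(_ ltac:(by have := ht n; rewrite /t; lra)).
have -> : (F (z + (h n)%:C) - F z) / (h n)%:C - F' z =
  (F (z + (h n)%:C) - F z - F' z * (h n)%:C) / (h n)%:C by field.
rewrite nm_div nh ler_pdivrMr // => /le_trans; apply.
rewrite -/K (expr2 (h n)) mulrA ler_wpM2r ?(ltW (h0 n)) // /h mulrA ler_pdivrMr ?ltr0Sn //.
rewrite -ler_pdivrMl // (mulrC e^-1) ltW // (lt_le_trans (truncnS_gt _)) //.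
by rewrite ler_nat ltnS.
Qed.

End Holomorphic.

(** * Infinite products *)

Section InfiniteProduct.
Variable R : realType.
Implicit Types (u v a : nat -> R[i]) (w z l : R[i]) (C r e : R) (n m N : nat).

Definition clim u l := forall e, 0 < e ->
  exists N : nat, forall n, (N <= n)%N -> nm (u n - l) <= e.

Lemma clim_unique u l (m : R[i]) : clim u l -> clim u m -> l = m.
Proof.
move=> h1 h2; apply/eqP; rewrite -subr_eq0; apply/eqP/nm_eq0P => e e0.
have e20 : 0 < e / 2 by lra.
have [N1 P1] := h1 _ e20; have [N2 P2] := h2 _ e20.
have := P1 (maxn N1 N2) (leq_maxl _ _); have := P2 (maxn N1 N2) (leq_maxr _ _).
by move=> q2 q1; rewrite (le_trans (nm_trans _ (u (maxn N1 N2)) _)) // nm_distC; lra.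
Qed.

Lemma clim_limn u l : clim u l -> limn (u : nat -> CC R) = l.
Proof.
move=> ul; apply/cvg_lim; first exact: norm_hausdorff.
apply/cvgrPdist_lt => e; rewrite ltcE /= => /andP[/eqP e1 e0].
have e20 : 0 < complex.Re e / 2 by lra.
have [N NP] := ul _ e20; exists N => // n /= /NP h.
by rewrite distrC normc_nm ltcE /= e1 eqxx /=; lra.
Qed.

Lemma clim_bound u l (k : nat) C : clim u l -> (forall n, (k <= n)%N -> nm (u n - u k) <= C) ->
  nm (l - u k) <= C.
Proof.
move=> ul uC; apply/ler_addgt0Pl => e e0; have [N NP] := ul _ e0.
have h1 := NP (maxn N k) (leq_maxl _ _); have h2 := uC (maxn N k) (leq_maxr _ _).
by rewrite nm_distC in h1; rewrite (le_trans (nm_trans _ (u (maxn N k)) _)) // lerD.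
Qed.

Lemma climM u v l (m : R[i]) : clim u l -> clim v m -> clim (fun n => u n * v n) (l * m).
Proof.
move=> ul vm e e0; set A := nm l + nm m + 2.
have A0 : 0 < A by rewrite ltr_wpDl // addr_ge0 ?nm_ge0.
have eA : 0 < e / A by rewrite divr_gt0.
have [d [d0 d1 d2]] := minr_pos ltr01 eA.
have [N1 P1] := ul _ d0; have [N2 P2] := vm _ d0.
exists (maxn N1 N2) => n; rewrite geq_max => /andP[/P1 h1 /P2 h2].
have -> : u n * v n - l * m = (u n - l) * (v n - m) + ((u n - l) * m + l * (v n - m)) by ring.
rewrite (le_trans (nmD _ _)) // (le_trans (lerD (lexx _) (nmD _ _))) // !nmM.
rewrite ler_pdivlMr // in d2; have l0 := nm_ge0 l; have m0 := nm_ge0 m.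
have a0 := nm_ge0 (u n - l); have b0 := nm_ge0 (v n - m).
have q1 : nm (u n - l) * nm (v n - m) <= d * 1 by rewrite ler_pM //; lra.
have q2 : nm (u n - l) * nm m <= d * nm m by rewrite ler_wpM2r.
have q3 : nm l * nm (v n - m) <= d * nm l by rewrite mulrC ler_wpM2r.
by apply: le_trans d2; rewrite /A; lra.
Qed.

Lemma clim_sub u l (s : nat -> nat) : (forall n, (n <= s n)%N) -> clim u l ->
  clim (fun n => u (s n)) l.
Proof.
move=> sn ul e /ul[N NP]; exists N => n hn; apply: NP.
exact: leq_trans hn (sn n).
Qed.

Lemma clim_cst l : clim (fun=> l) l.
Proof. by move=> e e0; exists 0%N => n _; rewrite subrr nm0 ltW. Qed.

Lemma clim_ext u v l : (forall n, u n = v n) -> clim u l -> clim v l.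
Proof. by move=> uv ul e /ul[N NP]; exists N => n /NP; rewrite uv. Qed.

Definition pprod a N := \prod_(1 <= n < N.+1) (1 - a n).
Definition iprod a : R[i] := limn (pprod a : nat -> CC R).

Lemma pprodS a N : pprod a N.+1 = pprod a N * (1 - a N.+1).
Proof. by rewrite /pprod big_nat_recr. Qed.

Lemma pprod0 a : pprod a 0 = 1. Proof. by rewrite /pprod big_geq. Qed.

Lemma pprod_shift a N : pprod a N.+1 = (1 - a 1) * pprod (fun n => a n.+1) N.
Proof.
elim: N => [|N IH]; first by rewrite pprodS !pprod0 mul1r mulr1.
by rewrite pprodS IH pprodS mulrA.
Qed.

Definition geom a C r := forall n, nm (a n) <= C * r ^+ n.
Definition iprod_cst C r : R := expR (C / (1 - r)) * C / (1 - r).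

Section Geom.
Variables (a : nat -> R[i]) (C r : R).
Hypotheses (C0 : 0 <= C) (r0 : 0 <= r) (r1 : r < 1) (ag : geom a C r).

Let q0 : 0 < 1 - r. Proof. by rewrite subr_gt0. Qed.

Lemma pprod_bound N : nm (pprod a N) <= expR (C / (1 - r)).
Proof.
suff : nm (pprod a N) <= expR (C * (r * (1 - r ^+ N) / (1 - r))).
  move=> /le_trans; apply; rewrite ler_expR ler_wpM2l // ler_pdivrMr // mulVf ?gt_eqF //.
  have := exprn_ge0 N r0; have : r * (1 - r ^+ N) <= 1 * (1 - r ^+ N).
    by rewrite ler_wpM2r ?(ltW r1) // subr_ge0 exprn_ile1 // ltW.
  by lra.
elim: N => [|N IH]; first by rewrite pprod0 nm1 expr0 subrr mulr0 mul0r mulr0 expR0.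
have -> : C * (r * (1 - r ^+ N.+1) / (1 - r)) =
    C * (r * (1 - r ^+ N) / (1 - r)) + C * r ^+ N.+1.
  by rewrite exprS; field; rewrite gt_eqF.
rewrite expRD pprodS nmM ler_pM ?nm_ge0 // (le_trans _ (expR_ge1Dx _)) //.
by rewrite (le_trans (nmB _ _)) // nm1 lerD2l.
Qed.

(** The n-th step changes the partial product by at most a constant times [r^n];
    the sum of these changes telescopes to [r^(N+1) (1 - r^k) / (1 - r)], which
    is what the induction bounds. *)
Lemma pprod_cauchy N k : nm (pprod a (N + k) - pprod a N) <= iprod_cst C r * r ^+ N.+1.
Proof.
have B0 : 0 <= expR (C / (1 - r)) * C by rewrite mulr_ge0 ?expR_ge0.
suff : nm (pprod a (N + k) - pprod a N) <= iprod_cst C r * (r ^+ N.+1 * (1 - r ^+ k)).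
  move=> /le_trans; apply; rewrite ler_wpM2l //.
    by rewrite /iprod_cst divr_ge0 // ltW.
  by rewrite ler_piMr ?exprn_ge0 // lerBlDr lerDl exprn_ge0.
elim: k => [|k IH]; first by rewrite addn0 subrr nm0 expr0 subrr !mulr0.
rewrite addnS pprodS mulrBr mulr1 addrAC (le_trans (nmB _ _)) //.
have -> : iprod_cst C r * (r ^+ N.+1 * (1 - r ^+ k.+1)) =
    iprod_cst C r * (r ^+ N.+1 * (1 - r ^+ k)) + expR (C / (1 - r)) * (C * r ^+ (N + k).+1).
  by rewrite /iprod_cst !exprS exprD; field; rewrite gt_eqF.
by rewrite lerD // nmM ler_pM ?nm_ge0 // pprod_bound.
Qed.

Lemma iprodP : clim (pprod a) (iprod a).
Proof.
have [l lP] : exists l, clim (pprod a) l.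
  apply: complex_complete => e e0; have e20 : 0 < e / 2 by lra.
  have K0 : 0 <= iprod_cst C r by rewrite /iprod_cst divr_ge0 ?mulr_ge0 ?expR_ge0 // ltW.
  have r01 : 0 <= r < 1 by rewrite r0.
  have [N NP] := pow_small r01 e20 K0.
  have H n : (N <= n)%N -> nm (pprod a n - pprod a N) <= e / 2.
    move=> hn; rewrite -(subnKC hn) (le_trans (pprod_cauchy _ _)) // (le_trans _ NP) //.
    by rewrite ler_wpM2l // exprS ler_piMl ?exprn_ge0 // ltW.
  exists N => n m /H h1 /H h2; rewrite nm_distC in h2.
  by rewrite (le_trans (nm_trans _ (pprod a N) _)) //; lra.
by rewrite /iprod (clim_limn lP).
Qed.

(** The error depends only on the constants of the geometric bound, so the
    convergence is uniform in any parameter for which these are uniform. *)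
Lemma iprod_rate N : nm (iprod a - pprod a N) <= iprod_cst C r * r ^+ N.+1.
Proof.
apply: (clim_bound iprodP) => n hn; rewrite -(subnKC hn); exact: pprod_cauchy.
Qed.

Lemma geom_shift k : geom (fun n => a (n + k)%N) (C * r ^+ k) r.
Proof. by move=> n; rewrite (le_trans (ag _)) // exprD -mulrA [r ^+ k * _]mulrC. Qed.

End Geom.

Lemma iprod_shift a C r : 0 <= C -> 0 <= r -> r < 1 -> geom a C r ->
  iprod a = (1 - a 1%N) * iprod (fun n => a n.+1).
Proof.
move=> C0 r0 r1 ag; apply: (clim_unique (u := fun n => pprod a n.+1)).
  by apply: (clim_sub (s := S)) => //; exact: iprodP C0 r0 r1 ag.
apply: (clim_ext (u := fun n => (1 - a 1%N) * pprod (fun n => a n.+1) n)).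
  by move=> n; rewrite pprod_shift.
apply: climM; first exact: clim_cst.
have := geom_shift ag 1; rewrite expr1 => h.
apply: (@iprodP _ (C * r) r) => //; first exact: mulr_ge0.
by move=> n; have := h n; rewrite addn1.
Qed.

(** A finite product splits off, and the product of the remaining factors is
    within 1/2 of 1. *)
Lemma iprod_neq0 a C r : 0 <= C -> 0 <= r -> r < 1 -> geom a C r ->
  (forall n, (0 < n)%N -> 1 - a n != 0) -> iprod a != 0.
Proof.
move=> C0 r0 r1 ag an0; have q0 : 0 < 1 - r by rewrite subr_gt0.
have split k : iprod a = pprod a k * iprod (fun n => a (n + k)%N).
  elim: k => [|k IH].
    by rewrite pprod0 mul1r; congr iprod; apply/funext => n; rewrite addn0.
  rewrite IH pprodS -mulrA; congr (_ * _).
  rewrite (iprod_shift _ r0 r1 (geom_shift ag k)) ?mulr_ge0 ?exprn_ge0 //.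
  rewrite add1n; congr (_ * iprod _); apply/funext => n; by rewrite addSnnS.
have r01 : 0 <= r < 1 by rewrite r0.
have K0 : 0 <= iprod_cst C r by rewrite /iprod_cst divr_ge0 ?mulr_ge0 ?expR_ge0 // ltW.
have [k kP] : exists k, iprod_cst C r * r ^+ k <= 1 / 2 by apply: pow_small; lra.
rewrite (split k) mulf_neq0 //.
  rewrite /pprod big_seq_cond; elim/big_ind: _ => [|x y hx hy|i]; first exact: oner_neq0.
    exact: mulf_neq0.
  by rewrite mem_index_iota andbT => /andP[i0 _]; exact: an0.
have Ck0 : 0 <= C * r ^+ k by rewrite mulr_ge0 ?exprn_ge0.
have := iprod_rate Ck0 r0 r1 (geom_shift ag k) 0; rewrite pprod0 expr1.
have h : iprod_cst (C * r ^+ k) r * r <= 1 / 2.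
  apply: le_trans kP; rewrite -[leRHS]mulr1 ler_pM ?(ltW r1) //.
    apply: divr_ge0; last exact: ltW.
    by apply: mulr_ge0 => //; exact: expR_ge0.
  have -> : iprod_cst C r * r ^+ k = expR (C / (1 - r)) * (C * r ^+ k) / (1 - r).
    by rewrite /iprod_cst; ring.
  rewrite /iprod_cst ler_wpM2r ?invr_ge0 ?(ltW q0) // ler_wpM2r //.
  rewrite ler_expR ler_wpM2r ?invr_ge0 ?(ltW q0) // ler_piMr // exprn_ile1 //; exact: ltW.
move=> h2; apply/eqP => E; move: h2; rewrite E add0r nmN nm1; lra.
Qed.

Lemma iprod_mul a b c C r : 0 <= C -> 0 <= r -> r < 1 -> geom a C r -> geom b C r ->
  geom c C r -> (forall n, (1 - a n) * (1 - b n) = 1 - c n) ->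
  iprod a * iprod b = iprod c.
Proof.
move=> C0 r0 r1 ag bg cg abc; apply: (clim_unique (u := pprod c)); last exact: iprodP C0 r0 r1 cg.
apply: (clim_ext (u := fun n => pprod a n * pprod b n)).
  by move=> n; rewrite /pprod -big_split; apply: eq_bigr => i _; rewrite /= abc.
by apply: climM; [exact: iprodP C0 r0 r1 ag|exact: iprodP C0 r0 r1 bg].
Qed.

Lemma iprod_even_odd a C r : 0 <= C -> 0 <= r -> r < 1 -> geom a C r ->
  geom (fun n => a n.*2) C r -> geom (fun n => a n.*2.-1) C r ->
  iprod a = iprod (fun n => a n.*2) * iprod (fun n => a n.*2.-1).
Proof.
move=> C0 r0 r1 ag eg og; apply: (clim_unique (u := fun n => pprod a n.*2)).
  apply: (clim_sub (s := double)); first by move=> n; rewrite -addnn leq_addr.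
  exact: iprodP C0 r0 r1 ag.
apply: (clim_ext (u := fun n => pprod (fun n => a n.*2) n * pprod (fun n => a n.*2.-1) n)).
  elim=> [|n IH]; first by rewrite !pprod0 mulr1.
  by rewrite doubleS !pprodS -IH doubleS /=; ring.
by apply: climM; [exact: iprodP C0 r0 r1 eg|exact: iprodP C0 r0 r1 og].
Qed.

Lemma iprod_holo (a : nat -> R[i] -> R[i]) C r z0 rho : 0 <= C -> 0 <= r -> r < 1 -> 0 < rho ->
  (forall n z, nm (z - z0) < rho -> exists l, cder (a n) z l) ->
  (forall z, nm (z - z0) < rho -> geom (fun n => a n z) C r) ->
  exists l, cder (fun z => iprod (fun n => a n z)) z0 l.
Proof.
move=> C0 r0 r1 rho0 ah ag.
apply: (@Weierstrass _ (fun N z => pprod (fun n => a n z) N) _ z0 rho) => //.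
  move=> N z hz; elim: N => [|N [l IH]].
    exists 0; rewrite (_ : (fun _ => _) = (fun=> 1)); first exact: cder_cst.
    by apply/funext => w; rewrite pprod0.
  have [m Hm] := ah N.+1 z hz; eexists.
  rewrite (_ : (fun _ => _) = (fun w => pprod (fun n => a n w) N * (1 - a N.+1 w))); last first.
    by apply/funext => w; rewrite pprodS.
  by apply: cderM; [exact: IH|exact: (cderB (cder_cst _ _) Hm)].
move=> e e0; have K0 : 0 <= iprod_cst C r.
  by rewrite /iprod_cst divr_ge0 ?mulr_ge0 ?expR_ge0 // subr_ge0 ltW.
have r01 : 0 <= r < 1 by rewrite r0.
have [N NP] := pow_small r01 e0 K0.
exists N => n z hn hz; rewrite nm_distC (le_trans (iprod_rate C0 r0 r1 (ag z hz) n)) //.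
apply: le_trans NP; rewrite ler_wpM2l // -(subnKC (leqW hn)) exprD.
by rewrite ler_piMr ?exprn_ge0 // exprn_ile1 // ltW.
Qed.

End InfiniteProduct.

(** * Theta functions and quasi-periodicity *)

Section QPochhammer.
Variable R : realType.
Implicit Types (q x p z w : R[i]) (n : nat).

(** The q-Pochhammer symbol [(q x; q)_oo]. *)
Definition phi q x : R[i] := iprod (fun n => q ^+ n * x).

Lemma iprod_ext (a b : nat -> R[i]) : (forall n, (0 < n)%N -> a n = b n) -> iprod a = iprod b.
Proof.
move=> ab; suff E : pprod a = pprod b by rewrite /iprod E.
apply/funext => N; rewrite /pprod big_seq_cond [RHS]big_seq_cond; apply: eq_bigr => n.
by rewrite mem_index_iota andbT => /andP[n0 _]; rewrite ab.
Qed.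

Lemma phi_geom q x C : nm x <= C -> geom (fun n => q ^+ n * x) C (nm q).
Proof. by move=> xC n; rewrite nmM nmX mulrC ler_wpM2r ?exprn_ge0 ?nm_ge0. Qed.

Section Fixq.
Variable q : R[i].
Hypothesis q1 : nm q < 1.
Let q0 := nm_ge0 q.

Lemma phi_shift x : phi q x = (1 - q * x) * phi q (q * x).
Proof.
rewrite /phi (iprod_shift (nm_ge0 x) q0 q1 (phi_geom q (lexx _))) expr1.
by congr (_ * iprod _); apply/funext => n; rewrite exprSr mulrA.
Qed.

Lemma phi_neq0 x : (forall n, (0 < n)%N -> 1 - q ^+ n * x != 0) -> phi q x != 0.
Proof. exact: (iprod_neq0 (nm_ge0 x) q0 q1 (phi_geom q (lexx _))). Qed.

Lemma phi1_neq0 : phi q 1 != 0.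
Proof.
apply: phi_neq0 => n n0; rewrite mulr1; apply: (one_sub_neq0 (erefl _)).
by rewrite nmX exprn_ilt1 // -lt0n.
Qed.

Lemma phi_holo x : exists l, cder (phi q) x l.
Proof.
apply: (@iprod_holo _ (fun n x => q ^+ n * x) (nm x + 1) (nm q) x 1) => //.
- by rewrite addr_ge0 ?nm_ge0.
- by move=> n z _; exists (q ^+ n * 1); exact: (cderZ _ (cder_id z)).
- move=> z hz; apply: phi_geom; have := ler_nm_dist z x; lra.
Qed.

(** Euler's identity, the product of [(1 + q^n) (1 - q^(2n-1))] is 1: multiplied
    by the product of [1 - q^n], both sides become the product over the even
    exponents times the one over the odd exponents. *)
Lemma phi_Euler p : p ^+ 2 = q -> p != 0 -> phi q (-1) * (phi q p^-1 * phi q (- p^-1)) = 1.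
Proof.
move=> pq p0; set C := 1 + nm p^-1 + nm (p^-1 ^+ 2).
have [c1 c2 c3] : [/\ 1 <= C, nm p^-1 <= C & nm (p^-1 ^+ 2) <= C].
  by have := nm_ge0 p^-1; have := nm_ge0 (p^-1 ^+ 2); rewrite /C; split; lra.
have C0 : 0 <= C by lra.
have le2 n : nm q ^+ n.*2 <= nm q ^+ n.
  by rewrite -addnn exprD ler_piMr ?exprn_ge0 // exprn_ile1 // ltW.
have one n : nm q ^+ n <= C * nm q ^+ n by rewrite ler_peMl ?exprn_ge0.
have gE : geom (fun n => q ^+ n.*2) C (nm q).
  by move=> n; rewrite nmX (le_trans (le2 n)).
have gO : geom (fun n => q ^+ n.*2.-1) C (nm q).
  move=> n; rewrite nmX (le_trans _ (one n)) //.
  case: n => [|n]; first by rewrite double0.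
  rewrite doubleS /= -addnn -addSn exprD ler_piMr ?exprn_ge0 //.
  by rewrite exprn_ile1 // ltW.
have g1 : geom (fun n => q ^+ n) C (nm q) by move=> n; rewrite nmX.
have gx x : nm x <= C -> geom (fun n => q ^+ n * x) C (nm q) by exact: phi_geom.
have E1 : phi q p^-1 * phi q (- p^-1) = iprod (fun n => q ^+ n.*2.-1).
  rewrite /phi (@iprod_mul _ _ _ (fun n => q ^+ n.*2 * p^-1 ^+ 2) C (nm q)) //.
  - apply: iprod_ext => -[//|n] _; rewrite doubleS /= [in LHS]exprSr -pq -mulrA.
    by rewrite -exprMn divff // expr1n mulr1.
  - exact: gx.
  - by apply: gx; rewrite nmN.
  - move=> n; rewrite nmM nmX (le_trans (ler_wpM2r (nm_ge0 _) (le2 n))) // mulrC.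
    by rewrite ler_wpM2r ?exprn_ge0.
  - by move=> n; rewrite -addnn exprD; ring.
have E2 : phi q 1 = iprod (fun n => q ^+ n).
  by rewrite /phi; congr iprod; apply/funext => n; rewrite mulr1.
have E3 : phi q 1 * phi q (-1) = iprod (fun n => q ^+ n.*2).
  rewrite E2 /phi (@iprod_mul _ _ _ (fun n => q ^+ n.*2) C (nm q)) //.
  - by apply: gx; rewrite nmN nm1.
  - by move=> n; rewrite -addnn exprD; ring.
have E4 : phi q 1 = phi q 1 * phi q (-1) * iprod (fun n => q ^+ n.*2.-1).
  by rewrite E3 E2; exact: (@iprod_even_odd _ (fun n => q ^+ n) C (nm q)).
apply: (mulfI phi1_neq0); rewrite E1 mulr1 mulrA; exact: esym.
Qed.

End Fixq.

End QPochhammer.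

Section Theta.
Variable R : realType.
Implicit Types (z w tau : R[i]) (n : int).

(** The half characters [e^(pi i z)], of period 2. *)
Definition hc z : R[i] := expC ((pi : R)%:C * 'i * z).

Lemma hcD z w : hc (z + w) = hc z * hc w.
Proof. by rewrite /hc mulrDr expCD. Qed.
Lemma hc0 : hc 0 = 1. Proof. by rewrite /hc mulr0 expC0. Qed.
Lemma hcN z : hc (- z) = (hc z)^-1.
Proof. by rewrite /hc mulrN expCN. Qed.
Lemma hc_neq0 z : hc z != 0. Proof. exact: expC_neq0. Qed.
Lemma hc1 : hc 1 = -1. Proof. by rewrite /hc mulr1 expC_pi. Qed.
Lemma hc_half : hc (1 / 2) = 'i.
Proof. by rewrite /hc mulrA mulr1 expC_pihalf. Qed.
Lemma hc_double z : hc (z + z) = chi 1 z.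
Proof. by rewrite /hc /chi; congr (expC _ : R[i]); rewrite mulr1z; ring. Qed.
Lemma hc_sqr z : hc z ^+ 2 = chi 1 z.
Proof. by rewrite expr2 -hcD hc_double. Qed.
Lemma cder_hc z : cder hc z ((pi : R)%:C * 'i * hc z).
Proof. exact: cder_expC_lin. Qed.

(** Jacobi's function [theta_1(z | tau)] without its constant factor: odd, with
    simple zeros at the lattice points [Z + Z tau]. *)
Definition theta tau z : R[i] :=
  (hc z - hc (- z)) * (phi (chi 1 tau) (chi 1 z) * phi (chi 1 tau) (chi 1 (- z))).

Lemma chi_upper tau : 0 < complex.Im tau -> nm (chi 1 tau) < 1.
Proof. by move=> t0; rewrite nm_chi1 expR_lt1 oppr_lt0 !mulr_gt0 ?pi_gt0. Qed.

Lemma theta_per tau z : theta tau (z + 1) = - theta tau z.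
Proof.
rewrite /theta opprD !hcD (hcN 1) hc1 invrN invr1 chi_per.
rewrite (_ : chi 1 (- z + -1) = chi 1 (- z)); first by ring.
by rewrite -[LHS]chi_per subrK.
Qed.

Lemma theta_odd tau z : theta tau (- z) = - theta tau z.
Proof. by rewrite /theta opprK; ring. Qed.

(** The translation by tau multiplies [e^(2 pi i z)] by [q], which moves one
    factor from each product to the other side. *)
Lemma theta_quasi tau z : 0 < complex.Im tau ->
  theta tau (z + tau) = - hc (- tau) * chi (-1) z * theta tau z.
Proof.
move=> t0; have q1 := chi_upper t0; rewrite /theta.
set q := chi 1 tau in q1 *; set x := chi 1 z; have x0 : x != 0 := chi_neq0 1 z.
have xE : chi (-1) z = x^-1 by rewrite -chiV.
have q0 : q != 0 := chi_neq0 1 tau.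
have -> : chi 1 (z + tau) = q * x by rewrite chi_add mulrC.
have -> : chi 1 (- (z + tau)) = (q * x)^-1 by rewrite chi_opp -chiV chi_add mulrC.
rewrite chi_opp xE.
rewrite (phi_shift q1 x) (phi_shift q1 (q * x)^-1).
have -> : q * (q * x)^-1 = x^-1 by field; rewrite q0 x0.
rewrite opprD !hcD !hcN; set k := hc z; set h := hc tau.
have [k0 h0] : k != 0 /\ h != 0 by split; exact: hc_neq0.
have qE : q = h ^+ 2 by rewrite hc_sqr.
have xk : x = k ^+ 2 by rewrite hc_sqr.
rewrite qE xk; field; by rewrite k0 h0.
Qed.

Lemma theta_holo tau z : 0 < complex.Im tau -> exists l, cder (theta tau) z l.
Proof.
move=> t0; have q1 := chi_upper t0.
have dN w : cder (fun w => - w) w (-1) by exact: (cderN (cder_id w)).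
have [l1 h1] := phi_holo q1 (chi 1 z); have [l2 h2] := phi_holo q1 (chi 1 (- z)).
eexists; apply: cderM.
  apply: cderB; first exact: cder_hc.
  by apply: (@cder_comp _ hc (fun w => - w)); [exact: dN|exact: cder_hc].
apply: cderM.
  by apply: (@cder_comp _ (phi (chi 1 tau)) (chi 1)); [exact: cder_chi|exact: h1].
apply: (@cder_comp _ (phi (chi 1 tau)) (fun w => chi 1 (- w))); last exact: h2.
by apply: (@cder_comp _ (chi 1) (fun w => - w)); [exact: dN|exact: cder_chi].
Qed.

Lemma theta0 tau : theta tau 0 = 0.
Proof. by rewrite /theta oppr0 subrr mul0r. Qed.

Lemma theta_der0 tau : 0 < complex.Im tau ->
  cder (theta tau) 0 (2 * (pi : R)%:C * 'i * phi (chi 1 tau) 1 ^+ 2).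
Proof.
move=> t0; have q1 := chi_upper t0.
have dN w : cder (fun w => - w) w (-1) by exact: (cderN (cder_id w)).
have [l1 h1] := phi_holo q1 (chi 1 0); have [l2 h2] := phi_holo q1 (chi 1 (- 0)).
have D1 : cder (fun w => hc w - hc (- w)) 0
    ((pi : R)%:C * 'i * hc 0 - (pi : R)%:C * 'i * hc (- 0) * (-1)).
  apply: cderB; first exact: cder_hc.
  by apply: (@cder_comp _ hc (fun w => - w)); [exact: dN|exact: cder_hc].
have [m2 D2] : exists m2,
    cder (fun w => phi (chi 1 tau) (chi 1 w) * phi (chi 1 tau) (chi 1 (- w))) 0 m2.
  eexists; apply: cderM.
    by apply: (@cder_comp _ (phi (chi 1 tau)) (chi 1)); [exact: cder_chi|exact: h1].
  apply: (@cder_comp _ (phi (chi 1 tau)) (fun w => chi 1 (- w))); last exact: h2.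
  by apply: (@cder_comp _ (chi 1) (fun w => - w)); [exact: dN|exact: cder_chi].
apply: (cder_eq (cderM D1 D2)).
by rewrite oppr0 subrr mul0r addr0 !chi_0 hc0; ring.
Qed.

(** The three values are elementary multiples of the squares of [phi q (-1)],
    [phi q (1/p)] and [phi q (-1/p)] with [p^2 = q], whose product is 1 by
    [phi_Euler]. *)
Lemma theta_half_periods tau : 0 < complex.Im tau ->
  theta tau (1 / 2) != 0 /\
  theta tau (1 / 2) * theta tau (tau / 2) * theta tau ((1 + tau) / 2) = 2 * hc (- tau).
Proof.
move=> t0; have q1 := chi_upper t0; set q := chi 1 tau in q1 *.
pose k := hc (tau / 2); pose p := hc tau.
have [k0 p0] : k != 0 /\ p != 0 by split; exact: hc_neq0.
have pk : p = k ^+ 2 by rewrite /p /k expr2 -hcD; congr hc; field.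
have qp : p ^+ 2 = q by rewrite hc_sqr.
pose J := hc (1 / 2).
have c1 : chi 1 (1 / 2) = -1 :> R[i] by rewrite -hc_double -splitr hc1.
have ii : J ^+ 2 = -1 by rewrite hc_sqr c1.
have i0 : J != 0 := hc_neq0 _.
have Vi : J^-1 = - J by apply: (mulfI i0); rewrite mulfV // mulrN -expr2 ii opprK.
have E1 : theta tau (1 / 2) = 2 * J * phi q (-1) ^+ 2.
  by rewrite /theta chi_opp -chiV c1 invrN invr1 hcN Vi -/q -/J; ring.
have E2 : theta tau (tau / 2) = - k^-1 * phi q p^-1 ^+ 2.
  have c2 : chi 1 (tau / 2) = p by rewrite -hc_sqr -/k pk.
  rewrite /theta chi_opp -chiV c2 hcN -/k -/q (phi_shift q1 p^-1) -qp.
  rewrite (_ : p ^+ 2 * p^-1 = p); last by field.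
  by rewrite pk; field.
have E3 : theta tau ((1 + tau) / 2) = J * k^-1 * phi q (- p^-1) ^+ 2.
  have h3 : hc ((1 + tau) / 2) = J * k by rewrite mulrDl hcD.
  have c3 : chi 1 ((1 + tau) / 2) = - p by rewrite -hc_sqr h3 exprMn ii mulN1r pk.
  rewrite /theta chi_opp -chiV c3 hcN h3 -/q invrN (phi_shift q1 (- p^-1)) -qp.
  rewrite (_ : p ^+ 2 * - p^-1 = - p); last by field.
  by rewrite invfM Vi pk; field.
have Eu := phi_Euler q1 qp p0.
split.
  have P0 : phi q (-1) != 0.
    by apply/eqP => E; move/eqP: Eu; rewrite E mul0r eq_sym oner_eq0.
  by rewrite E1; apply: mulf_neq0; [apply: mulf_neq0; rewrite ?pnatr_eq0|exact: expf_neq0].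
rewrite E1 E2 E3 hcN -/p.
rewrite (_ : _ * _ * _ = - J ^+ 2 * 2 * (k ^+ 2)^-1 *
   (phi q (-1) * (phi q p^-1 * phi q (- p^-1))) ^+ 2); last by field.
by rewrite Eu ii expr1n pk; ring.
Qed.

End Theta.

Section QuasiPeriodic.
Variable R : realType.
Implicit Types (D : R[i] -> R[i]) (z w tau : R[i]) (n : int).

Definition entire D := forall z : R[i], exists l, cder D z l.

Lemma entire_cont D z : entire D -> ccont D z.
Proof. by move=> /(_ z)[l /cder_cont]. Qed.

(** A period is compact. *)
Lemma periodic_bounded D (y : R) : per1 D -> (forall x, ccont D (x +i* y)) ->
  exists M, forall x, nm (D (x +i* y)) <= M.
Proof.
move=> D1 Dc.
have cf : {within `[0, 1], continuous (fun x : R => nm (D (x +i* y)))}.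
  apply: continuous_in_subspaceT => x _; apply/cvgrPdist_lt => e e0.
  have H := @cont_horizontal _ D x x y (fun t _ => Dc t) x.
  have [|d d0 dP] := H _ e e0; first by rewrite lexx.
  apply/nbhs_normP; exists d => // t /=; rewrite distrC => /dP; apply: le_lt_trans.
  by rewrite distrC nm_dist_dist.
have [c _ cP] := EVT_max ler01 cf; exists (nm (D (c +i* y))) => x.
have DN (k : nat) w : D (w + k%:R) = D w.
  by elim: k => [|k IH]; rewrite ?addr0 // -addn1 natrD addrA D1.
have DZ (m : int) w : D (w + m%:~R) = D w.
  case: m => k; first exact: DN.
  by rewrite NegzE mulrNz -[in RHS](subrK (k.+1%:R) w) DN.
pose m := Num.floor x; pose s := x - m%:~R.
have -> : x +i* y = (s +i* y) + m%:~R.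
  rewrite -(rmorph_int (real_complex R)); apply/eqP; rewrite eq_complex /= /s.
  by rewrite subrK addr0 !eqxx.
rewrite DZ; apply: cP; rewrite in_itv /= subr_ge0 floor_le_tmp.
by rewrite lerBlDr addrC -intrD1 ltW // floorD1_gt.
Qed.

(** The Fourier coefficients [c n] of such a function satisfy [c n = - q^(-n) c
    (n+1)], so they all vanish as soon as [c 0] does. *)
Lemma quasi_zero D tau : 0 < complex.Im tau -> entire D -> per1 D ->
  (forall z, D (z + tau) = - chi (-1) z * D z) -> fcoef D 0 0 = 0 -> forall z, D z = 0.
Proof.
move=> t0 De D1 Dt c0 w.
have Dc z : ccont D z by exact: entire_cont.
have Dch n : per1 (fun z => D z * chi n z) by move=> z; rewrite D1 chi_per.
have Dcc n z : ccont (fun z => D z * chi n z) z by apply: ccontM => //; exact: ccont_chi.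
have Dh n y1 y2 : strip_holo (fun z => D z * chi n z) y1 y2.
  move=> z _; have [l Hl] := De z; eexists; apply: cderM; first exact: Hl.
  exact: cder_chi.
have indep y n : fcoef D y n = fcoef D 0 n.
  by case/orP: (le_total y 0) => h; [|apply: esym]; exact: hint_indep.
have rec n : fcoef D 0 n = - (chi (- n) tau * fcoef D 0 (n + 1)).
  rewrite -(indep (complex.Im tau)) /fcoef.
  rewrite -(@hint_start _ _ _ (complex.Re tau) (Dch _)) //.
  rewrite {1}/hint -[X in cint _ X _]add0r (addrC 0) -[X in cint _ _ X](addrC 1).
  rewrite (_ : complex.Re tau + 0 = 0 + complex.Re tau); last by rewrite addrC.
  rewrite cint_translate ?ler01 //; last first.
    by apply: (@cont_horizontal _ (fun z => D z * chi (- n) z)) => x _; exact: Dcc.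
  rewrite -mulNr -hintZ //; rewrite /hint add0r; apply: eq_cint => x _.
  have -> : (x + complex.Re tau) +i* complex.Im tau = (x +i* 0) + tau.
    by case: (tau) => u v; apply/eqP; rewrite eq_complex /= add0r !eqxx.
  rewrite Dt chi_add opprD chiD; ring.
have all0 n : fcoef D 0 n = 0.
  case: n => k.
    elim: k => [//|k IH]; have := rec k; rewrite IH => /esym/eqP.
    rewrite oppr_eq0 mulf_eq0 (negPf (chi_neq0 _ _)) /= => /eqP.
    by rewrite addrC -intS.
  elim: k => [|k IH]; rewrite rec.
    by rewrite (_ : (Negz 0 + 1 = 0)%R) // c0 mulr0 oppr0.
  by rewrite (_ : (Negz k.+1 + 1 = Negz k)%R) ?IH ?mulr0 ?oppr0 // !NegzE; lia.
pose y1 := complex.Im w - 1; pose y2 := complex.Im w + 1.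
have [M1 M1P] := periodic_bounded D1 (fun x => Dc (x +i* y1)).
have [M2 M2P] := periodic_bounded D1 (fun x => Dc (x +i* y2)).
have Ds : strip_holo D y1 y2 by move=> z _; exact: De.
have h1 : y1 < complex.Im w by rewrite /y1; lra.
have h2 : complex.Im w < y2 by rewrite /y2; lra.
apply: nm_eq0P => e e0; pose r : R := expR (- (2 * pi)).
have r0 : 0 <= r by exact: expR_ge0.
have r1 : r < 1 by rewrite expR_lt1 oppr_lt0 mulr_gt0 ?pi_gt0.
have q0 : 0 < 1 - r by rewrite subr_gt0.
have M10 : 0 <= M1 by apply: le_trans (nm_ge0 _) (M1P 0).
have M20 : 0 <= M2 by apply: le_trans (nm_ge0 _) (M2P 0).
have [N NP] : exists N : nat, ((M1 + M2) / (1 - r)) * r ^+ N <= e.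
  by apply: pow_small => //; rewrite ?r0 //; apply: divr_ge0; [exact: addr_ge0|exact: ltW].
have := Laurent_cylinder D1 Ds h1 h2 N N M1P M2P.
rewrite (_ : \sum_(1 <= n < N.+1) _ = 0); last by apply: big1 => i _; rewrite indep all0 mul0r.
rewrite (_ : \sum_(0 <= n < N) _ = 0); last by apply: big1 => i _; rewrite indep all0 mul0r.
rewrite addr0 subr0 (_ : complex.Im w - y1 = 1); last by rewrite /y1; ring.
rewrite (_ : y2 - complex.Im w = 1); last by rewrite /y2; ring.
rewrite mulr1 -/r => /le_trans; apply; apply: le_trans NP.
rewrite [leRHS](_ : _ = M1 * (r ^+ N / (1 - r)) + M2 * (r ^+ N / (1 - r))); last first.
  by field; rewrite gt_eqF.
rewrite lerD2r ler_wpM2l // ler_wpM2r ?invr_ge0 ?(ltW q0) //.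
by rewrite exprS ler_piMl ?exprn_ge0 // ltW.
Qed.

End QuasiPeriodic.

(** * The inversion formula of the eta function *)

Section Differentiable.
Variable R : realType.
Implicit Types (F G : R[i] -> R[i]) (z w : R[i]).

Definition cdf F z := exists l, cder F z l.

Lemma cdf_cst (k : R[i]) z : cdf (fun=> k) z. Proof. by exists 0; exact: cder_cst. Qed.
Lemma cdf_id z : cdf id z. Proof. by exists 1; exact: cder_id. Qed.
Lemma cdfD F G z : cdf F z -> cdf G z -> cdf (fun w => F w + G w) z.
Proof. by move=> [l Fl] [m Gm]; exists (l + m); exact: cderD. Qed.
Lemma cdfB F G z : cdf F z -> cdf G z -> cdf (fun w => F w - G w) z.
Proof. by move=> [l Fl] [m Gm]; exists (l - m); exact: cderB. Qed.
Lemma cdfN F z : cdf F z -> cdf (fun w => - F w) z.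
Proof. by move=> [l Fl]; exists (- l); exact: cderN. Qed.
Lemma cdfM F G z : cdf F z -> cdf G z -> cdf (fun w => F w * G w) z.
Proof. by move=> [l Fl] [m Gm]; exists (l * G z + F z * m); exact: cderM. Qed.
Lemma cdfZ (k : R[i]) F z : cdf F z -> cdf (fun w => k * F w) z.
Proof. by move=> [l Fl]; exists (k * l); exact: cderZ. Qed.
Lemma cdfV F z : F z != 0 -> cdf F z -> cdf (fun w => (F w)^-1) z.
Proof. by move=> Fz [l Fl]; exists (- l / F z ^+ 2); exact: cderV. Qed.
Lemma cdfX F n z : cdf F z -> cdf (fun w => F w ^+ n) z.
Proof. by move=> [l Fl]; exists (n%:R * F z ^+ n.-1 * l); exact: cderX. Qed.
Lemma cdf_comp F G z : cdf G z -> cdf F (G z) -> cdf (fun w => F (G w)) z.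
Proof. by move=> [l Gl] [m Fm]; exists (m * l); exact: cder_comp. Qed.
Lemma cdf_cont F z : cdf F z -> ccont F z.
Proof. by move=> [l /cder_cont]. Qed.

End Differentiable.

Section EtaInversion.
Variable R : realType.
Implicit Types (z w tau : R[i]).

Definition upperP z := 0 < complex.Im z.

Lemma upper_neq0 tau : upperP tau -> tau != 0.
Proof. by move=> t0; apply/eqP => E; move: t0; rewrite /upperP E ltxx. Qed.

Lemma Im_Ninv tau : complex.Im (- tau^-1) = complex.Im tau / nm tau ^+ 2.
Proof. by rewrite nm_sqr; case: tau => x y /=; rewrite opprK. Qed.

Lemma upper_Ninv tau : upperP tau -> upperP (- tau^-1).
Proof.
move=> t0; rewrite /upperP Im_Ninv divr_gt0 // exprn_gt0 // nm_gt0.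
exact: upper_neq0.
Qed.

(** The eta function through the product [phi]; [etaE] identifies it with the
    given one. *)
Definition eta tau : R[i] := hc (tau / 12) * phi (chi 1 tau) 1.

Lemma chi1E w : chi 1 w = expC (2 * (pi : R)%:C * 'i * w).
Proof.
rewrite /chi; have -> : (1%:~R : R[i]) = 1 by [].
by rewrite (mulr1 (2 * (pi : R)%:C * 'i)).
Qed.

Lemma etaE tau : dedekind_eta (tau : CC R) = eta tau.
Proof.
rewrite /dedekind_eta /eta /hc; congr (_ * _).
  by congr (expC _ : R[i]); rewrite mulrA.
rewrite /phi /iprod; congr (limn _); apply/funext => n; apply: eq_bigr => i _.
by rewrite mulr1 chi1E.
Qed.

Lemma eta_neq0 tau : upperP tau -> eta tau != 0.
Proof.
by move=> t0; rewrite mulf_neq0 ?hc_neq0 // phi1_neq0 // chi_upper.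
Qed.

Lemma cder_scale (k : R[i]) z : cder (fun w => k * w) z k.
Proof. by apply: (cder_eq (cderZ k (cder_id z))); rewrite mulr1. Qed.

(** Multiplied by [e^(pi i z)], both sides become 1-periodic with the same
    multiplier under tau, and a linear combination of them without constant
    Fourier coefficient vanishes by [quasi_zero]. *)
Lemma theta_inversion tau : upperP tau -> exists C, forall z,
  hc (- (z ^+ 2 / tau)) * theta (- tau^-1) (z / tau) = C * theta tau z.
Proof.
move=> t0; have t'0 := upper_Ninv t0; have tn := upper_neq0 t0.
pose t' := - tau^-1; pose B z := hc (- (z ^+ 2 / tau)) * theta t' (z / tau).
have B1 z : B (z + 1) = - B z.
  have E := theta_quasi (z / tau - t') t'0; rewrite -/t' subrK in E.
  have -> : B (z + 1) = hc (- ((z + 1) ^+ 2 / tau)) * theta t' (z / tau - t').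
    by rewrite /B; congr (_ * theta _ _); rewrite /t'; field.
  have X0 : - hc (- t') * chi (-1) (z / tau - t') != 0.
    by rewrite mulf_neq0 ?chi_neq0 // oppr_eq0 hc_neq0.
  have -> : theta t' (z / tau - t') = theta t' (z / tau) / (- hc (- t') * chi (-1) (z / tau - t')).
    by rewrite E mulrAC divff // mul1r.
  rewrite /B (_ : hc (- ((z + 1) ^+ 2 / tau)) =
     hc (- (z ^+ 2 / tau)) * (hc (- t') * chi (-1) (z / tau - t'))).
    by move: (hc_neq0 (- t')) (chi_neq0 (-1) (z / tau - t')) => h1 h2; field; rewrite h1 h2.
  by rewrite -chi_opp -hc_double -!hcD; congr hc; rewrite /t'; field.
have Bt z : B (z + tau) = - hc (- tau) * chi (-1) z * B z.
  rewrite /B mulrDl divff // theta_per -mulrN1 (_ : hc (- ((z + tau) ^+ 2 / tau)) =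
     hc (- (z ^+ 2 / tau)) * (hc (- tau) * chi (-1) z)); first by ring.
  by rewrite -chi_opp -hc_double -!hcD; congr hc; field.
have Bh : entire B.
  move=> z; have [l Hl] := theta_holo (z / tau) t'0; eexists; apply: cderM.
    apply: (@cder_comp _ (@hc R) (fun z => - (z ^+ 2 / tau))); last exact: cder_hc.
    by apply: cderN; apply: cderM; [exact: (cderX 2 (cder_id z))|exact: cder_cst].
  apply: (@cder_comp _ (theta t') (fun z => z / tau)); last exact: Hl.
  by apply: cderM; [exact: cder_id|exact: cder_cst].
pose tw (F : R[i] -> R[i]) z := hc z * F z.
have tw1 F : (forall z, F (z + 1) = - F z) -> per1 (tw F).
  by move=> F1 z; rewrite /tw hcD hc1 F1; ring.
have twt F : (forall z, F (z + tau) = - hc (- tau) * chi (-1) z * F z) ->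
    forall z, tw F (z + tau) = - chi (-1) z * tw F z.
  move=> Ft z; rewrite /tw hcD Ft hcN; move: (hc_neq0 tau) => h; field.
  by rewrite h.
have twh F : entire F -> entire (tw F).
  move=> Fh z; have [l Hl] := Fh z; eexists; apply: cderM; first exact: cder_hc.
  exact: Hl.
have [A1 At] : (forall z, theta tau (z + 1) = - theta tau z) /\
    (forall z, theta tau (z + tau) = - hc (- tau) * chi (-1) z * theta tau z).
  by split=> z; [exact: theta_per|exact: theta_quasi].
have Ah : entire (theta tau) by move=> z; exact: theta_holo.
pose a := fcoef (tw (theta tau)) 0 0; pose b := fcoef (tw B) 0 0.
have a0 : a != 0.
  apply/eqP => E; have := quasi_zero t0 (twh _ Ah) (tw1 _ A1) (twt _ At) E (1 / 2).
  by move/eqP; rewrite mulf_eq0 (negPf (hc_neq0 _)) (negPf (theta_half_periods t0).1).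
exists (b / a) => z; pose D z := tw B z + (- (b / a)) * tw (theta tau) z.
have Dh : entire D.
  move=> w; have [l1 h1] := twh _ Bh w; have [l2 h2] := twh _ Ah w; eexists.
  by apply: cderD; [exact: h1|apply: cderZ; exact: h2].
have : D z = 0.
  apply: (@quasi_zero _ D tau t0 Dh).
  - by move=> w; rewrite /D (tw1 _ B1) (tw1 _ A1).
  - by move=> w; rewrite /D (twt _ Bt) (twt _ At); ring.
  rewrite /fcoef (@eq_hint _ _ (fun w => tw B w * chi (- 0) w +
      - (b / a) * (tw (theta tau) w * chi (- 0) w))); last first.
    by move=> x; rewrite /D; ring.
  have c1 x : ccont (fun w => tw B w * chi (- 0) w) (x +i* 0).
    by apply: ccontM; [exact: entire_cont (twh _ Bh)|exact: ccont_chi].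
  have c2 x : ccont (fun w => tw (theta tau) w * chi (- 0) w) (x +i* 0).
    by apply: ccontM; [exact: entire_cont (twh _ Ah)|exact: ccont_chi].
  rewrite hintD ?hintZ // -/a.
    by rewrite -[hint _ _ _]/b mulNr divfK // subrr.
  by move=> x; apply: ccontM; [exact: ccont_cst|exact: c2].
rewrite /D /tw => E; apply: (mulfI (hc_neq0 z)).
rewrite -/t' -/(B z); apply/eqP; rewrite -subr_eq0 -[X in _ == X]E; apply/eqP; ring.
Qed.

(** The derivatives at 0 express the factor [C] of [theta_inversion] as a
    quotient of products [phi], and the points of order 2, which the inversion
    permutes up to sign and periods, give [C^3]. *)
Theorem eta_inversion tau : upperP tau -> eta (- tau^-1) ^+ 6 = 'i%C * tau ^+ 3 * eta tau ^+ 6.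
Proof.
move=> t0; have t'0 := upper_Ninv t0; have tn := upper_neq0 t0.
have [C CP] := theta_inversion t0; move: t'0 CP.
have [t' t'E] : exists t', t' = - tau^-1 by eexists.
rewrite -t'E => t'0 CP.
set P := phi (chi 1 tau) 1; set P' := phi (chi 1 t') 1.
have P0 : P != 0 by rewrite phi1_neq0 // chi_upper.
have CE : C = P' ^+ 2 / (tau * P ^+ 2).
  have d1 : cder (fun z => C * theta tau z) 0 (C * (2 * (pi : R)%:C * 'i * P ^+ 2)).
    by apply: cderZ; exact: theta_der0.
  have d2 : cder (fun z => hc (- (z ^+ 2 / tau)) * theta t' (z / tau)) 0
      (2 * (pi : R)%:C * 'i * P' ^+ 2 * tau^-1).
    have e1 : cder (fun z => z / tau) 0 tau^-1.
      by apply: (cder_eq (cderM (cder_id 0) (cder_cst tau^-1 0))); ring.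
    have e2 : cder (fun z => theta t' (z / tau)) 0 (2 * (pi : R)%:C * 'i * P' ^+ 2 * tau^-1).
      apply: (@cder_comp _ (theta t') (fun z => z / tau)) => //.
      by rewrite mul0r; exact: theta_der0.
    have [m e3] : exists m, cder (fun z => hc (- (z ^+ 2 / tau))) 0 m.
      apply: (@cdf_comp _ (@hc R) (fun z => - (z ^+ 2 / tau))); last by eexists; exact: cder_hc.
      by apply: cdfN; apply: cdfM; [exact: cdfX (cdf_id 0)|exact: cdf_cst].
    apply: (cder_eq (cderM e3 e2)).
    by rewrite mul0r theta0 mulr0 add0r expr0n mul0r oppr0 hc0 mul1r.
  have E : (fun z => hc (- (z ^+ 2 / tau)) * theta t' (z / tau)) = (fun z => C * theta tau z).
    by apply/funext => z; exact: CP.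
  rewrite E in d2; have := cder_unique d1 d2.
  have k0 := twopii_neq0 R; move: k0; set k := 2 * _ * _ => k0 H.
  apply: (mulIf (mulf_neq0 k0 (expf_neq0 2 P0))); rewrite H.
  by field; rewrite tn P0.
have [_ T] := theta_half_periods t0; have [_ T'] := theta_half_periods t'0.
have E3 : C ^+ 3 * hc (- tau) = - hc (1 / (2 * tau) - tau / 2 - 1 / 2).
  have two0 : (2 : R[i]) != 0 by rewrite pnatr_eq0.
  apply: (mulfI two0); rewrite mulrCA -T.
  have -> : C ^+ 3 * (theta tau (1 / 2) * theta tau (tau / 2) * theta tau ((1 + tau) / 2)) =
     (C * theta tau (1 / 2)) * (C * theta tau (tau / 2)) * (C * theta tau ((1 + tau) / 2)) by ring.
  rewrite -!CP.
  have -> : theta t' (1 / 2 / tau) = - theta t' (t' / 2).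
    by rewrite -theta_odd; congr theta; rewrite t'E; field.
  have -> : tau / 2 / tau = 1 / 2 by field.
  have -> : theta t' ((1 + tau) / 2 / tau) = theta t' ((1 + t') / 2).
    rewrite -[RHS]opprK -theta_odd -theta_per; congr theta; rewrite t'E; field.
    by rewrite tn.
  rewrite (_ : _ * _ * _ = - (hc (- ((1 / 2) ^+ 2 / tau)) * hc (- ((tau / 2) ^+ 2 / tau)) *
     hc (- (((1 + tau) / 2) ^+ 2 / tau))) *
     (theta t' (1 / 2) * theta t' (t' / 2) * theta t' ((1 + t') / 2))); last by ring.
  rewrite T' (_ : hc (1 / (2 * tau) - tau / 2 - 1 / 2) =
    hc (- ((1 / 2) ^+ 2 / tau)) * hc (- ((tau / 2) ^+ 2 / tau)) *
    hc (- (((1 + tau) / 2) ^+ 2 / tau)) * hc (- t')); first by ring.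
  by rewrite -!hcD; congr hc; rewrite t'E; field.
have Pt : eta tau ^+ 6 = hc (tau / 2) * P ^+ 6.
  rewrite /eta exprMn -/P; congr (_ * _).
  by rewrite /hc -expCMn; congr (expC _ : R[i]); field.
have Pt' : eta t' ^+ 6 = hc (t' / 2) * P' ^+ 6.
  rewrite /eta exprMn -/P'; congr (_ * _).
  by rewrite /hc -expCMn; congr (expC _ : R[i]); field.
have P6 : P' ^+ 6 = C ^+ 3 * tau ^+ 3 * P ^+ 6 by rewrite CE; field; rewrite tn P0.
apply: (etrans Pt'); apply: (etrans (congr1 (fun x => hc (t' / 2) * x) P6)).
apply: (etrans _ (congr1 (fun x => 'i%C * tau ^+ 3 * x) (esym Pt))).
have iE : 'i%C = - hc (- (1 / 2)) :> R[i].
  have ii := sqr_i R; have i0 : 'i%C != 0 :> R[i] by rewrite -nm_gt0 nm_i.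
  by rewrite hcN hc_half; apply: (mulfI i0); rewrite mulrN mulfV // -expr2 ii.
apply: (etrans _ (congr1 (fun x => x * tau ^+ 3 * (hc (tau / 2) * P ^+ 6)) (esym iE))).
have -> : C ^+ 3 = - hc (1 / (2 * tau) - tau / 2 - 1 / 2) * hc tau.
  by rewrite -E3 -mulrA -hcD addNr hc0 mulr1.
rewrite (_ : _ * (_ * _ * _ * _) = - (hc (t' / 2) * hc (1 / (2 * tau) - tau / 2 - 1 / 2) * hc tau)
   * tau ^+ 3 * P ^+ 6); last by ring.
have -> : hc (t' / 2) * hc (1 / (2 * tau) - tau / 2 - 1 / 2) * hc tau =
    hc (- (1 / 2)) * hc (tau / 2).
  by rewrite -!hcD; congr hc; rewrite t'E; field.
by ring.
Qed.

Lemma eta_holo tau : upperP tau -> exists l, cder eta tau l.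
Proof.
move=> t0; pose rho : R := complex.Im tau / 2.
have r0 : 0 < rho by rewrite divr_gt0.
pose r : R := expR (- (2 * pi * rho)).
have r1 : r < 1 by rewrite expR_lt1 oppr_lt0 !mulr_gt0 ?pi_gt0.
have inb z : nm (z - tau) < rho -> rho <= complex.Im z.
  move=> h; have := le_lt_trans (Im_le_nm _) h; rewrite raddfB /= ltr_norml /rho; lra.
have [m Hm] : exists m, cder (fun z => phi (chi 1 z) 1) tau m.
  apply: (@iprod_holo _ (fun n z => chi 1 z ^+ n * 1) 1 r tau rho) => //.
  - exact: expR_ge0.
  - move=> n z _; eexists; apply: cderM; last exact: cder_cst.
    by apply: cderX; exact: cder_chi.
  - move=> z /inb hz n; rewrite mulr1 mul1r nmX lerXn2r ?nnegrE ?nm_ge0 ?expR_ge0 //.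
    by rewrite nm_chi1 ler_expR lerN2 ler_pM2l // mulr_gt0 ?pi_gt0.
apply: cdfM; last by exists m.
apply: (@cdf_comp _ (@hc R) (fun z => z / 12)); last by eexists; exact: cder_hc.
by apply: cdfM; [exact: cdf_id|exact: cdf_cst].
Qed.

End EtaInversion.

(** * The modular group and its derived groups *)

Section ModularGroup.
Implicit Types (g h x y : 'M[int]_2) (a b c d n m : int).

Definition mx2 a b c d : 'M[int]_2 :=
  \matrix_(i, j) if i == 0 then (if j == 0 then a else b) else (if j == 0 then c else d).

Lemma mx2E g : g = mx2 (g 0 0) (g 0 1) (g 1 0) (g 1 1).
Proof.
apply/matrixP => i j; rewrite mxE.
have ord2 (k : 'I_2) : k = 0 \/ k = 1.
  by case: k => -[|[|//]] k2; [left|right]; exact: val_inj.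
by case: (ord2 i) => ->; case: (ord2 j) => ->.
Qed.

Lemma mx2_00 a b c d : mx2 a b c d 0 0 = a. Proof. by rewrite mxE. Qed.
Lemma mx2_01 a b c d : mx2 a b c d 0 1 = b. Proof. by rewrite mxE. Qed.
Lemma mx2_10 a b c d : mx2 a b c d 1 0 = c. Proof. by rewrite mxE. Qed.
Lemma mx2_11 a b c d : mx2 a b c d 1 1 = d. Proof. by rewrite mxE. Qed.
Definition mx2s := (mx2_00, mx2_01, mx2_10, mx2_11).

Lemma mx2M_entries g h (i j : 'I_2) : (g * h) i j = g i 0 * h 0 j + g i 1 * h 1 j.
Proof.
rewrite -mulmxE mxE !big_ord_recl big_ord0 addr0.
by rewrite (_ : lift ord0 ord0 = 1 :> 'I_2); last exact: val_inj.
Qed.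

Lemma mx2M a b c d a' b' c' d' : mx2 a b c d * mx2 a' b' c' d' =
  mx2 (a * a' + b * c') (a * b' + b * d') (c * a' + d * c') (c * b' + d * d').
Proof. by rewrite [LHS]mx2E !mx2M_entries !mx2s. Qed.

Lemma mx2_1 : 1 = mx2 1 0 0 1.
Proof. by rewrite [LHS]mx2E !mxE. Qed.


Lemma SL2Z_mx2 a b c d : a * d - b * c = 1 -> SL2Z (mx2 a b c d).
Proof.
move=> E; rewrite /SL2Z /= (expand_det_row _ 0) !big_ord_recl big_ord0 addr0 /cofactor.
rewrite !det_mx11 !mxE /= expr0 expr1 mul1r mulN1r mulrN.
by rewrite -[RHS]E.
Qed.

Lemma SL2Z_unit g : SL2Z g -> g \is a GRing.unit.
Proof. by move=> Sg; rewrite -[_ \is a _]/(g \in unitmx) unitmxE Sg unitr1. Qed.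

Lemma mx2V a b c d : a * d - b * c = 1 -> (mx2 a b c d)^-1 = mx2 d (- b) (- c) a.
Proof.
move=> E; have U := SL2Z_unit (SL2Z_mx2 E).
apply: (mulrI U); rewrite mulrV // mx2M mx2_1; congr mx2; move: E; lia.
Qed.

Definition Smx := mx2 0 (-1) 1 0.
Definition Tmx n := mx2 1 n 0 1.

Lemma SL2Z_S : SL2Z Smx. Proof. exact: SL2Z_mx2. Qed.
Lemma SL2Z_T n : SL2Z (Tmx n). Proof. by apply: SL2Z_mx2; rewrite mulr0 subr0. Qed.

Lemma TmxD m n : Tmx (m + n) = Tmx m * Tmx n.
Proof. by rewrite /Tmx mx2M; congr mx2; lia. Qed.

Lemma TmxN n : (Tmx n)^-1 = Tmx (- n).
Proof. by rewrite /Tmx mx2V; [congr mx2; lia|lia]. Qed.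

Lemma closed_T (K : set 'M[int]_2) n : group_closed_set K -> K (Tmx 1) -> K (Tmx n).
Proof.
move=> [K1 KM KV] KT.
have N (k : nat) : K (Tmx k).
  elim: k => [|k IH]; first by rewrite /Tmx -mx2_1.
  by rewrite -addn1 PoszD TmxD; exact: KM.
by case: n => k //; rewrite NegzE -TmxN; apply: KV; exact: N.
Qed.

(** Euclid's algorithm on the first column: multiplying by [S T^(-q)] replaces
    the lower left entry by the remainder of the upper left entry modulo it. *)
Theorem SL2Z_generated (K : set 'M[int]_2) : group_closed_set K -> K Smx -> K (Tmx 1) ->
  SL2Z `<=` K.
Proof.
move=> KG KS KT1; have KT n := closed_T n KG KT1; have [K1 KM KV] := KG.
have K1' : K (mx2 (-1) 0 0 (-1)).
  have := KM _ _ KS KS; rewrite /Smx mx2M.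
  by rewrite (_ : mx2 _ _ _ _ = mx2 (-1) 0 0 (-1)) //; congr mx2; lia.
suff H k a b c d : (`|c| <= k)%N -> a * d - b * c = 1 -> K (mx2 a b c d).
  by move=> g Sg; have := H _ _ _ _ _ (leqnn _) (SL2Z_det Sg); rewrite -mx2E.
elim: k a b c d => [|k IH] a b c d ck E.
  have c0 : c = 0 by lia.
  subst c; have [[a1 d1]|[a1 d1]] : (a = 1 /\ d = 1) \/ (a = -1 /\ d = -1).
    have ad : a * d = 1 by lia.
    have /eqP : (`|a| * `|d| = 1)%N by rewrite -abszM ad.
    by rewrite muln_eq1 => /andP[/eqP a1 /eqP d1]; nia.
  - by subst a d; exact: KT.
  subst a d; have := KM _ _ K1' (KT (- b)); rewrite /Tmx mx2M.
  by rewrite (_ : mx2 _ _ _ _ = mx2 (-1) b 0 (-1)) //; congr mx2; lia.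
case: (eqVneq c 0) => [c0|c0]; first by apply: IH => //; lia.
pose q := divz a c; pose r := modz a c.
have aE : a = q * c + r by rewrite /q /r -divz_eq.
have r0 : 0 <= r by rewrite modz_ge0.
have rc : r < `|c| by rewrite ltz_mod.
have E' : Smx * Tmx (- q) * mx2 a b c d = mx2 (- c) (- d) r (b - q * d).
  by rewrite /Smx /Tmx !mx2M; congr mx2; lia.
have Kr : K (mx2 (- c) (- d) r (b - q * d)).
  by apply: IH; [lia|rewrite aE in E; nia].
have U : SL2Z (Smx * Tmx (- q)).
  by have [_ M _] := SL2Z_closed; apply: M; [exact: SL2Z_S|exact: SL2Z_T].
rewrite -(mulKr (SL2Z_unit U) (mx2 a b c d)) E'; apply: (KM) => //; apply: KV.
by apply: (KM) => //; exact: KT.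
Qed.

Lemma derived_comm (G : set 'M[int]_2) g h : G g -> G h -> derived G (g * h * g^-1 * h^-1).
Proof. by move=> Gg Gh K [_]; apply; exists g, h. Qed.

Lemma Gamma'_closed : group_closed_set Gamma'. Proof. exact: derived_closed. Qed.

Lemma Gamma'_conj g x : SL2Z g -> Gamma' x -> Gamma' (g * x * g^-1).
Proof.
move=> Sg Gx; have Sx := Gamma'_SL2Z Gx; have [_ M _] := Gamma'_closed.
have -> : g * x * g^-1 = (g * x * g^-1 * x^-1) * x.
  by rewrite mulrVK //; exact: SL2Z_unit.
by apply: M => //; exact: derived_comm.
Qed.

(** In the abelianisation of [SL_2(Z)] the class of [S] is that of [T^(-3)]. *)
Lemma Gamma'_ST3 : Gamma' (Smx * Tmx 3).
Proof.
have [_ M V] := Gamma'_closed; have [_ SM SV] := SL2Z_closed.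
have c1 : Gamma' (Tmx 2 * Smx * Tmx 1).
  have := V _ (derived_comm (SV _ SL2Z_S) (SL2Z_T 1)).
  rewrite invrK !TmxN /Smx /Tmx; rewrite !mx2V; try lia.
  rewrite !mx2M mx2V; last lia.
  by rewrite (_ : mx2 _ _ _ _ = mx2 2 1 1 1) // (_ : mx2 _ _ _ _ = mx2 2 1 1 1) //; congr mx2; lia.
have := Gamma'_conj (SL2Z_T (-2)) c1; rewrite TmxN /Smx /Tmx !mx2M.
by rewrite (_ : mx2 _ _ _ _ = mx2 0 (-1) 1 3) // (_ : mx2 _ _ _ _ = mx2 0 (-1) 1 3) //; congr mx2; lia.
Qed.

(** The abelianisation of [SL_2(Z)] is generated by the class of [T]. *)
Theorem SL2Z_coset g : SL2Z g -> exists2 x, Gamma' x & exists n, g = x * Tmx n.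
Proof.
have [G1 M V] := Gamma'_closed.
have TK n x : Gamma' x -> Tmx n * x = (Tmx n * x * (Tmx n)^-1) * Tmx n.
  by move=> _; rewrite mulrVK //; exact: SL2Z_unit (SL2Z_T n).
pose K := [set g | exists2 x, Gamma' x & exists n, g = x * Tmx n].
have KG : group_closed_set K.
  split.
  - by exists 1 => //; exists 0; rewrite mul1r /Tmx -mx2_1.
  - move=> _ _ [x Gx [m ->]] [y Gy [n ->]].
    exists (x * (Tmx m * y * (Tmx m)^-1)).
      by apply: M => //; apply: Gamma'_conj => //; exact: SL2Z_T.
    by exists (m + n); rewrite TmxD !mulrA mulrVK //; exact: SL2Z_unit (SL2Z_T m).
  - move=> _ [x Gx [m ->]]; exists (Tmx (- m) * x^-1 * (Tmx (- m))^-1).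
      by apply: Gamma'_conj; [exact: SL2Z_T|exact: V].
    exists (- m); rewrite mulrVK; last exact: SL2Z_unit (SL2Z_T _).
    rewrite invrM ?TmxN //; first exact: SL2Z_unit (Gamma'_SL2Z Gx).
    exact: SL2Z_unit (SL2Z_T m).
apply: (SL2Z_generated KG).
  exists (Smx * Tmx 3); first exact: Gamma'_ST3.
  by exists (-3); rewrite -mulrA -TmxD subrr /Tmx -mx2_1 mulr1.
by exists 1 => //; exists 1; rewrite mul1r.
Qed.

(** The commutator of [[T, S]] and [[T^(-1), S]] is this matrix, which acts as
    [tau |-> tau + 6]. *)
Lemma GammaN_T6 : GammaN (mx2 (-1) (-6) 0 (-1)).
Proof.
have c1 : Gamma' (mx2 2 1 1 1).
  have := derived_comm (SL2Z_T 1) SL2Z_S; rewrite /Tmx /Smx !mx2V; try lia.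
  by rewrite !mx2M (_ : mx2 _ _ _ _ = mx2 2 1 1 1) //; congr mx2; lia.
have c2 : Gamma' (mx2 2 (-1) (-1) 1).
  have := derived_comm (SL2Z_T (-1)) SL2Z_S; rewrite /Tmx /Smx !mx2V; try lia.
  by rewrite !mx2M (_ : mx2 _ _ _ _ = mx2 2 (-1) (-1) 1) //; congr mx2; lia.
have := derived_comm c1 c2; rewrite !mx2V; try lia.
by rewrite !mx2M (_ : mx2 _ _ _ _ = mx2 (-1) (-6) 0 (-1)) //; congr mx2; lia.
Qed.

Lemma GammaN_sub : GammaN `<=` Gamma'.
Proof.
apply: smallest_sub; first exact: Gamma'_closed.
have [_ M V] := Gamma'_closed.
by move=> _ [g [h [Gg Gh ->]]]; do 2![apply: (M); last exact: V]; exact: M.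
Qed.

End ModularGroup.

Section Automorphy.
Variable R : realType.
Implicit Types (g h : 'M[int]_2) (tau z w : R[i]).

(** The automorphy factor [c tau + d]. *)
Definition jf g tau : R[i] := (g 1 0)%:~R * tau + (g 1 1)%:~R.
Definition mob g tau : R[i] := mobius g (tau : CC R).

Lemma mobE g tau : mob g tau = ((g 0 0)%:~R * tau + (g 0 1)%:~R) / jf g tau.
Proof. by []. Qed.

Lemma jf_neq0 g tau : SL2Z g -> upperP tau -> jf g tau != 0.
Proof. exact: mobius_denom_neq0. Qed.

Lemma SL2Z_detC g : SL2Z g ->
  (g 0 0)%:~R * (g 1 1)%:~R - (g 0 1)%:~R * (g 1 0)%:~R = 1 :> R[i].
Proof. by move=> /SL2Z_det E; rewrite -!intrM -intrB E. Qed.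

Lemma mobM g h tau : SL2Z g -> SL2Z h -> upperP tau -> mob (g * h) tau = mob g (mob h tau).
Proof. exact: mobiusM. Qed.

Lemma mob1 tau : mob 1 tau = tau. Proof. exact: mobius1. Qed.

Lemma jfM g h tau : SL2Z h -> upperP tau -> jf (g * h) tau = jf g (mob h tau) * jf h tau.
Proof.
move=> Sh t0; have := jf_neq0 Sh t0; rewrite mobE /jf !mx2M_entries !intrD !intrM => j0.
by field.
Qed.

Lemma Im_mob g tau : SL2Z g -> upperP tau ->
  complex.Im (mob g tau) = complex.Im tau / nm (jf g tau) ^+ 2.
Proof.
move=> Sg t0; rewrite mobE; have := SL2Z_det Sg.
rewrite nm_sqr /jf -!(rmorph_int (real_complex R)).
move: (g 0 0) (g 0 1) (g 1 0) (g 1 1) => a b c d; case: tau t0 => x y t0 E.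
have ER : a%:~R * d%:~R - b%:~R * c%:~R = 1 :> R by rewrite -!intrM -intrB E.
rewrite /= !(mul0r, mulr0, addr0, subr0, add0r).
set D := (_^-1); have -> : y * D = (a%:~R * d%:~R - b%:~R * c%:~R) * y * D.
  by rewrite ER mul1r.
by move: D => D; ring.
Qed.

Lemma mob_upper g tau : SL2Z g -> upperP tau -> upperP (mob g tau).
Proof.
by move=> Sg t0; rewrite /upperP Im_mob // divr_gt0 // exprn_gt0 // nm_gt0 jf_neq0.
Qed.

Lemma cder_mob g tau : SL2Z g -> upperP tau -> cder (mob g) tau (jf g tau ^- 2).
Proof.
move=> Sg t0; have j0 := jf_neq0 Sg t0.
have L (a b : int) : cder (fun z => a%:~R * z + b%:~R) tau a%:~R.
  by apply: (cder_eq (cderD (cderZ _ (cder_id _)) (cder_cst _ _))); rewrite mulr1 addr0.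
apply: (cder_eq (cderM (L _ _) (cderV j0 (L _ _)))).
have E := SL2Z_detC Sg; move: j0; rewrite /jf => j0.
transitivity (((g 0 0)%:~R * (g 1 1)%:~R - (g 0 1)%:~R * (g 1 0)%:~R) /
    ((g 1 0)%:~R * tau + (g 1 1)%:~R) ^+ 2); first by field; exact: j0.
by rewrite E mul1r.
Qed.

Lemma mob_T n tau : mob (Tmx n) tau = tau + n%:~R.
Proof. by rewrite mobE /jf !mx2s mul1r mul0r add0r divr1. Qed.

Lemma jf_T n tau : jf (Tmx n) tau = 1.
Proof. by rewrite /jf !mx2s mul0r add0r. Qed.

Lemma mob_S tau : mob Smx tau = - tau^-1.
Proof. by rewrite mobE /jf !mx2s mul0r add0r mul1r addr0 mulrN1z mulN1r. Qed.

Lemma jf_S tau : jf Smx tau = tau.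
Proof. by rewrite /jf !mx2s mul1r addr0. Qed.

Lemma mob_V g tau : SL2Z g -> upperP tau -> mob g (mob g^-1 tau) = tau.
Proof.
move=> Sg t0; have [_ _ V] := SL2Z_closed.
by rewrite -mobM // ?mulrV ?mob1 //; [exact: SL2Z_unit|exact: V].
Qed.

(** The multipliers of such a function form a character of [SL_2(Z)], by the
    cocycle relation for [c tau + d]; a character is trivial on commutators. *)
Lemma weight2_Gamma' (f : R[i] -> R[i]) (cS cT : R[i]) :
  (forall tau, upperP tau -> f tau != 0) ->
  (forall tau, upperP tau -> f (- tau^-1) = cS * tau ^+ 2 * f tau) ->
  (forall tau, upperP tau -> f (tau + 1) = cT * f tau) ->
  forall g tau, Gamma' g -> upperP tau -> f (mob g tau) = jf g tau ^+ 2 * f tau.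
Proof.
move=> f0 fS fT.
pose W c g := SL2Z g /\ forall tau, upperP tau -> f (mob g tau) = c * jf g tau ^+ 2 * f tau.
have [S1 SM SV] := SL2Z_closed.
have WM c c' g h : W c g -> W c' h -> W (c * c') (g * h).
  move=> [Sg gP] [Sh hP]; split; first exact: SM.
  move=> tau t0; rewrite mobM // gP ?hP //; last exact: mob_upper.
  by rewrite jfM //; ring.
have Wn0 c g : W c g -> c != 0.
  move=> [Sg gP]; have i0 : upperP ('i%C : R[i]) by rewrite /upperP ltr01.
  apply/eqP => c0; have := f0 _ (mob_upper Sg i0).
  by rewrite gP // c0 !mul0r eqxx.
have WV c g : W c g -> W c^-1 g^-1.
  move=> Wg; have c0 := Wn0 _ _ Wg; case: Wg => Sg gP; split; first exact: SV.
  move=> tau t0; have tV := mob_upper (SV _ Sg) t0.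
  have := gP _ tV; rewrite mob_V // => ->.
  have : jf g (mob g^-1 tau) * jf g^-1 tau = 1.
    rewrite -jfM //; last exact: SV.
    by rewrite mulrV ?SL2Z_unit // mx2_1 (jf_T 0).
  set u := jf g _; set v := jf g^-1 _ => uv.
  rewrite (_ : c^-1 * v ^+ 2 * _ = (c^-1 * c) * (u * v) ^+ 2 * f (mob g^-1 tau)); last by ring.
  by rewrite uv mulVf // expr1n !mul1r.
have all g : SL2Z g -> exists c, W c g.
  pose K := [set g | exists c, W c g].
  apply: (@SL2Z_generated K).
  - split.
    + by exists 1; split=> // tau t0; rewrite mob1 mx2_1 (jf_T 0) expr1n !mul1r.
    + by move=> x y [c Wc] [c' Wc']; exists (c * c'); exact: WM.
    + by move=> x [c Wc]; exists c^-1; exact: WV.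
  - by exists cS; split; [exact: SL2Z_S|move=> tau t0; rewrite mob_S jf_S fS].
  - exists cT; split; first exact: SL2Z_T.
    by move=> tau t0; rewrite mob_T jf_T fT // expr1n mulr1.
suff sub : Gamma' `<=` W 1.
  by move=> g tau /sub[_ gP] t0; rewrite gP // mul1r.
apply: smallest_sub.
  split.
  - by split=> // tau t0; rewrite mob1 mx2_1 (jf_T 0) expr1n !mul1r.
  - by move=> g h Wg Wh; have := WM _ _ _ _ Wg Wh; rewrite mulr1.
  - by move=> g Wg; have := WV _ _ Wg; rewrite invr1.
move=> _ [g [h [/all[c Wc] /all[c' Wc'] ->]]].
have := WM _ _ _ _ (WM _ _ _ _ (WM _ _ _ _ Wc Wc') (WV _ _ Wc)) (WV _ _ Wc').
rewrite (_ : c * c' / c / c' = 1) //.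
by have c0 := Wn0 _ _ Wc; have c'0 := Wn0 _ _ Wc'; field; rewrite c0 c'0.
Qed.

(** Translating to [|Re tau| <= 1/2] and inverting at least doubles an imaginary
    part smaller than 1/2. *)
Lemma reduction tau : upperP tau -> exists2 g, SL2Z g & 1 / 2 <= complex.Im (mob g tau).
Proof.
move=> t0; have [S1 SM SV] := SL2Z_closed.
have [n] := exp2_lt 1 t0; rewrite ltr_pdivrMr ?exprn_gt0 // => /ltW.
have : 1 <= complex.Im tau * 2 ^+ n -> exists2 g, SL2Z g & 1 / 2 <= complex.Im (mob g tau).
  elim: n tau t0 => [|n IH] tau t0 h.
    by exists 1 => //; rewrite mob1; move: h; rewrite expr0; lra.
  case: (leP (1 / 2) (complex.Im tau)) => hy; first by exists 1; rewrite ?mob1.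
  pose m := Num.floor (complex.Re tau + 1 / 2); pose w := tau + (- m)%:~R.
  have wE : w = mob (Tmx (- m)) tau by rewrite mob_T.
  have Imw : complex.Im w = complex.Im tau.
    by rewrite /w -(rmorph_int (real_complex R)) raddfD /= addr0.
  have Rew : `|complex.Re w| <= 1 / 2.
    have := floor_le_tmp (complex.Re tau + 1 / 2); have := floorD1_gt (complex.Re tau + 1 / 2).
    rewrite intrD1 -/m /w -(rmorph_int (real_complex R)) raddfD /= intrN => h1 h2.
    by rewrite ler_norml; lra.
  have w0 : upperP w by rewrite /upperP Imw.
  have nw : nm w ^+ 2 <= 1 / 2.
    rewrite nm_sqr Imw; have : complex.Re w ^+ 2 <= (1 / 2) ^+ 2.
      by rewrite -real_normK ?num_real // lerXn2r ?nnegrE.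
    have : complex.Im tau ^+ 2 <= (1 / 2) ^+ 2.
      by rewrite lerXn2r ?nnegrE ?(ltW t0) // ltW.
    by rewrite !expr2; lra.
  have Sw : SL2Z (Smx * Tmx (- m)) by apply: SM; [exact: SL2Z_S|exact: SL2Z_T].
  have mE : mob (Smx * Tmx (- m)) tau = - w^-1.
    by rewrite mobM ?mob_S ?wE //; [exact: SL2Z_S|exact: SL2Z_T].
  have h2 : 2 * complex.Im tau <= complex.Im (- w^-1).
    rewrite Im_Ninv Imw ler_pdivlMr ?exprn_gt0 ?nm_gt0 ?upper_neq0 //.
    have : 0 < complex.Im tau by []. nra.
  have [g Sg gP] : exists2 g, SL2Z g & 1 / 2 <= complex.Im (mob g (- w^-1)).
    apply: IH; first exact: upper_Ninv.
    apply: (le_trans h); rewrite exprS mulrA [_ * 2]mulrC.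
    by apply: ler_wpM2r h2; exact: exprn_ge0.
  by exists (g * (Smx * Tmx (- m))); [exact: SM|rewrite mobM // mE].
by move=> H /H.
Qed.

(** Translations do not change the imaginary part. *)
Lemma reduction_Gamma' tau : upperP tau ->
  exists2 g, Gamma' g & 1 / 2 <= complex.Im (mob g tau).
Proof.
move=> t0; have [g Sg gP] := reduction t0; have [_ _ SV] := SL2Z_closed.
have [_ _ GV] := Gamma'_closed.
have [x Gx [n gE]] := SL2Z_coset (SV _ Sg).
have Sx := Gamma'_SL2Z Gx.
exists x^-1; first exact: GV.
have xE : g = Tmx (- n) * x^-1.
  by rewrite -[LHS]invrK gE invrM ?TmxN //; [exact: SL2Z_unit|exact: SL2Z_unit (SL2Z_T n)].
move: gP; rewrite xE mobM //; [|exact: SL2Z_T|exact: SV].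
by rewrite mob_T -(rmorph_int (real_complex R)) raddfD /= addr0.
Qed.

End Automorphy.

(** * Functions on the compactified punctured torus *)

Section Cusp.
Variable R : realType.
Implicit Types (F G : R[i] -> R[i]) (w z v tau l : R[i]) (x y b C M : R).

(** The fundamental theorem along the segment from [z] to [z + v]. *)
Lemma mean_value G g z v M :
  (forall x, 0 <= x <= 1 -> cder G (line z v x) (g (line z v x))) ->
  (forall x, 0 <= x <= 1 -> ccont g (line z v x)) ->
  (forall x, 0 <= x <= 1 -> nm (g (line z v x)) <= M) -> nm (G (z + v) - G z) <= nm v * M.
Proof.
move=> Gd gc gM; have := cint_FTC ler01 Gd gc.
rewrite /line mul1r mul0r addr0 => <-; rewrite nmM ler_wpM2l ?nm_ge0 //.
have := @cint_bound _ (fun x => g (line z v x)) 0 1 M ler01.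
rewrite subr0 mulr1; apply=> // x hx.
exact: contp_line (gc _ hx).
Qed.

Lemma upper_line z w x : upperP z -> upperP w -> 0 <= x <= 1 -> upperP (line z (w - z) x).
Proof.
move=> z0 w0 /andP[x0 x1]; rewrite /upperP /line.
rewrite (_ : complex.Im _ = (1 - x) * complex.Im z + x * complex.Im w).
  by move: z0 w0; rewrite /upperP; nra.
by case: z {z0} => a b; case: w {w0} => a' b' /=; ring.
Qed.

Lemma zero_der_upper F : (forall tau, upperP tau -> cder F tau 0) ->
  forall z w, upperP z -> upperP w -> F w = F z.
Proof.
move=> Fd z w z0 w0; apply/eqP; rewrite -subr_eq0; apply/eqP/nm_eq0P => e e0.
have := @mean_value F (fun=> 0) z (w - z) 0; rewrite mulr0 (addrC z (w - z)) subrK.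
move=> h; apply: le_trans (ltW e0); apply: h => x hx.
- by apply: Fd; exact: upper_line.
- exact: ccont_cst.
- by rewrite nm0.
Qed.

(** [Fourier_cusp] for a line between [b] and [y], whose geometric factor is
    bounded on [Im w >= y]. *)
Lemma cusp_expansion G b y N : per1 G -> holo (fun z => b < complex.Im z) G -> upto0 G ->
  b < y -> exists a : nat -> R[i], exists2 C : R, 0 <= C & forall w, y <= complex.Im w ->
    nm (G w - \sum_(1 <= n < N.+1) a n * chi 1 w ^+ n) <= C * nm (chi 1 w) ^+ N.+1.
Proof.
move=> G1 Gh G0 bY; pose y0 := (b + y) / 2.
have [by0 y0y] : b < y0 /\ y0 < y by rewrite /y0; split; lra.
have Gc x : ccont G (x +i* y0) by apply: cdf_cont; exact: Gh.
have [M MP] := periodic_bounded G1 Gc.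
have M0 : 0 <= M := le_trans (nm_ge0 _) (MP 0).
exists (fun n => fcoef G y0 n%:Z).
pose r0 : R := expR (- (2 * pi * (y - y0))).
have r01 : 0 < 1 - r0 by rewrite subr_gt0 expR_lt1 oppr_lt0 !mulr_gt0 ?pi_gt0 // subr_gt0.
exists (M * (expR (2 * pi * y0) ^+ N.+1 / (1 - r0))).
  by rewrite mulr_ge0 // divr_ge0 ?exprn_ge0 ?expR_ge0 // ltW.
move=> w hw; have y0w : y0 < complex.Im w by exact: lt_le_trans hw.
have := Fourier_cusp N G1 Gh G0 by0 y0w MP.
rewrite (eq_bigr (fun n : nat => fcoef G y0 n%:Z * chi 1 w ^+ n)); last first.
  by move=> n _; rewrite chiX.
move=> /le_trans; apply; rewrite -(mulrA M) ler_wpM2l //.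
have -> : expR (- (2 * pi * (complex.Im w - y0))) = expR (2 * pi * y0) * nm (chi 1 w).
  by rewrite nm_chi1 -expRD; congr expR; ring.
rewrite exprMn -!mulrA ler_wpM2l ?exprn_ge0 ?expR_ge0 // [leRHS]mulrC.
rewrite ler_wpM2l ?exprn_ge0 ?nm_ge0 // lef_pV2 ?posrE //; last first.
  rewrite nm_chi1 -expRD subr_gt0 expR_lt1 (_ : _ + _ = - (2 * pi * (complex.Im w - y0))); last by ring.
  by rewrite oppr_lt0 !mulr_gt0 ?pi_gt0 // subr_gt0.
rewrite lerD2l lerN2 nm_chi1 -expRD /r0 ler_expR.
rewrite (_ : _ + _ = - (2 * pi * (complex.Im w - y0))); last by ring.
by rewrite lerN2 ler_pM2l ?mulr_gt0 ?pi_gt0 // lerD2r.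
Qed.

(** A property that holds in a neighbourhood of the cusp. *)
Definition cusp (P : R[i] -> Prop) := exists Y : R, forall w, Y <= complex.Im w -> P w.

Lemma cusp_and (P Q : R[i] -> Prop) : cusp P -> cusp Q -> cusp (fun w => P w /\ Q w).
Proof.
move=> [Y1 h1] [Y2 h2]; exists (Num.max Y1 Y2) => w.
by rewrite ge_max => /andP[/h1 ? /h2].
Qed.

Lemma cusp_imp (P Q : R[i] -> Prop) : (forall w, P w -> Q w) -> cusp P -> cusp Q.
Proof. by move=> PQ [Y h]; exists Y => w /h/PQ. Qed.

Lemma cusp_ex (P : R[i] -> Prop) : cusp P -> exists w, P w.
Proof. by move=> [Y h]; exists (0 +i* Y); apply: h => /=. Qed.

(** [F = O(t^k)] at the cusp, with [t = e^(2 pi i w)]. *)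
Definition Ot (k : nat) F := exists2 C : R, 0 <= C &
  cusp (fun w => nm (F w) <= C * nm (chi 1 w) ^+ k).

Lemma cusp_chi (e : R) : 0 < e -> cusp (fun w => nm (chi 1 w) <= e).
Proof.
move=> e0; exists (- ln e / (2 * pi)) => w; rewrite ler_pdivrMr ?mulr_gt0 ?pi_gt0 // => h.
rewrite nm_chi1 -[e in leRHS]lnK ?posrE // ler_expR; lra.
Qed.

Lemma Ot_small k F (e : R) : Ot k.+1 F -> 0 < e -> cusp (fun w => nm (F w) <= e).
Proof.
move=> [C C0 FC] e0; have C1 : 0 < C + 1 by rewrite ltr_wpDl.
have := cusp_and FC (cusp_and (cusp_chi ltr01) (cusp_chi (divr_gt0 e0 C1))).
apply: cusp_imp => w [h1 [t1 t2]]; apply: (le_trans h1).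
move: t2; rewrite ler_pdivlMr // exprS => h4.
have h5 : nm (chi 1 w) ^+ k <= 1 by rewrite exprn_ile1 ?nm_ge0.
have := nm_ge0 (chi 1 w); have := exprn_ge0 k (nm_ge0 (chi 1 w)).
move: h4 h5 {h1 t1}; set t := nm _; set s := t ^+ k => h4 h5 s0 t0.
have : t * s <= t by nra.
nra.
Qed.

Lemma cusp_lt (P : R[i] -> Prop) : cusp P -> exists Y : R, forall w, Y < complex.Im w -> P w.
Proof. by move=> [Y h]; exists Y => w /ltW/h. Qed.

Lemma Ot_upto0 k F : Ot k.+1 F -> upto0 F.
Proof. by move=> Fk e e0; apply: cusp_lt; exact: Ot_small Fk e0. Qed.

Lemma upto0P F : upto0 F <-> forall e, 0 < e -> cusp (fun w => nm (F w) <= e).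
Proof.
split=> h e e0; last exact/cusp_lt/h.
have [Y YP] := h e e0; exists (Y + 1) => w hw; apply: YP; lra.
Qed.

Definition cusp_lim F l := forall e, 0 < e -> cusp (fun tau => nm (F tau - l) <= e).

(** In the coordinate w = tau / 6 a function on H of period 6 becomes one of
    period 1; outside H, where nothing is known of F, it is replaced by 0. *)
Definition cut F w := if 0 < complex.Im w then F (6 * w) else 0.

Lemma Im_6 w : complex.Im (6 * w) = 6 * complex.Im w.
Proof. by rewrite -(rmorph_nat (real_complex R)); case: w => a b /=; ring. Qed.

Lemma cutE F w : upperP w -> cut F w = F (6 * w).
Proof. by rewrite /cut /upperP => ->. Qed.

Lemma cut_div6 F tau : upperP tau -> upperP (tau / 6) /\ cut F (tau / 6) = F tau.
Proof.
move=> t0; have E : 6 * (tau / 6) = tau by field.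
have w0 : upperP (tau / 6).
  by move: t0; rewrite /upperP -[in X in X -> _]E Im_6 pmulr_rgt0.
by rewrite cutE // E.
Qed.

Lemma upper_6 w : upperP w -> upperP (6 * w).
Proof. by rewrite /upperP Im_6 pmulr_rgt0. Qed.

Lemma cut_per F : (forall tau, upperP tau -> F (tau + 6) = F tau) -> per1 (cut F).
Proof.
move=> F6 w; rewrite /cut raddfD /= addr0; case: ifPn => // w0.
by rewrite mulrDr mulr1 F6 //; exact: upper_6.
Qed.

Lemma cut_cder F w d : upperP w -> cder F (6 * w) d -> cder (cut F) w (6 * d).
Proof.
move=> w0 Fd; apply: (@cder_ext _ (fun z => F (6 * z)) _ w _ (complex.Im w)) => //.
  move=> z hz; rewrite cutE // /upperP.
  have := le_lt_trans (Im_le_nm _) hz; rewrite raddfB /= ltr_norml; lra.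
by rewrite mulrC; apply: (cder_comp (f := F)) => //; exact: cder_scale.
Qed.

Lemma cut_holo F : (forall tau, upperP tau -> cdf F tau) -> holo (fun z => 0 < complex.Im z) (cut F).
Proof.
move=> Fd w w0; have [d dP] := Fd _ (upper_6 w0).
by exists (6 * d); exact: cut_cder.
Qed.

Lemma cut_upto0 F : cusp_lim F 0 -> upto0 (cut F).
Proof.
move=> F0; apply/upto0P => e e0; have [Y YP] := F0 _ e0; exists (Y / 6) => w hw.
rewrite /cut; case: ifP => _; last by rewrite nm0 ltW.
by have := YP (6 * w); rewrite subr0; apply; rewrite Im_6; lra.
Qed.

Lemma per6_Gamma' (T : Type) (F : R[i] -> T) :
  (forall g tau, Gamma' g -> upperP tau -> F (mob g tau) = F tau) ->
  forall tau, upperP tau -> F (tau + 6) = F tau.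
Proof.
move=> Fg tau t0; rewrite -(Fg _ tau (GammaN_sub GammaN_T6) t0); congr F.
by rewrite mobE /jf !mx2s mul0r add0r !mulrN1z invrN invr1; ring.
Qed.

(** After subtracting the limit, [F] is bounded by a multiple of [t = e^(2 pi i
    tau / 6)] on [Im tau >= 1/4], hence bounded. The expansion at the cusp of
    [F^n], which vanishes there to order [n], improves a bound for [|F|^n] by a
    factor 1/2 on [Im tau >= 1/2] for a suitable [n]. Every orbit has a point
    there, so the better bound holds everywhere, and repeating this gives 0. *)
Theorem rigid F l : (forall tau, upperP tau -> cdf F tau) ->
  (forall g tau, Gamma' g -> upperP tau -> F (mob g tau) = F tau) ->
  cusp_lim F l -> forall tau, upperP tau -> F tau = l.
Proof.
move=> Fh Fg Fl.
pose G tau := F tau - l; pose K := cut G.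
have Gh tau : upperP tau -> cdf G tau by move=> t0; apply: cdfB; [exact: Fh|exact: cdf_cst].
have GG g tau : Gamma' g -> upperP tau -> G (mob g tau) = G tau.
  by move=> Gg t0; rewrite /G Fg.
have K1 : per1 K by apply: cut_per; exact: per6_Gamma'.
have Kh : holo (fun z => 0 < complex.Im z) K by exact: cut_holo.
have K0 : upto0 K.
  by apply: cut_upto0 => e e0; apply: cusp_imp (Fl _ e0) => w; rewrite /G subr0.
(* In the coordinate tau / 6 the set Im tau >= 1/2 is Im w >= 1/12, at distance 1/24
   from the line Im w = y1. *)
pose y1 : R := 1 / 24.
have y10 : 0 < y1 by rewrite divr_gt0.
have [a [C C0 CP]] := cusp_expansion 0 K1 Kh K0 y10.
have {}CP w : y1 <= complex.Im w -> nm (K w) <= C * nm (chi 1 w).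
  by move=> /CP; rewrite big_geq // subr0 expr1.
pose r1 : R := expR (- (2 * pi * y1)).
have r11 : r1 < 1 by rewrite expR_lt1 oppr_lt0 !mulr_gt0 ?pi_gt0.
have r10 : 0 < r1 := expR_gt0 _.
have [n n0 nP] : exists2 n : nat, (0 < n)%N & r1 ^+ n / (1 - r1) <= 1 / 2.
  have [|||N NP] := @pow_small R r1 ((1 - r1)^-1) (1 / 2).
  - by rewrite (ltW r10) r11.
  - by rewrite divr_gt0.
  - by rewrite invr_ge0 subr_ge0 ltW.
  exists N.+1 => //; rewrite mulrC; apply: le_trans NP.
  rewrite ler_wpM2l ?invr_ge0 ?subr_ge0 ?(ltW r11) // exprS ler_piMl ?(ltW r11) //.
  by rewrite exprn_ge0 // ltW.
have step A : (forall tau, upperP tau -> nm (G tau) ^+ n <= A) ->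
    forall tau, upperP tau -> nm (G tau) ^+ n <= A / 2.
  move=> GA tau0 t0.
  have [g Gg hg] := reduction_Gamma' t0; rewrite -(GG g tau0 Gg t0).
  have : upperP (mob g tau0) by apply: mob_upper => //; exact: Gamma'_SL2Z.
  move: (mob g tau0) hg => tau ht tau1; have [w0 <-] := cut_div6 G tau1; rewrite -/K.
  have hw : 1 / 12 <= complex.Im (tau / 6).
    by have := Im_6 (tau / 6); rewrite (_ : 6 * (tau / 6) = tau); [lra|field].
  move: (tau / 6) w0 hw => w w0 hw {t0 ht tau1}.
  have A0 : 0 <= A by apply: le_trans (GA _ w0); rewrite exprn_ge0 ?nm_ge0.
  have KA z : upperP z -> nm (K z) ^+ n <= A.
    by move=> z0; rewrite /K cutE //; apply: GA; exact: upper_6.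
  (* Q is K^n / t^(n-1), which still vanishes at the cusp. *)
  pose Q z := K z ^+ n * chi (1 - n%:Z) z.
  have Q1 : per1 Q by move=> z; rewrite /Q K1 chi_per.
  have Qh : holo (fun z => 0 < complex.Im z) Q.
    move=> z hz; apply: cdfM; first by apply: cdfX; exact: Kh.
    by eexists; exact: cder_chi.
  have chin z : chi (1 - n%:Z) z = chi 1 z * (chi 1 z ^+ n)^-1 by rewrite chiD -chiV -chiX.
  have t0 z : 0 < nm (chi 1 z) by rewrite nm_gt0 chi_neq0.
  have Q0 : upto0 Q.
    apply: (@Ot_upto0 0); exists (C ^+ n); first exact: exprn_ge0.
    exists y1 => z hz; rewrite /Q chin nmM (nmM (chi 1 z)) nmV !nmX expr1.
    rewrite mulrCA [leRHS]mulrC ler_pM2l // ler_pdivrMr ?exprn_gt0 // -exprMn.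
    by rewrite lerXn2r ?nnegrE ?mulr_ge0 ?nm_ge0 // CP.
  pose t1 : R := expR (- (2 * pi * y1)).
  have QM x : nm (Q (x +i* y1)) <= A * (r1 / r1 ^+ n).
    rewrite /Q chin nmM (nmM (chi 1 _)) nmV !nmX nm_chi1 /= -/r1.
    by rewrite ler_wpM2r ?KA // divr_ge0 ?exprn_ge0 // ltW.
  have y1w : y1 < complex.Im w by rewrite /y1; lra.
  have := Fourier_cusp 0 Q1 Qh Q0 y10 y1w QM.
  rewrite big_geq // subr0 expr1.
  set r := expR _; set t := nm (chi 1 w).
  have tE : t = r1 * r.
    by rewrite /t nm_chi1 /r1 /r -expRD; congr expR; ring.
  have r0 : 0 < r := expR_gt0 _.
  have rr1 : r <= r1.
    rewrite ler_expR lerN2 ler_pM2l ?mulr_gt0 ?pi_gt0 // /y1; lra.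
  rewrite /Q chin nmM (nmM (chi 1 w)) nmV !nmX -/t tE exprMn.
  have -> : nm (K w) ^+ n * (r1 * r * (r1 ^+ n * r ^+ n)^-1) =
      nm (K w) ^+ n * (r / r ^+ n) * (r1 / r1 ^+ n).
    by field; rewrite !gt_eqF // exprn_gt0.
  rewrite [leRHS]mulrAC ler_pM2r ?divr_gt0 ?exprn_gt0 //.
  rewrite mulrA ler_pdivrMr ?exprn_gt0 // => h.
  have : nm (K w) ^+ n <= A * (r ^+ n / (1 - r)).
    rewrite -(ler_pM2r r0) (le_trans h) // le_eqVlt; apply/orP; left; apply/eqP; ring.
  move=> /le_trans; apply; rewrite ler_wpM2l //; apply: le_trans (_ : 1 / 2 <= _); last by rewrite div1r.
  apply: le_trans nP; rewrite ler_pM ?exprn_ge0 ?invr_ge0 ?subr_ge0 ?(ltW r0) //.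
  - by rewrite (le_trans rr1) // ltW.
  - by rewrite lerXn2r ?nnegrE ?(ltW r0) ?(ltW r10).
  - rewrite lef_pV2 ?posrE ?subr_gt0 //; first by lra.
    exact: le_lt_trans rr1 r11.
have GA : exists2 A : R, 0 <= A & forall tau, upperP tau -> nm (G tau) ^+ n <= A.
  exists (C ^+ n); first exact: exprn_ge0.
  move=> tau0 t0; have [g Gg hg] := reduction_Gamma' t0; rewrite -(GG g tau0 Gg t0).
  have : upperP (mob g tau0) by apply: mob_upper => //; exact: Gamma'_SL2Z.
  move: (mob g tau0) hg => tau ht tau1; have [w0 <-] := cut_div6 G tau1; rewrite -/K.
  have hw : y1 <= complex.Im (tau / 6).
    by have := Im_6 (tau / 6); rewrite /y1 (_ : 6 * (tau / 6) = tau); [lra|field].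
  rewrite lerXn2r ?nnegrE ?nm_ge0 // (le_trans (CP _ hw)) // ler_piMr // nm_chi1.
  by rewrite expR_le1 oppr_le0 !mulr_ge0 ?pi_ge0 // ltW.
move=> tau t0; apply/eqP; rewrite -subr_eq0 -[_ - _]/(G tau).
have [A A0 AP] := GA.
have all k : forall tau, upperP tau -> nm (G tau) ^+ n <= A / 2 ^+ k.
  elim: k => [|k IH]; first by rewrite expr0 divr1.
  by rewrite exprSr invfM mulrA; exact: step.
have /eqP : nm (G tau) ^+ n = 0.
  apply/eqP; rewrite eq_le exprn_ge0 ?nm_ge0 // andbT leNgt; apply/negP => p.
  by have [k] := exp2_lt A p; rewrite ltNge all.
by rewrite expf_eq0 n0 nm_eq0.
Qed.

Definition f4 tau := eta tau ^+ 4 : R[i].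

Lemma f4_neq0 tau : upperP tau -> f4 tau != 0.
Proof. by move=> t0; rewrite expf_neq0 // eta_neq0. Qed.

Lemma f4_holo tau : upperP tau -> cdf f4 tau.
Proof. by move=> t0; apply: cdfX; exact: eta_holo. Qed.

Lemma f4_T tau : f4 (tau + 1) = hc (1 / 3) * f4 tau.
Proof.
have h12 : hc (1 / 12) ^+ 4 = hc (1 / 3) :> R[i].
  by rewrite !exprS expr0 mulr1 -!hcD; congr hc; field.
rewrite /f4 /eta chi_per (mulrDl tau 1) (hcD (tau / 12)) (mulrC (hc (tau / 12))).
by rewrite -(mulrA (hc (1 / 12))) exprMn h12.
Qed.

(** By [eta_inversion] the quotient of both sides without [cS] has the constant
    cube -1, so its derivative vanishes. *)
Lemma f4_S : exists cS, forall tau, upperP tau -> f4 (- tau^-1) = cS * tau ^+ 2 * f4 tau.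
Proof.
pose u tau := f4 (- tau^-1) / (tau ^+ 2 * f4 tau).
have d0 tau : upperP tau -> tau ^+ 2 * f4 tau != 0.
  by move=> t0; rewrite mulf_neq0 ?f4_neq0 // expf_neq0 // upper_neq0.
have uh tau : upperP tau -> cdf u tau.
  move=> t0; apply: cdfM.
    apply: (@cdf_comp _ f4 (fun z => - z^-1)); last exact: f4_holo (upper_Ninv t0).
    by apply: cdfN; apply: cdfV; [exact: upper_neq0|exact: cdf_id].
  apply: cdfV; first exact: d0.
  by apply: cdfM; [apply: cdfX; exact: cdf_id|exact: f4_holo].
have u3 tau : upperP tau -> u tau ^+ 3 = -1.
  move=> t0; rewrite /u /f4; move: (eta_inversion t0) (eta_neq0 t0) (upper_neq0 t0).
  move: (eta (- tau^-1)) (eta tau) => e' e E e0 tn.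
  have -> : (e' ^+ 4 / (tau ^+ 2 * e ^+ 4)) ^+ 3 = (e' ^+ 6) ^+ 2 / (tau ^+ 3 * e ^+ 6) ^+ 2.
    by field; rewrite tn e0.
  rewrite E -mulrA exprMn sqr_i mulN1r mulNr divff // expf_neq0 // mulf_neq0 //;
    exact: expf_neq0.
have u0 tau : upperP tau -> cder u tau 0.
  move=> t0; have [l ul] := uh _ t0; suff l0 : l = 0 by rewrite -l0.
  have := cderX 3 ul.
  have h := @cder_ext _ (fun=> -1) (fun z => u z ^+ 3) tau 0 (complex.Im tau) t0.
  move=> h3; have := cder_unique h3 (h _ (cder_cst _ _)).
  rewrite /= => E; have : 3 * u tau ^+ 2 * l = 0.
    apply: E => w hw; rewrite u3 // /upperP.
    have := le_lt_trans (Im_le_nm _) hw; rewrite raddfB /= ltr_norml; lra.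
  have un : u tau != 0 by apply/eqP => e; have := u3 _ t0; rewrite e expr0n /= => /eqP; rewrite eq_sym oppr_eq0 oner_eq0.
  have v0 : 3 * u tau ^+ 2 != 0 by apply: mulf_neq0; [rewrite pnatr_eq0|exact: expf_neq0].
  by move/eqP; rewrite mulf_eq0 (negPf v0) /= => /eqP.
have i0 : upperP ('i%C : R[i]) by rewrite /upperP ltr01.
exists (u 'i%C) => tau t0; rewrite -(zero_der_upper u0 i0 t0) -mulrA /u divfK //.
exact: d0.
Qed.

Theorem f4_Gamma' g tau : Gamma' g -> upperP tau -> f4 (mob g tau) = jf g tau ^+ 2 * f4 tau.
Proof.
have [cS S] := f4_S; apply: (weight2_Gamma' f4_neq0 S) => z _; exact: f4_T.
Qed.

End Cusp.

(** * Asymptotic expansions at the cusp *)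

Section Jets.
Variable R : realType.
Implicit Types (F G E : R[i] -> R[i]) (w z c d : R[i]) (C Y : R) (k : nat).
Local Notation t := (@chi R 1).

Lemma nm_t_gt0 w : 0 < nm (t w). Proof. by rewrite nm_gt0 chi_neq0. Qed.
Lemma nm_tX_gt0 w k : 0 < nm (t w) ^+ k. Proof. by rewrite exprn_gt0 ?nm_t_gt0. Qed.

Lemma cusp_true (P : R[i] -> Prop) : (forall w, P w) -> cusp P.
Proof. by move=> h; exists 0. Qed.

Lemma Ot_ext k F G : cusp (fun w => F w = G w) -> Ot k F -> Ot k G.
Proof.
move=> FG [C C0 FC]; exists C => //.
by apply: cusp_imp (cusp_and FG FC) => w [-> ].
Qed.

Lemma Ot_eq k F G : (forall w, F w = G w) -> Ot k F -> Ot k G.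
Proof. by move=> FG; apply: Ot_ext; exact: cusp_true. Qed.

Lemma OtD k F G : Ot k F -> Ot k G -> Ot k (fun w => F w + G w).
Proof.
move=> [C C0 FC] [D D0 GD]; exists (C + D); first exact: addr_ge0.
apply: cusp_imp (cusp_and FC GD) => w [h1 h2].
by rewrite (le_trans (nmD _ _)) // mulrDl lerD.
Qed.

Lemma Ot_le j k F : (j <= k)%N -> Ot k F -> Ot j F.
Proof.
move=> jk [C C0 FC]; exists C => //.
apply: cusp_imp (cusp_and FC (cusp_chi ltr01)) => w [h1 h2].
by rewrite (le_trans h1) // ler_wpM2l // ler_wiXn2l // nm_ge0.
Qed.

Lemma OtM j k F G : Ot j F -> Ot k G -> Ot (j + k) (fun w => F w * G w).
Proof.
move=> [C C0 FC] [D D0 GD]; exists (C * D); first exact: mulr_ge0.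
apply: cusp_imp (cusp_and FC GD) => w [h1 h2].
by rewrite nmM exprD mulrACA ler_pM ?nm_ge0.
Qed.

Lemma Ot_cst c : Ot 0 (fun=> c).
Proof. by exists (nm c); rewrite ?nm_ge0 //; apply: cusp_true => w; rewrite expr0 mulr1. Qed.

Lemma Ot_t k : Ot k (fun w => t w ^+ k).
Proof. by exists 1; rewrite ?ler01 //; apply: cusp_true => w; rewrite mul1r nmX. Qed.

Lemma OtZ k c F : Ot k F -> Ot k (fun w => c * F w).
Proof. by move=> h; exact: (OtM (Ot_cst c) h). Qed.

Lemma OtZt j k c : (j <= k)%N -> Ot j (fun w => c * t w ^+ k).
Proof. by move=> jk; apply: OtZ; exact: (Ot_le jk (Ot_t k)). Qed.

Lemma Ot_divt k F : Ot k.+1 F -> Ot k (fun w => F w / t w).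
Proof.
move=> [C C0 FC]; exists C => //; apply: cusp_imp FC => w h.
by rewrite nm_div ler_pdivrMr ?nm_t_gt0 // -mulrA -exprSr.
Qed.

(** Uniqueness of the coefficients in an expansion. *)
Lemma Ot_leading k c : Ot k.+1 (fun w => c * t w ^+ k) -> c = 0.
Proof.
move=> [C C0 FC]; apply: nm_eq0P => e e0; have C1 : 0 < C + 1 by rewrite ltr_wpDl.
have [w [h1 h2]] := cusp_ex (cusp_and FC (cusp_chi (divr_gt0 e0 C1))).
move: h1; rewrite nmM nmX exprS mulrA ler_pM2r ?nm_tX_gt0 // => h1.
apply: (le_trans h1); move: h2; rewrite ler_pdivlMr //.
by have := nm_t_gt0 w; nra.
Qed.

(** Cauchy's estimate on discs of radius 1, on which [|t|] changes at most by a
    constant factor. *)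
Lemma Ot_der k E E' Y : (forall w, Y < complex.Im w -> cder E w (E' w)) -> Ot k E -> Ot k E'.
Proof.
move=> Ed [C C0 [Y' EC]].
exists (4 * C * expR (2 * pi) ^+ k); first by rewrite mulr_ge0 ?mulr_ge0 ?exprn_ge0 ?expR_ge0.
exists (Num.max Y Y' + 2) => w hw.
have [y1 y2] : Y <= Num.max Y Y' /\ Y' <= Num.max Y Y' by rewrite !le_max !lexx orbT.
have inb z : nm (z - w) < 1 -> complex.Im w - 1 < complex.Im z.
  move=> h; have := le_lt_trans (Im_le_nm _) h; rewrite raddfB /= ltr_norml; lra.
have [|z hz||+ _] := @Taylor2 _ E w 1 (C * (expR (2 * pi) * nm (t w)) ^+ k) (E' w).
- exact: ltr01.
- have h := inb _ hz; split; first by exists (E' z); apply: Ed; lra.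
  apply: (le_trans (EC _ _)); first by lra.
  rewrite ler_wpM2l // lerXn2r ?nnegrE ?mulr_ge0 ?nm_ge0 ?expR_ge0 //.
  rewrite !nm_chi1 -expRD ler_expR; have := @pi_gt0 R; move: h; nra.
- by apply: Ed; lra.
by rewrite divr1 exprMn !mulrA.
Qed.

(** The increments over unit steps of a vertical ray form a geometric series,
    because [|t|] decreases by the factor [e^(-2 pi)] at each step. *)
Lemma Ot_int k E E' Y : (forall w, Y < complex.Im w -> cder E w (E' w)) ->
  (forall w, Y < complex.Im w -> ccont E' w) -> upto0 E -> Ot k.+1 E' -> Ot k.+1 E.
Proof.
move=> Ed Ec E0 [C C0 [Y' EC]]; pose r : R := expR (- (2 * pi)).
have r0 : 0 < r := expR_gt0 _.
have r1 : r < 1 by rewrite expR_lt1 oppr_lt0 mulr_gt0 ?pi_gt0.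
exists (C / (1 - r)); first by rewrite divr_ge0 // subr_ge0 ltW.
exists (Num.max Y Y' + 1) => w hw.
have [y1 y2] : Y <= Num.max Y Y' /\ Y' <= Num.max Y Y' by rewrite !le_max !lexx orbT.
pose W n : R[i] := w + n%:R%:C * 'i%C.
have ImW n : complex.Im (W n) = complex.Im w + n%:R.
  by rewrite /W; case: (w) => a b /=; ring.
have tW n : nm (t (W n)) = r ^+ n * nm (t w).
  rewrite !nm_chi1 ImW -expRM_natl -expRD; congr expR; rewrite -mulr_natl; ring.
have step n : nm (E (W n.+1) - E (W n)) <= C * nm (t (W n)) ^+ k.+1.
  have -> : W n.+1 = W n + 'i%C by rewrite /W -addn1 natrD rmorphD /=; ring.
  have Iml x : complex.Im (line (W n) 'i%C x) = complex.Im w + n%:R + x.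
    by rewrite /line -(ImW n); case: (W n) => a b /=; ring.
  have := @mean_value _ E E' (W n) 'i%C (C * nm (t (W n)) ^+ k.+1).
  rewrite nm_i mul1r; apply=> x /andP[x0 x1].
  - by apply: Ed; rewrite Iml; have : 0 <= n%:R :> R by []; lra.
  - by apply: Ec; rewrite Iml; have : 0 <= n%:R :> R by []; lra.
  - apply: (le_trans (EC _ _)); first by rewrite Iml; have : 0 <= n%:R :> R by []; lra.
    rewrite ler_wpM2l // lerXn2r ?nnegrE ?nm_ge0 // !nm_chi1 ler_expR Iml ImW.
    by have := @pi_gt0 R; nra.
have sum n : nm (E (W n) - E w) <= C * nm (t w) ^+ k.+1 * ((1 - r ^+ n) / (1 - r)).
  elim: n => [|n IH]; first by rewrite /W mul0r addr0 !subrr nm0 mul0r mulr0.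
  apply: (le_trans (nm_trans _ (E (W n)) _)); apply: (le_trans (lerD (step n) IH)).
  rewrite tW exprMn; set T := nm (t w) ^+ k.+1.
  have q : 0 < 1 - r by rewrite subr_gt0.
  have h : (r ^+ n) ^+ k.+1 <= r ^+ n.
    rewrite -exprM mulnS exprD ler_piMr ?exprn_ge0 ?(ltW r0) //.
    by rewrite exprn_ile1 ?(ltW r0) ?(ltW r1).
  have -> : (1 - r ^+ n.+1) / (1 - r) = r ^+ n + (1 - r ^+ n) / (1 - r).
    by rewrite exprS; field; rewrite gt_eqF.
  rewrite mulrDr lerD2r -mulrA ler_wpM2l // mulrC ler_wpM2l // ltW //.
  exact: nm_tX_gt0.
apply/ler_addgt0Pl => e e0; have [Z ZP] := E0 _ e0.
pose n := Num.truncn `|Z - complex.Im w|.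
have hn : nm (E (W n.+1)) <= e.
  apply: ZP; rewrite ImW -ltrBlDl; apply: le_lt_trans (truncnS_gt _); exact: ler_norm.
have -> : E w = E (W n.+1) - (E (W n.+1) - E w) by ring.
apply: (le_trans (nmB _ _)); apply: lerD hn _; apply: (le_trans (sum n.+1)).
rewrite [leRHS]mulrAC ler_wpM2l ?mulr_ge0 ?exprn_ge0 ?nm_ge0 //.
rewrite -[leRHS]mul1r ler_wpM2r ?invr_ge0 ?subr_ge0 ?(ltW r1) //.
by rewrite lerBlDr lerDl exprn_ge0 // ltW.
Qed.

(** The expansions of interest only contain, after division by a power of [t],
    powers of [t^6]; the first two of their terms suffice. *)
Definition jet F c d := Ot 7 (fun w => F w - (c + d * t w ^+ 6)).

Lemma jet_ext F G c d : cusp (fun w => F w = G w) -> jet F c d -> jet G c d.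
Proof. by move=> FG; apply: Ot_ext; apply: cusp_imp FG => w ->. Qed.

Lemma jet_eq F c d c' d' : jet F c d -> c = c' -> d = d' -> jet F c' d'.
Proof. by move=> h <- <-. Qed.

Lemma jet_cst c : jet (fun=> c) c 0.
Proof. by apply: (Ot_eq (F := fun w => 0 * t w ^+ 7)); [move=> w; ring|exact: OtZt]. Qed.

Lemma jetD F G c d c' d' : jet F c d -> jet G c' d' -> jet (fun w => F w + G w) (c + c') (d + d').
Proof. by move=> h1 h2; apply: Ot_eq (OtD h1 h2) => w; ring. Qed.

Lemma jetZ a F c d : jet F c d -> jet (fun w => a * F w) (a * c) (a * d).
Proof. by move=> h; apply: Ot_eq (OtZ a h) => w; ring. Qed.

Lemma jet_bounded F c d : jet F c d -> Ot 0 F.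
Proof.
move=> h; apply: (Ot_eq (F := fun w => (F w - (c + d * t w ^+ 6)) + (c + d * t w ^+ 6))).
  by move=> w; rewrite subrK.
by apply: OtD; [exact: Ot_le h|apply: OtD; [exact: Ot_cst|exact: OtZt]].
Qed.

Lemma jetM F G c d c' d' : jet F c d -> jet G c' d' ->
  jet (fun w => F w * G w) (c * c') (c * d' + d * c').
Proof.
move=> h1 h2; have b2 := jet_bounded h2.
have h3 := OtD (OtM (Ot_cst c) h2) (OtM h1 b2).
have h4 : Ot 7 (fun w => d * t w ^+ 6 * (G w - (c' + d' * t w ^+ 6))).
  by apply: (@Ot_le 7 13) => //; apply: (@OtM 6 7) => //; exact: OtZt.
have h5 : Ot 7 (fun w => d * d' * t w ^+ 12) by exact: OtZt.
by apply: Ot_eq (OtD (OtD h3 h4) h5) => w; ring.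
Qed.

Lemma jet_neq0 F c d : jet F c d -> c != 0 -> cusp (fun w => nm c / 2 <= nm (F w)).
Proof.
move=> h c0.
have h1 : Ot 1 (fun w => F w - c).
  apply: (Ot_eq (F := fun w => (F w - (c + d * t w ^+ 6)) + d * t w ^+ 6)); first by move=> w; ring.
  by apply: OtD; [exact: Ot_le h|exact: OtZt].
have c2 : 0 < nm c / 2 by rewrite divr_gt0 // nm_gt0.
apply: cusp_imp (Ot_small h1 c2) => w hw.
have := ler_nm_dist c (F w); rewrite nm_distC; lra.
Qed.

(** The remainder of the inverse is a combination of that of [F], multiplied by
    the bounded function [1 / F]. *)
Lemma jetV F c d : jet F c d -> c != 0 -> jet (fun w => (F w)^-1) c^-1 (- d / c ^+ 2).
Proof.
move=> h c0; have n0 := jet_neq0 h c0; have c2 : 0 < nm c / 2 by rewrite divr_gt0 // nm_gt0.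
have V0 : Ot 0 (fun w => (F w)^-1).
  exists (nm c / 2)^-1; first by rewrite invr_ge0 ltW.
  apply: cusp_imp n0 => w hw; rewrite expr0 mulr1 nmV lef_pV2 ?posrE //.
  exact: lt_le_trans hw.
pose E w := F w - (c + d * t w ^+ 6).
have h1 : Ot 7 (fun w => - c^-1 * E w + d / c ^+ 2 * (t w ^+ 6 * E w) + d ^+ 2 / c ^+ 2 * t w ^+ 12).
  apply: OtD; last exact: OtZt.
  apply: OtD; first exact: OtZ.
  by apply: OtZ; apply: (@Ot_le 7 13) => //; exact: (@OtM 6 7 _ _ (Ot_t 6)).
apply: Ot_ext (OtM h1 V0); apply: cusp_imp n0 => w hw.
have Fw : F w != 0 by rewrite -nm_gt0; exact: lt_le_trans hw.
by rewrite /E; field; rewrite c0 Fw.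
Qed.

Lemma jetX F c d n : jet F c d -> jet (fun w => F w ^+ n) (c ^+ n) (n%:R * c ^+ n.-1 * d).
Proof.
move=> h; elim: n => [|n IH].
  apply: jet_eq (jet_ext _ (jet_cst 1)) _ _ => //; last by rewrite !mul0r.
  by apply: cusp_true => w; rewrite expr0.
apply: (jet_ext (F := fun w => F w * F w ^+ n)); first by apply: cusp_true => w; rewrite exprS.
apply: jet_eq (jetM h IH) _ _; first by rewrite exprS.
case: n {IH} => [|n] /=; first by rewrite expr0; ring.
by rewrite -[in RHS]addn1 natrD exprS; ring.
Qed.

Lemma jet_Ot k F : (6 < k)%N -> Ot k F -> jet F 0 0.
Proof. by move=> k6 h; apply: Ot_eq (Ot_le k6 h) => w; ring. Qed.

Lemma jet_t6 : jet (fun w => t w ^+ 6) 0 1.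
Proof. by apply: (Ot_eq (F := fun w => 0 * t w ^+ 7)); [move=> w; ring|exact: OtZt]. Qed.

Lemma jet_divt F c d : Ot 8 (fun w => F w - (c * t w + d * t w ^+ 7)) -> jet (fun w => F w / t w) c d.
Proof.
move=> /Ot_divt; apply: Ot_eq => w; have t0 := chi_neq0 1 w; rewrite [t w ^+ 7]exprS.
by field.
Qed.

Lemma jet_unique c d : jet (fun=> 0) c d -> c = 0 /\ d = 0.
Proof.
move=> h; have c0 : c = 0.
  apply: (@Ot_leading 0); have := OtD (Ot_le (isT : (1 <= 7)%N) h) (OtZt d (isT : (1 <= 6)%N)).
  move=> /(OtZ (-1)); apply: Ot_eq => w; ring.
split=> //; apply: (@Ot_leading 6); move: h => /(OtZ (-1)); apply: Ot_eq => w; rewrite c0; ring.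
Qed.

End Jets.

(** * The fourth power of eta and its bracket *)

Section EtaFourth.
Variable R : realType.
Implicit Types (F : R[i] -> R[i]) (w z tau c d : R[i]) (g : 'M[int]_2).
Local Notation t := (@chi R 1).
Local Notation omega := (2 * (pi : R)%:C * 'i : R[i]).

Lemma upper_near tau z : nm (z - tau) < complex.Im tau -> upperP z.
Proof.
by move=> h; have := le_lt_trans (Im_le_nm _) h; rewrite raddfB /upperP /= ltr_norml; lra.
Qed.

(** The derivative as a function, differentiable again by [holo_derivative]. *)
Lemma upper_derivative F : (forall tau, upperP tau -> cdf F tau) ->
  exists F', (forall tau, upperP tau -> cder F tau (F' tau)) /\
    forall tau, upperP tau -> cdf F' tau.
Proof.
move=> Fh; have /choice[F' FF'] tau : exists l, upperP tau -> cder F tau l.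
  by have [t0|t0] := pselect (upperP tau); [have [l] := Fh _ t0; exists l|exists 0].
exists F'; split=> // tau t0.
apply: (@holo_derivative _ F F' tau (complex.Im tau)) => // z /upper_near; exact: FF'.
Qed.

Lemma cder_jf g tau : cder (jf g) tau (g 1 0)%:~R.
Proof. by apply: (cder_eq (cderD (cderZ _ (cder_id _)) (cder_cst _ _))); rewrite mulr1 addr0. Qed.

(** Differentiates an identity between functions that holds on the half-plane
    only. *)
Lemma cder_upper_unique F G tau (l m : R[i]) : upperP tau -> (forall z, upperP z -> F z = G z) ->
  cder F tau l -> cder G tau m -> l = m.
Proof.
move=> t0 FG h1 h2; apply: (cder_unique (cder_ext (g := G) t0 _ h1) h2) => w.
by move=> /upper_near/FG.
Qed.

(** Differentiates the law of transformation; the derivative of the action is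
    [j^(-2)]. *)
Lemma weight2_der (f f1 : R[i] -> R[i]) g : SL2Z g ->
  (forall tau, upperP tau -> f (mob g tau) = jf g tau ^+ 2 * f tau) ->
  (forall tau, upperP tau -> cder f tau (f1 tau)) ->
  forall tau, upperP tau -> f1 (mob g tau) =
    jf g tau ^+ 4 * f1 tau + 2 * (g 1 0)%:~R * (jf g tau ^+ 3 * f tau).
Proof.
move=> Sg fg fd tau t0; have j0 := jf_neq0 Sg t0.
have := cder_upper_unique t0 fg (cder_comp (cder_mob Sg t0) (fd _ (mob_upper Sg t0)))
  (cderM (cderX 2 (cder_jf g tau)) (fd _ t0)).
move=> /(congr1 (fun x => x * jf g tau ^+ 2)); rewrite divfK ?expf_neq0 // => ->.
by rewrite /=; ring.
Qed.

Lemma weight2_der2 (f f1 f2 : R[i] -> R[i]) g : SL2Z g ->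
  (forall tau, upperP tau -> f (mob g tau) = jf g tau ^+ 2 * f tau) ->
  (forall tau, upperP tau -> cder f tau (f1 tau)) ->
  (forall tau, upperP tau -> cder f1 tau (f2 tau)) ->
  forall tau, upperP tau -> f2 (mob g tau) =
    jf g tau ^+ 6 * f2 tau + 6 * (g 1 0)%:~R * (jf g tau ^+ 5 * f1 tau) +
    6 * (g 1 0)%:~R ^+ 2 * (jf g tau ^+ 4 * f tau).
Proof.
move=> Sg fg fd f1d tau t0; have j0 := jf_neq0 Sg t0.
have := cder_upper_unique t0 (weight2_der Sg fg fd)
  (cder_comp (cder_mob Sg t0) (f1d _ (mob_upper Sg t0)))
  (cderD (cderM (cderX 4 (cder_jf g tau)) (f1d _ t0))
    (cderZ _ (cderM (cderX 3 (cder_jf g tau)) (fd _ t0)))).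
move=> /(congr1 (fun x => x * jf g tau ^+ 2)); rewrite divfK ?expf_neq0 // => ->.
by rewrite /=; ring.
Qed.

(** The first factor of the product is [1 - t^6], and the error of truncation is
    [O(t^12)]. *)
Lemma phi1_expansion : jet (fun w => phi (t w ^+ 6) 1) 1 (-1).
Proof.
exists (iprod_cst 1 (1 / 2)).
  by rewrite /iprod_cst mulr1 divr_ge0 ?expR_ge0 // subr_ge0; lra.
have h12 : 0 < (1 / 2 : R) by rewrite divr_gt0.
apply: cusp_imp (cusp_and (cusp_chi h12) (cusp_chi ltr01)) => w [h h1].
set q := t w ^+ 6.
have qE : nm q = nm (t w) ^+ 6 by rewrite nmX.
have q6 : nm q <= 1 / 2.
  by rewrite qE exprS; have := exprn_ile1 5 (nm_ge0 (t w)) h1; have := nm_ge0 (t w); nra.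
have q1 : nm q < 1 by lra.
have qg := phi_geom q (lexx (nm (1 : R[i]))); rewrite nm1 in qg.
have := iprod_rate ler01 (nm_ge0 q) q1 qg 1.
rewrite /pprod big_nat1 expr1 mulr1 -/(phi q 1) (_ : 1 + -1 * q = 1 - q); last by ring.
move=> /le_trans; apply; rewrite /iprod_cst !mulr1.
have q0 : 0 < 1 - nm q by rewrite subr_gt0.
have V : (1 - nm q)^-1 <= (1 - 1 / 2)^-1 by rewrite lef_pV2 ?posrE //; lra.
apply: ler_pM.
- by rewrite divr_ge0 ?expR_ge0 // ltW.
- exact: exprn_ge0 (nm_ge0 _).
- by apply: ler_pM; rewrite ?expR_ge0 ?invr_ge0 ?(ltW q0) // ler_expR !div1r in V *.
- by rewrite qE -exprM ler_wiXn2l // nm_ge0.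
Qed.

Lemma f4_6 w : f4 (6 * w) = t w * phi (t w ^+ 6) 1 ^+ 4.
Proof.
have h4 : hc (6 * w / 12) ^+ 4 = t w :> R[i].
  by rewrite !exprS expr0 mulr1 -!hcD -hc_double; congr hc; field.
have h6 : chi 1 (6 * w) = t w ^+ 6.
  by rewrite -chiX chi1E /chi; congr (expC _ : R[i]); rewrite -[6%:~R]/(6%:R : R[i]); ring.
by rewrite /f4 /eta h6 -{2}h4 -(exprMn 4 (hc (6 * w / 12))).
Qed.

(** The error of [f4 = t - 4 t^7] is [O(t^8)], and differentiation preserves
    this. Derivatives are taken with respect to [w = tau / 6], whence the
    factors 6 and 36. *)
Lemma f4_jets (f1 f2 : R[i] -> R[i]) :
  (forall tau, upperP tau -> cder (@f4 R) tau (f1 tau)) ->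
  (forall tau, upperP tau -> cder f1 tau (f2 tau)) ->
  [/\ jet (fun w => f4 (6 * w) / t w) 1 (-4),
      jet (fun w => 6 * f1 (6 * w) / t w) omega (-28 * omega),
      jet (fun w => 36 * f2 (6 * w) / t w) (omega ^+ 2) (-196 * omega ^+ 2) &
      Ot 8 (fun w => f4 (6 * w) - (t w - 4 * t w ^+ 7))].
Proof.
move=> fd f1d.
have J4 : jet (fun w => f4 (6 * w) / t w) 1 (-4).
  apply: jet_eq (jet_ext _ (jetX 4 phi1_expansion)) _ _.
  - apply: cusp_true => w; rewrite f4_6 mulrAC divff ?mul1r //; exact: chi_neq0.
  - by rewrite expr1n.
  - by rewrite /= expr1n; ring.
have E8 : Ot 8 (fun w => f4 (6 * w) - (t w - 4 * t w ^+ 7)).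
  apply: Ot_eq (OtM (Ot_t R 1) J4) => w; have t0 := chi_neq0 1 w.
  by rewrite expr1; field.
have d0 w : 0 < complex.Im w -> cder (fun w => f4 (6 * w)) w (6 * f1 (6 * w)).
  move=> w0; rewrite mulrC; apply: (cder_comp (f := @f4 R)); first exact: cder_scale.
  by apply: fd; exact: upper_6.
have d1 w : 0 < complex.Im w -> cder (fun w => 6 * f1 (6 * w)) w (36 * f2 (6 * w)).
  move=> w0; have -> : 36 * f2 (6 * w) = 6 * (f2 (6 * w) * 6) by ring.
  apply: cderZ; apply: (cder_comp (f := f1)); first exact: cder_scale.
  by apply: f1d; exact: upper_6.
have dt (n : nat) w : cder (fun w => t w ^+ n) w (n%:R * omega * t w ^+ n).
  have -> : (fun w => t w ^+ n) = @chi R n by apply/funext => z; rewrite chiX.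
  by apply: cder_eq (cder_chi n w) _; rewrite chiX -pmulrn; ring.
have dE w : 0 < complex.Im w -> cder (fun w => f4 (6 * w) - (t w - 4 * t w ^+ 7)) w
    (6 * f1 (6 * w) - (omega * t w - 28 * omega * t w ^+ 7)).
  move=> w0; apply: cder_eq (cderB (d0 _ w0) (cderB (dt 1 w) (cderZ 4 (dt 7 w)))) _.
  by rewrite expr1; ring.
have E8' := Ot_der dE E8.
have dE' w : 0 < complex.Im w -> cder (fun w => 6 * f1 (6 * w) - (omega * t w - 28 * omega * t w ^+ 7)) w
    (36 * f2 (6 * w) - (omega ^+ 2 * t w - 196 * omega ^+ 2 * t w ^+ 7)).
  move=> w0.
  apply: cder_eq (cderB (d1 _ w0) (cderB (cderZ omega (dt 1 w)) (cderZ (28 * omega) (dt 7 w)))) _.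
  by rewrite expr1; ring.
have E8'' := Ot_der dE' E8'.
by split=> //; apply: jet_divt; [apply: Ot_eq E8'|apply: Ot_eq E8''] => w; ring.
Qed.

(** The bracket [3 f'^2 - 2 f f''] of a form of weight 2 has weight 8, as the
    terms with [c] cancel in the formulas of [weight2_der] and [weight2_der2].
    Its quotient by [f^4] has weight 0 and a double pole at the cusp. *)
Theorem bracket_quotient : exists X : R[i] -> R[i],
  [/\ forall tau, upperP tau -> cdf X tau,
      forall g tau, Gamma' g -> upperP tau -> X (mob g tau) = X tau &
      jet (fun w => X (6 * w) * t w ^+ 2) 1 248].
Proof.
have [f1 [fd f1h]] := upper_derivative (@f4_holo R).
have [f2 [f1d f2h]] := upper_derivative f1h.
exists (fun tau => (6 / omega) ^+ 2 * ((3 * f1 tau ^+ 2 - 2 * (f4 tau * f2 tau)) / f4 tau ^+ 4)); split.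
- move=> tau t0; apply: cdfZ; apply: cdfM.
    apply: cdfB; apply: cdfZ; first by apply: cdfX; exact: f1h.
    by apply: cdfM; [exact: f4_holo|exact: f2h].
  by apply: cdfV; [rewrite expf_neq0 // f4_neq0|apply: cdfX; exact: f4_holo].
- move=> g tau Gg t0; have Sg := Gamma'_SL2Z Gg.
  have fg z : upperP z -> f4 (mob g z) = jf g z ^+ 2 * f4 z by exact: f4_Gamma'.
  rewrite (weight2_der2 Sg fg fd f1d t0) (weight2_der Sg fg fd t0) (fg _ t0).
  congr (_ * _); have := f4_neq0 t0; have := jf_neq0 Sg t0.
  move: (jf g tau) (f4 tau) (f1 tau) (f2 tau) => j a b e j0 a0.
  by field; rewrite a0 j0.
have [J0 J1 J2 _] := f4_jets fd f1d.
have n1 : 1 ^+ 4 != 0 :> R[i] by rewrite expr1n oner_neq0.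
have w0 : omega != 0 := twopii_neq0 R.
have := jetZ (omega ^- 2) (jetM (jetD (jetZ 3 (jetX 2 J1)) (jetZ (-2) (jetM J0 J2)))
  (jetV (jetX 4 J0) n1)).
move=> J; apply: jet_eq (jet_ext _ J) _ _.
- exists 1 => w hw; have t0 := chi_neq0 1 w.
  have f0 : f4 (6 * w) != 0 by apply: f4_neq0; apply: upper_6; rewrite /upperP; lra.
  move: f0 t0; move: (t w) (f4 _) (f1 _) (f2 _) w0 => T a b e w0 a0 T0.
  move: omega w0 => o o0.
  by field; rewrite a0 T0 o0.
- by rewrite !expr1n; move: omega w0 => o o0; field.
- by rewrite /= !expr1n; move: omega w0 => o o0; field.
Qed.

End EtaFourth.

(** * Unordered sums and the hexagonal lattice *)

Section UnorderedSums.
Variables (R : realType) (I : choiceType).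
Implicit Types (u v : I -> R[i]) (b : I -> R) (A B : {fset I}) (l : R[i]) (e : R).

Lemma fsum_split (V : nmodType) (F : I -> V) A B : (A `<=` B)%fset ->
  \sum_(i <- B) F i = \sum_(i <- A) F i + \sum_(i <- B | i \notin A) F i.
Proof.
move=> AB; rewrite (bigID (mem A)) /=; congr (_ + _); rewrite -big_filter.
apply: perm_big; apply: uniq_perm; rewrite ?filter_uniq ?fset_uniq // => i.
by rewrite mem_filter andb_idr // => /(fsubsetP AB).
Qed.

(** Unordered summation over an arbitrary index set: the limit along the finite
    subsets, directed by inclusion. *)
Definition has_Usum u l := forall e, 0 < e ->
  exists A, forall B, (A `<=` B)%fset -> nm (\sum_(i <- B) u i - l) <= e.

Definition bounded_sums b := (forall i, 0 <= b i) /\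
  exists S : R, forall A, \sum_(i <- A) b i <= S.

Definition tail b e A := forall B, (A `<=` B)%fset -> \sum_(i <- B | i \notin A) b i <= e.

(** A finite sum comes within [e] of the supremum of all finite sums. *)
Lemma tail_ex b e : bounded_sums b -> 0 < e -> exists A, tail b e A.
Proof.
move=> [b0 [S bS]] e0; pose X := [set x : R | exists A, x = \sum_(i <- A) b i].
have hX : has_sup X.
  split; first by exists (\sum_(i <- (fset0 : {fset I})) b i), fset0.
  by exists S => _ [A ->].
have [_ [A ->] hA] := sup_adherent e0 hX; exists A => B AB.
have : \sum_(i <- B) b i <= sup X by apply: (sup_ubound hX.2); exists B.
rewrite (fsum_split b AB); lra.
Qed.

Lemma fsum_mono b A B : (forall i, 0 <= b i) -> (A `<=` B)%fset -> \sum_(i <- A) b i <= \sum_(i <- B) b i.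
Proof. by move=> b0 AB; rewrite (fsum_split b AB) lerDl sumr_ge0. Qed.

Lemma has_Usum_unique u l (m : R[i]) : has_Usum u l -> has_Usum u m -> l = m.
Proof.
move=> h1 h2; apply/eqP; rewrite -subr_eq0; apply/eqP/nm_eq0P => e e0.
have e20 : 0 < e / 2 by lra.
have [A AP] := h1 _ e20; have [B BP] := h2 _ e20.
have hA := AP (A `|` B)%fset (fsubsetUl _ _); have := BP (A `|` B)%fset (fsubsetUr _ _).
rewrite nm_distC in hA.
have := nm_trans l (\sum_(i <- (A `|` B)%fset) u i) m; lra.
Qed.

Lemma has_UsumD u v l (m : R[i]) : has_Usum u l -> has_Usum v m ->
  has_Usum (fun i => u i + v i) (l + m).
Proof.
move=> h1 h2 e e0; have e20 : 0 < e / 2 by lra.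
have [A AP] := h1 _ e20; have [B BP] := h2 _ e20; exists (A `|` B)%fset => D.
rewrite fsubUset => /andP[/AP hA /BP hB].
rewrite big_split /= opprD addrACA (le_trans (nmD _ _)) //; lra.
Qed.

Lemma has_UsumZ (k : R[i]) u l : has_Usum u l -> has_Usum (fun i => k * u i) (k * l).
Proof.
move=> h e e0; have k0 : 0 < nm k + 1 by rewrite ltr_wpDl ?nm_ge0.
have [A AP] := h _ (divr_gt0 e0 k0); exists A => B /AP.
rewrite -mulr_sumr -mulrBr nmM ler_pdivlMr // => hB.
by apply: le_trans hB; rewrite mulrC ler_wpM2l ?nm_ge0 // lerDl.
Qed.

Lemma has_Usum_ext u v l : (forall i, u i = v i) -> has_Usum u l -> has_Usum v l.
Proof. by move=> /funext ->. Qed.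

Lemma has_Usum_delta i0 l : has_Usum (fun i => if i == i0 then l else 0) l.
Proof.
move=> e e0; exists [fset i0]%fset => B /fsubsetP/(_ i0); rewrite inE eqxx => /(_ isT) Bi.
rewrite (big_fsetD1 _ Bi) /= eqxx big_seq big1 ?addr0 ?subrr ?nm0 ?(ltW e0) //.
by move=> i; rewrite !inE => /andP[/negPf ->].
Qed.

Lemma has_Usum_remove u l i0 : has_Usum u l ->
  has_Usum (fun i => if i == i0 then 0 else u i) (l - u i0).
Proof.
move=> h; have := has_UsumD h (has_Usum_delta i0 (- u i0)).
by apply: has_Usum_ext => i; case: eqP => [->|_]; rewrite ?subrr ?addr0.
Qed.

(** The finite subsets correspond under a permutation of the indices. *)
Lemma has_Usum_reindex u l (s s' : I -> I) : cancel s s' -> cancel s' s ->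
  has_Usum u l -> has_Usum (fun i => u (s i)) l.
Proof.
move=> ss' s's h e /h[A AP]; exists [fset s' i | i in A]%fset => B /fsubsetP AB.
have -> : \sum_(i <- B) u (s i) = \sum_(i <- [fset s i | i in B]%fset) u i.
  by rewrite big_imfset //= => x y _ _; exact: (can_inj ss').
apply: AP; apply/fsubsetP => i iA; apply/imfsetP; exists (s' i); last by rewrite s's.
by apply: AB; apply/imfsetP; exists i.
Qed.

Lemma nm_fsum_tail u b e A B : (forall i, nm (u i) <= b i) -> tail b e A -> (A `<=` B)%fset ->
  nm (\sum_(i <- B) u i - \sum_(i <- A) u i) <= e.
Proof.
move=> ub tA AB; rewrite (fsum_split u AB) addrC addKr (le_trans (nm_sum _ _ _)) //.
by apply: (le_trans _ (tA _ AB)); exact: ler_sum.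
Qed.

Lemma tail_sum u b l e A : (forall i, nm (u i) <= b i) -> tail b e A -> has_Usum u l ->
  nm (\sum_(i <- A) u i - l) <= e.
Proof.
move=> ub tA h; apply/ler_addgt0Pl => e' /h[B BP].
have := BP (A `|` B)%fset (fsubsetUr _ _).
have := nm_fsum_tail ub tA (fsubsetUl A B); rewrite nm_distC.
have := nm_trans (\sum_(i <- A) u i) (\sum_(i <- (A `|` B)%fset) u i) l; lra.
Qed.

Lemma has_Usum_bound u b l (S : R) : (forall i, nm (u i) <= b i) ->
  (forall A, \sum_(i <- A) b i <= S) -> has_Usum u l -> nm l <= S.
Proof.
move=> ub bS h; apply/ler_addgt0Pl => e /h[A /(_ A (fsubset_refl _)) hA].
have h1 : nm (\sum_(i <- A) u i) <= S.
  by rewrite (le_trans (nm_sum _ _ _)) // (le_trans _ (bS A)) // ler_sum.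
have := nmB (\sum_(i <- A) u i) (\sum_(i <- A) u i - l); rewrite opprB addrCA subrr addr0; lra.
Qed.

(** A sequence of finite sets makes unordered sums into limits of sequences,
    uniformly for all families with the same bound. *)
Lemma exhaustion b : bounded_sums b -> exists E : nat -> {fset I}, forall n, tail b (1 / 2 ^+ n) (E n).
Proof.
move=> bs; have /boolp.choice[E EP] (n : nat) : exists A, tail b (1 / 2 ^+ n) A.
  by apply: tail_ex => //; rewrite divr_gt0 ?exprn_gt0.
by exists E.
Qed.

Lemma has_Usum_ex u b : bounded_sums b -> (forall i, nm (u i) <= b i) -> exists l, has_Usum u l.
Proof.
move=> bs ub; have [E EP] := exhaustion bs.
have small e : 0 < e -> exists N : nat, forall n, (N <= n)%N -> 1 / 2 ^+ n <= e.
  move=> e0; have [N NP] := exp2_lt 1 e0; exists N => n Nn.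
  rewrite (le_trans _ (ltW NP)) // !div1r lef_pV2 ?posrE ?exprn_gt0 //.
  by rewrite ler_weXn2l // ler1n.
have [|l lP] := @complex_complete R (fun n => \sum_(i <- E n) u i).
  move=> e e0; have e20 : 0 < e / 2 by lra.
  have [N NP] := small _ e20; exists N => n m /NP hn /NP hm.
  have h1 := nm_fsum_tail ub (EP n) (fsubsetUl (E n) (E m)); rewrite nm_distC in h1.
  have h2 := nm_fsum_tail ub (EP m) (fsubsetUr (E n) (E m)).
  apply: (le_trans (nm_trans _ (\sum_(i <- (E n `|` E m)%fset) u i) _)); lra.
exists l => e e0; have e20 : 0 < e / 2 by lra.
have [N1 h1] := small _ e20; have [N2 h2] := lP _ e20.
pose N := maxn N1 N2; exists (E N) => B hB.
have := nm_fsum_tail ub (EP N) hB; have := h1 N (leq_maxl _ _); have := h2 N (leq_maxr _ _).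
have := nm_trans (\sum_(i <- B) u i) (\sum_(i <- E N) u i) l; lra.
Qed.

Lemma cdf_sum (u : I -> R[i] -> R[i]) A z : (forall i, cdf (u i) z) ->
  cdf (fun z => \sum_(i <- A) u i z) z.
Proof.
move=> uh; elim: (enum_fset A) => [|i s IH].
  have -> : (fun z => \sum_(i <- [::]) u i z) = fun=> 0 by apply/funext => w; rewrite big_nil.
  exact: cdf_cst.
have -> : (fun z => \sum_(j <- i :: s) u j z) = (fun z => u i z + \sum_(j <- s) u j z).
  by apply/funext => w; rewrite big_cons.
exact: cdfD.
Qed.

(** The sums over the sets of an exhaustion converge uniformly, so [Weierstrass]
    applies. *)
Theorem Usum_holo (u : I -> R[i] -> R[i]) b (G : R[i] -> R[i]) z0 (rho : R) :
  bounded_sums b -> 0 < rho ->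
  (forall i z, nm (z - z0) < rho -> cdf (u i) z /\ nm (u i z) <= b i) ->
  (forall z, nm (z - z0) < rho -> has_Usum (u^~ z) (G z)) ->
  cdf G z0.
Proof.
move=> bs rho0 H HG; have [E EP] := exhaustion bs.
apply: (@Weierstrass R (fun n z => \sum_(i <- E n) u i z) G z0 rho rho0).
  by move=> n z hz; apply: cdf_sum => i; have [] := H i _ hz.
move=> e e0; have [N NP] := exp2_lt 1 e0; exists N => n z Nn hz.
have ub i : nm (u i z) <= b i by have [] := H i _ hz.
apply: (le_trans (tail_sum ub (EP n) (HG _ hz))).
rewrite (le_trans _ (ltW NP)) // !div1r lef_pV2 ?posrE ?exprn_gt0 //.
by rewrite ler_weXn2l // ler1n.
Qed.

End UnorderedSums.

Section LatticeSums.
Variable R : realType.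
Implicit Types (c x y e : R) (z w : R[i]) (m n : int) (k : nat).

Lemma fset_nat_bound (g : nat -> R) (S : R) (A : {fset nat}) : (forall k, 0 <= g k) ->
  (forall N, \sum_(0 <= k < N) g k <= S) -> \sum_(k <- A) g k <= S.
Proof.
move=> g0 gS; pose N := (\max_(k <- A) k).+1.
apply: le_trans (gS N); rewrite [leRHS](bigID (mem A)) /=.
rewrite -[leLHS]addr0 lerD ?sumr_ge0 // le_eqVlt; apply/orP; left; apply/eqP.
rewrite -[RHS]big_filter; apply: perm_big; apply: uniq_perm.
- exact: fset_uniq.
- by rewrite filter_uniq // iota_uniq.
move=> k; rewrite mem_filter mem_index_iota /= andb_idr // => kA.
by rewrite ltnS (@leq_bigmax_seq _ _ (fun=> true) id).
Qed.

Lemma sum_inj_bound (I J : choiceType) (h : I -> J) (f : I -> R) (g : J -> R) (S : R) (A : {fset I}) :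
  injective h -> (forall i, f i <= g (h i)) -> (forall B : {fset J}, \sum_(j <- B) g j <= S) ->
  \sum_(i <- A) f i <= S.
Proof.
move=> hI fg gS; apply: le_trans (gS [fset h i | i in A]%fset).
by rewrite big_imfset /=; [exact: ler_sum|move=> ? ? _ _; exact: hI].
Qed.

Definition isq m : R := (1 + m%:~R ^+ 2)^-1.

Lemma isq_gt0 m : 0 < isq m. Proof. by rewrite invr_gt0 ltr_pwDl // sqr_ge0. Qed.

(** Indexing the integers by the naturals as 0, -1, 1, -2, ... bounds [1 / (1 +
    m^2)] by a multiple of [1 / ((k + 1) (k + 2))], which telescopes. *)
Lemma isq_sum (A : {fset int}) : \sum_(m <- A) isq m <= 16.
Proof.
pose h m : nat := match m with Posz n => n.*2 | Negz n => n.*2.+1 end.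
pose g (k : nat) : R := 16 / ((k%:R + 1) * (k%:R + 2)).
have kp (k : nat) : 0 <= k%:R :> R by [].
apply: (@sum_inj_bound _ _ h _ g).
- move=> [m|m] [n|n] //=; rewrite /h; lia.
- have E (k : nat) (x : R) : (k%:R + 1) * (k%:R + 2) <= 16 * (1 + x) -> 0 <= x -> (1 + x)^-1 <= g k.
    move=> h1 x0; rewrite /g ler_pdivlMr ?mulr_gt0 ?ltr_wpDl //.
    by rewrite mulrC ler_pdivrMr ?ltr_pwDl //.
  move=> [m|m]; apply: E; rewrite ?sqr_ge0 // /h.
    rewrite -[m.*2]muln2 natrM -[m%:~R]/(m%:R : R); have := kp m; nra.
  rewrite -[m.*2]muln2 NegzE mulrNz sqrrN -[m.+1%:~R]/(m.+1%:R : R) -(natr1 m) -(natr1 (m * 2)) natrM.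
  have := kp m; nra.
move=> B; apply: fset_nat_bound => [k|N]; first by rewrite /g divr_ge0 // mulr_ge0 // addr_ge0.
have -> : \sum_(0 <= k < N) g k = 16 * (1 - (N%:R + 1)^-1).
  elim: N => [|N IH]; first by rewrite big_geq // add0r invr1 subrr mulr0.
  have N0 := kp N; rewrite big_nat_recr //= IH /g -natr1; field; lra.
by have := kp N; rewrite ler_piMr // gerBl invr_ge0 addr_ge0.
Qed.

Local Notation index := (int * int)%type.

(** For [w = c (m + n rho)] the number [(1 + |w|)^4] is at least a multiple of
    [(1 + m^2) (1 + n^2)], the inverse of this weight. *)
Definition wt (i : index) : R := isq i.1 * isq i.2.

(** A finite set of pairs lies in a product of two finite sets, over which the
    sum of [wt] is a product. *)
Lemma wt_bounded (K : R) : 0 <= K -> bounded_sums (fun i => K * wt i).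
Proof.
move=> K0; split; first by move=> i; rewrite mulr_ge0 // mulr_ge0 // ltW // isq_gt0.
exists (K * (16 * 16)) => A; rewrite -mulr_sumr ler_wpM2l //.
pose A1 := [fset i.1 | i in A]%fset; pose A2 := [fset i.2 | i in A]%fset.
apply: (@le_trans _ _ (\sum_(i <- (A1 `*` A2)%fset) wt i)).
  apply: (@fsum_mono R _ wt) => [i|]; first by rewrite mulr_ge0 // ltW // isq_gt0.
  apply/fsubsetP => i iA; rewrite in_fsetM; apply/andP.
  by split; apply/imfsetP; exists i.
rewrite big_imfset2 /=; last by move=> [? ?] [? ?] _ _ /= [-> ->].
rewrite /wt /=; under eq_bigr do rewrite -mulr_sumr; rewrite -mulr_suml.
by apply: ler_pM; rewrite ?isq_sum // sumr_ge0 // => i _; rewrite ltW // isq_gt0.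
Qed.


(** The lattice c[1, rho] through its coordinates. *)
Definition lat c (i : index) : R[i] := c%:C * (i.1%:~R + i.2%:~R * (rho R : R[i])).

Lemma latD c i j : lat c (i + j) = lat c i + lat c j.
Proof. by rewrite /lat /= !intrD; ring. Qed.
Lemma latN c i : lat c (- i) = - lat c i.
Proof. by rewrite /lat /= !intrN; ring. Qed.
Lemma lat0 c : lat c 0 = 0.
Proof. by rewrite /lat /= mul0r addr0 mulr0. Qed.

Lemma latP c (z : R[i]) : lattice c%:C (c%:C * rho R) (z : CC R) <-> exists i, z = lat c i.
Proof.
split=> [[m [n ->]]|[[m n] ->]]; first by exists (m, n); rewrite /lat /=; ring.
by exists m, n; rewrite /lat /=; ring.
Qed.

(** [rho] is a root of [r^2 + r + 1] by [rho^3 = 1], which determines its real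
    part and the square of its imaginary part. *)
Lemma rhoE : complex.Re (rho R) = - (1 / 2) /\ complex.Im (rho R) ^+ 2 = 3 / 4.
Proof.
have E : (rho R : R[i]) = chi 1 (1 / 3).
  by rewrite chi1E /rho div1r.
have r3 : (rho R : R[i]) ^+ 3 = 1.
  by rewrite E -chiX -[RHS](chi_int R 1 1) /chi; congr (expC _ : R[i]); field.
have r1 : (rho R : R[i]) != 1.
  rewrite E; apply/eqP => /chi1_eq1 h; have /eqP : (1 / 3 : R[i]) = 0.
    apply: h; rewrite (_ : 1 / 3 = (1 / 3 : R)%:C); last by rewrite fmorph_div rmorph1 rmorph_nat.
    by rewrite /= ger0_norm; lra.
  by rewrite mulf_eq0 oner_eq0 invr_eq0 pnatr_eq0.
have : (rho R : R[i]) ^+ 2 + rho R + 1 = 0.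
  have r1' : (rho R : R[i]) - 1 != 0 by rewrite subr_eq0.
  have cubic (r : R[i]) : r ^+ 3 = 1 -> r - 1 != 0 -> r ^+ 2 + r + 1 = 0.
    move=> h h1; apply: (mulfI h1); rewrite mulr0 -(subrr (r ^+ 3)) {2}h; ring.
  exact: cubic.
case: (rho R : R[i]) => x y /eqP; rewrite eq_complex /= => /andP[/eqP h1 /eqP h2].
have y0 : y != 0 by apply/eqP => y0; move: h1; rewrite y0; nra.
have x12 : x = - (1 / 2).
  have : y * (2 * x + 1) = 0 by rewrite -h2; ring.
  by move/eqP; rewrite mulf_eq0 (negPf y0) /= => /eqP; lra.
by split=> //; move: h1; rewrite x12; lra.
Qed.

(** The norm form of the hexagonal lattice. *)
Lemma nm_lat c i : nm (lat c i) ^+ 2 = c ^+ 2 * (i.1%:~R ^+ 2 - i.1%:~R * i.2%:~R + i.2%:~R ^+ 2).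
Proof.
have [r1 r2] := rhoE; rewrite /lat nmM exprMn nm_real real_normK ?num_real //; congr (_ * _).
rewrite -!(rmorph_int (real_complex R)) nm_sqr.
move: r1 r2; case: (rho R : R[i]) => x y /= -> h.
by rewrite !(mul0r, mulr0, addr0, subr0, add0r) exprMn h; field.
Qed.

Lemma lat_inj c : 0 < c -> injective (lat c).
Proof.
move=> c0 i j E; apply/eqP; rewrite -subr_eq0; apply/eqP.
have : nm (lat c (i - j)) ^+ 2 = 0 by rewrite latD latN E subrr nm0 expr0n.
rewrite nm_lat => /eqP; rewrite mulf_eq0 expf_eq0 (gt_eqF c0) /=.
set x : R := _%:~R; set y : R := _%:~R => /eqP h.
have x0 : x = 0.
  apply/eqP; rewrite -sqrf_eq0 eq_le sqr_ge0 andbT; have := sqr_ge0 (x - 2 * y); nra.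
have y0 : y = 0.
  apply/eqP; rewrite -sqrf_eq0 eq_le sqr_ge0 andbT; have := sqr_ge0 (y - 2 * x); nra.
move/eqP: x0; move/eqP: y0; rewrite /x /y !intr_eq0.
by case: (i) => a b; case: (j) => a' b' /= /eqP h1 /eqP h2; congr (_, _).
Qed.

Lemma lat_lower c i : c ^+ 2 / 2 * (i.1%:~R ^+ 2 + i.2%:~R ^+ 2) <= nm (lat c i) ^+ 2.
Proof.
rewrite nm_lat -mulrA ler_wpM2l ?sqr_ge0 //.
have := sqr_ge0 (i.1%:~R - i.2%:~R : R); move: (i.1%:~R : R) (i.2%:~R : R) => x y; nra.
Qed.

(** A nonzero pair of integers satisfies [m^2 + n^2 >= 1]; the constant is not
    sharp. *)
Lemma lat_min c i : 0 < c -> i != 0 -> c / 2 <= nm (lat c i).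
Proof.
move=> c0 i0; rewrite -ler_sqr ?nnegrE ?nm_ge0 ?divr_ge0 ?(ltW c0) //.
apply: le_trans (lat_lower c i).
have i1 : 1 <= i.1%:~R ^+ 2 + i.2%:~R ^+ 2 :> R.
  rewrite !expr2 -!intrM -intrD -[1]/(1%:~R) ler_int.
  by case: i i0 => a b; rewrite -pair_eqE /= negb_and => i0; nia.
have := sqr_ge0 c; rewrite exprMn exprVn; nra.
Qed.

(** The square of [1 + |w|] is at least a multiple of both [1 + m^2] and [1 +
    n^2]. The number [x] will be [|w|] or [|z - w|]. *)
Lemma lat_dominated c : 0 < c -> exists2 K : R, 0 <= K & forall (D x : R) i k,
  (3 < k)%N -> 0 < x -> 1 + nm (lat c i) <= D * x -> x ^- k <= D ^+ k * K * wt i.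
Proof.
move=> c0; have c2 : 0 < c ^+ 2 / 2 by rewrite divr_gt0 // exprn_gt0.
have [kap [k0 k1 kc]] := minr_pos ltr01 c2.
exists (kap ^- 2); first by rewrite invr_ge0 exprn_ge0 // ltW.
move=> D x i k k3 x0 hD; set n := nm (lat c i) in hD.
have n0 : 0 <= n := nm_ge0 _.
have D0 : 0 < D.
  by rewrite -(pmulr_lgt0 _ x0); apply: lt_le_trans hD; rewrite ltr_pwDl.
have L := lat_lower c i; rewrite -/n in L.
have hm (m : int) : m%:~R ^+ 2 <= i.1%:~R ^+ 2 + i.2%:~R ^+ 2 :> R -> kap <= isq m * (1 + n) ^+ 2.
  move=> h; rewrite /isq mulrC ler_pdivlMr ?ltr_pwDl ?sqr_ge0 //.
  have := sqr_ge0 (m%:~R : R); move: (m%:~R ^+ 2 : R) h L => y h L y0.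
  have : c ^+ 2 / 2 * y <= n ^+ 2 by apply: le_trans L; rewrite ler_wpM2l // ltW.
  nra.
have h1 := hm i.1; have h2 := hm i.2; rewrite lerDl sqr_ge0 in h1; rewrite lerDr sqr_ge0 in h2.
have h3 : kap ^+ 2 <= wt i * (1 + n) ^+ 4.
  have -> : wt i * (1 + n) ^+ 4 = (isq i.1 * (1 + n) ^+ 2) * (isq i.2 * (1 + n) ^+ 2).
    by rewrite /wt; ring.
  by rewrite expr2; apply: ler_pM; rewrite ?(ltW k0) ?h1 ?h2.
have h4 : kap ^+ 2 <= wt i * (D * x) ^+ k.
  apply: (le_trans h3); rewrite ler_wpM2l //; first by rewrite mulr_ge0 // ltW // isq_gt0.
  apply: (@le_trans _ _ ((1 + n) ^+ k)); first by rewrite ler_weXn2l // lerDl.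
  by rewrite lerXn2r ?nnegrE ?addr_ge0 ?(le_trans _ hD) ?addr_ge0.
rewrite -[leLHS]mul1r ler_pdivrMr ?exprn_gt0 //.
have -> : D ^+ k * kap ^- 2 * wt i * x ^+ k = wt i * (D * x) ^+ k / kap ^+ 2.
  by rewrite exprMn; field; rewrite gt_eqF.
by rewrite ler_pdivlMr ?exprn_gt0 // mul1r.
Qed.

Lemma latX_dominated c k : 0 < c -> (3 < k)%N -> exists2 K : R, 0 <= K &
  forall i, nm (lat c i ^- k) <= K * wt i.
Proof.
move=> c0 k3; have [K K0 KP] := lat_dominated c0.
have D0 : 0 <= 2 / c + 1 by rewrite addr_ge0 // divr_ge0 // ltW.
exists ((2 / c + 1) ^+ k * K); first by rewrite mulr_ge0 // exprn_ge0.
move=> i; case: (eqVneq i 0) => [->|i0].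
  rewrite lat0 expr0n (gtn_eqF (leq_trans _ k3)) // invr0 nm0.
  by rewrite !mulr_ge0 ?exprn_ge0 // ltW // isq_gt0.
have h := lat_min c0 i0; rewrite nmV nmX; apply: KP => //.
  by apply: lt_le_trans h; rewrite divr_gt0.
rewrite mulrDl mul1r lerD2r mulrAC ler_pdivlMr // mul1r; lra.
Qed.

Lemma lat_sum_ex c k : 0 < c -> (3 < k)%N -> exists l, has_Usum (fun i => lat c i ^- k) l.
Proof.
move=> c0 k3; have [K K0 KP] := latX_dominated c0 k3.
exact: has_Usum_ex (wt_bounded K0) KP.
Qed.

(** Only the lattice points of a finite set of numbers contribute, and these are
    the image of a finite set of coordinates; the index 0 contributes [0^(-k)],
    which is 0. *)
Lemma lattice_sumE c k l : 0 < c -> (3 < k)%N -> has_Usum (fun i => lat c i ^- k) l ->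
  lattice_sum (lattice c%:C (c%:C * rho R)) k = l.
Proof.
move=> c0 k3 h; set L := lattice _ _.
have kn : (0 < k)%N by exact: leq_trans k3.
have /boolp.choice[idx idxP] (z : R[i]) : exists i, L z -> z = lat c i.
  have [/latP[i zE]|nz] := pselect (L z); last by exists 0.
  by exists i.
have idxK i : idx (lat c i) = i.
  by apply: (lat_inj c0); rewrite -idxP //; apply/latP; exists i.
have FF : ProperFilter (@finite_subsets (CC R)).
  apply: filter_from_proper; last by move=> A _; exists A; exact: fsubset_refl.
  apply: filter_from_filter; first by exists fset0.
  move=> A B _ _; exists (A `|` B)%fset => // D /=.
  by rewrite fsubUset => /andP[].
rewrite /lattice_sum; apply/cvg_lim; first exact: norm_hausdorff.
apply/cvgrPdist_lt => e; rewrite ltcE /= => /andP[/eqP e1 e0].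
have e20 : 0 < complex.Re e / 2 by lra.
have [A AP] := h _ e20.
exists [fset (lat c i : CC R) | i in A]%fset => // B /= /fsubsetP AB.
pose B' := [fset idx z | z in [fset z in B | z \in (L `\ 0)%classic]]%fset.
have BE : \sum_(w <- B | w \in L `\ 0) w ^- k = \sum_(i <- B') lat c i ^- k :> R[i].
  rewrite big_imfset /=; last first.
    move=> x y; rewrite !inE /= => /andP[_ /set_mem[Lx _]] /andP[_ /set_mem[Ly _]] E.
    by rewrite (idxP x Lx) E -idxP.
  rewrite [RHS]big_seq_cond [LHS]big_fset_condE /= [LHS]big_seq_cond.
  apply: eq_bigr => z; rewrite !inE /= andbT => /andP[_ /set_mem[Lz _]].
  by rewrite -idxP.
have B0 : 0 \notin B'.
  apply/imfsetP => -[z]; rewrite !inE /= => /andP[_ /set_mem[Lz z0]] E.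
  by apply: z0; rewrite /= (idxP z Lz) -E lat0.
have : nm (\sum_(i <- (0 |` B')%fset) lat c i ^- k - l) <= complex.Re e / 2.
  apply: AP; apply/fsubsetP => i iA; rewrite in_fset1U; case: eqP => //= /eqP i0.
  apply/imfsetP; exists (lat c i); last by rewrite idxK.
  rewrite !inE /= AB ?in_imfset //=; apply/mem_set; split; first by apply/latP; exists i.
  move=> /= E; move/eqP: i0; apply; apply: (lat_inj c0); by rewrite E lat0.
rewrite big_fsetU1 //= lat0 expr0n (gtn_eqF kn) invr0 add0r -BE => hB.
rewrite normc_nm ltcE /= e1 eqxx /= nm_distC; apply: (le_lt_trans hB); lra.
Qed.


End LatticeSums.

(** * The sum of the poles of order 4 over a lattice *)

Section FourthOrderPole.
Variables (R : realType) (c : R).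
Hypothesis c0 : 0 < c.
Implicit Types (z w x l : R[i]) (e d : R).
Local Notation lat := (lat c).

Definition in_lat z := exists i, z = lat i.

(** At most one lattice point lies within [c / 4] of [z0]. *)
Lemma off_lattice z0 : ~ in_lat z0 -> exists2 d : R, 0 < d & forall i, d <= nm (z0 - lat i).
Proof.
move=> n0; have c4 : 0 < c / 4 by rewrite divr_gt0.
have [[i hi]|far] := pselect (exists i, nm (z0 - lat i) < c / 4); last first.
  by exists (c / 4) => // i; rewrite leNgt; apply/negP => h; apply: far; exists i.
have p : 0 < nm (z0 - lat i) by rewrite nm_gt0 subr_eq0; apply/eqP => E; apply: n0; exists i.
have [d [d0 d1 d2]] := minr_pos p c4; exists d => // j.
case: (eqVneq j i) => [->//|ji]; apply: (le_trans d2).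
have := @lat_min R c (j - i) c0; rewrite subr_eq0 ji latD latN => /(_ isT).
have := nm_trans (lat j) z0 (lat i); rewrite (nm_distC (lat j) z0); lra.
Qed.

(** Away from the lattice [|z - w|] is comparable to [1 + |w|], locally
    uniformly in [z]. *)
Lemma pole_dominated z0 : ~ in_lat z0 -> exists2 d : R, 0 < d &
  exists2 K : R, 0 <= K & forall z i, nm (z - z0) < d ->
    z - lat i != 0 /\ nm ((z - lat i) ^- 4) <= K * wt R i.
Proof.
move=> /off_lattice[d d0 dP]; exists (d / 2); first by rewrite divr_gt0.
have [K K0 KP] := lat_dominated c0.
pose A := nm z0 + d; pose D := (1 + A) / (d / 2) + 1.
have A0 : 0 <= A by rewrite addr_ge0 ?nm_ge0 // ltW.
have D0 : 0 <= D.
  apply: addr_ge0 => //; apply: divr_ge0; first exact: addr_ge0.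
  by rewrite divr_ge0 // ltW.
exists (D ^+ 4 * K); first by rewrite mulr_ge0 // exprn_ge0.
move=> z i hz; have hd : d / 2 <= nm (z - lat i).
  have := nm_trans z0 z (lat i); rewrite (nm_distC z0 z); have := dP i; lra.
have p : 0 < nm (z - lat i) by lra.
split; first by rewrite -nm_gt0.
rewrite nmV nmX; apply: KP => //.
rewrite mulrDl mul1r; have h1 : 1 + A <= (1 + A) / (d / 2) * nm (z - lat i).
  by rewrite mulrAC ler_pdivlMr ?divr_gt0 // ler_wpM2l // addr_ge0.
have h2 : nm z <= A by have := ler_nm_dist z z0; rewrite /A; lra.
have := ler_nm_dist (lat i) z; rewrite nm_distC; lra.
Qed.

(** The function [Z4] is a sixth of the second derivative of the Weierstrass
    function of the lattice. For [g_2 = 0] it is the square of the latter, and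
    its defining series converges absolutely. *)
Lemma Z4_ex : exists Z4 : R[i] -> R[i], forall z, ~ in_lat z ->
  has_Usum (fun i => (z - lat i) ^- 4) (Z4 z).
Proof.
suff /boolp.choice[Z4 H] (z : R[i]) :
  exists l, ~ in_lat z -> has_Usum (fun i => (z - lat i) ^- 4) l by exists Z4.
have [iz|nz] := pselect (in_lat z); first by exists 0.
have [d d0 [K K0 KP]] := pole_dominated nz.
have [l lP] : exists l, has_Usum (fun i => (z - lat i) ^- 4) l.
  apply: has_Usum_ex (wt_bounded K0) _ => i.
  by have [|_] := KP z i; rewrite ?subrr ?nm0.
by exists l.
Qed.

Lemma in_latD z i : in_lat (z + lat i) <-> in_lat z.
Proof.
split=> [[j E]|[j ->]]; last by exists (j + i); rewrite latD.
by exists (j - i); rewrite latD latN -E addrK.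
Qed.

(** A translation of the argument is a translation of the index. *)
Lemma Z4_per Z4 : (forall z, ~ in_lat z -> has_Usum (fun i => (z - lat i) ^- 4) (Z4 z)) ->
  forall z i, ~ in_lat z -> Z4 (z + lat i) = Z4 z.
Proof.
move=> ZP z j nz; have nzj : ~ in_lat (z + lat j) by move/in_latD.
have := @has_Usum_reindex _ _ _ _ (fun i => i + j) (fun i => i - j) (addrK j) (subrK j) (ZP _ nzj).
move=> h; apply: has_Usum_unique (has_Usum_ext _ h) (ZP _ nz) => i.
by rewrite latD opprD addrACA subrr addr0.
Qed.

Lemma Z4_holo Z4 : (forall z, ~ in_lat z -> has_Usum (fun i => (z - lat i) ^- 4) (Z4 z)) ->
  forall z, ~ in_lat z -> cdf Z4 z.
Proof.
move=> ZP z0 nz; have [d d0 [K K0 KP]] := pole_dominated nz.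
apply: (@Usum_holo R (int * int)%type (fun i z => (z - lat i) ^- 4) _ Z4 z0 d (wt_bounded K0) d0).
  move=> i z hz; have [n0 h] := KP z i hz; split=> //.
  apply: cdfV; first exact: expf_neq0.
  by apply: cdfX; apply: cdfB; [exact: cdf_id|exact: cdf_cst].
move=> z hz; apply: ZP => -[i E]; have [] := KP z i hz; by rewrite E subrr eqxx.
Qed.

(** The reflection [w |-> - w] changes the sign of the terms. *)
Lemma G5_eq0 l : has_Usum (fun i => lat i ^- 5) l -> l = 0.
Proof.
move=> h; have h' := @has_Usum_reindex _ _ _ _ -%R -%R opprK opprK h.
have /(has_Usum_unique h) : has_Usum (fun i => lat i ^- 5) (- l).
  have := has_UsumZ (-1) h'; rewrite mulN1r; apply: has_Usum_ext => i.
  by rewrite latN exprNn -signr_odd /= expr1 !mulN1r invrN opprK.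
move=> /eqP; rewrite -subr_eq0 opprK -mulr2n mulrn_eq0 /= => /eqP.
by [].
Qed.

(** With [x = z / w], the expansion [(1 - x)^(-4) = 1 + 4 x + 10 x^2 + ...] has
    the remainder [x^3 P(x) / (1 - x)^4] for a polynomial [P]; for [|x| <= 1/2]
    the values 53 and 16 bound [P] and [(1 - x)^(-4)]. *)
Lemma pole_Taylor z w : w != 0 -> nm z <= nm w / 2 ->
  nm ((z - w) ^- 4 - (w ^- 4 + 4 * z * w ^- 5 + 10 * z ^+ 2 * w ^- 6)) <=
  848 * nm z ^+ 3 * nm (w ^- 7).
Proof.
move=> w0 hz; have p : 0 < nm w by rewrite nm_gt0.
pose x := z / w; have x12 : nm x <= 1 / 2 by rewrite /x nm_div ler_pdivrMr //; lra.
have zE : z = x * w by rewrite /x divfK.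
have h1 : 1 / 2 <= nm (1 - x) by have := ler_nm_dist 1 x; rewrite nm1; lra.
have x1 : 1 - x != 0 by rewrite -nm_gt0; lra.
pose P := 20 - 45 * x + 36 * x ^+ 2 - 10 * x ^+ 3.
have -> : (z - w) ^- 4 - (w ^- 4 + 4 * z * w ^- 5 + 10 * z ^+ 2 * w ^- 6) =
    z ^+ 3 * w ^- 7 * (P / (1 - x) ^+ 4).
  have e1 : (z - w) ^- 4 = w ^- 4 * (1 - x) ^- 4.
    by rewrite -invfM -exprMn; congr (_^-1); rewrite zE; ring.
  have e2 : 4 * z * w ^- 5 = w ^- 4 * (4 * x) by rewrite zE; field.
  have e3 : 10 * z ^+ 2 * w ^- 6 = w ^- 4 * (10 * x ^+ 2) by rewrite zE; field.
  have e4 : z ^+ 3 * w ^- 7 = w ^- 4 * x ^+ 3 by rewrite zE; field.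
  rewrite e1 e2 e3 e4 -[in X in _ - (X + _ + _)](mulr1 (w ^- 4)) -!mulrDr -mulrBr -mulrA.
  by congr (_ * _); rewrite /P; field; exact: x1.
have hP : nm P <= 53.
  have x0 := nm_ge0 x; have x2 : nm x ^+ 2 <= 1 / 4 by nra.
  have x3 : nm x ^+ 3 <= 1 / 8 by rewrite exprS; nra.
  have t1 := nmB (20 - 45 * x + 36 * x ^+ 2) (10 * x ^+ 3).
  have t2 := nmD (20 - 45 * x) (36 * x ^+ 2); have t3 := nmB 20 (45 * x).
  move: t1 t2 t3; rewrite (nmM 10) (nmM 36) (nmM 45) !nmX !nm_nat -/P; lra.
have hV : (nm (1 - x) ^+ 4)^-1 <= 16.
  rewrite -[16]invrK lef_pV2 ?posrE ?exprn_gt0 ?invr_gt0 //; last by lra.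
  rewrite (_ : 16^-1 = (1 / 2) ^+ 4); last by field.
  by rewrite lerXn2r ?nnegrE ?nm_ge0 ?divr_ge0.
rewrite (nmM (z ^+ 3 * w ^- 7)) (nmM (z ^+ 3)) nmX -(mulrA 848) (mulrC 848).
rewrite ler_wpM2l ?mulr_ge0 ?exprn_ge0 ?nm_ge0 //.
rewrite nm_div nmX (_ : 848 = 53 * 16); last by ring.
by apply: ler_pM; rewrite ?nm_ge0 ?invr_ge0 ?exprn_ge0 ?nm_ge0.
Qed.

(** The expansions of the terms with [w] nonzero are summed; their remainders
    are dominated by [|z|^3 |w|^(-7)]. *)
Lemma pole_expansion (l4 l5 l6 : R[i]) : has_Usum (fun i => lat i ^- 4) l4 ->
  has_Usum (fun i => lat i ^- 5) l5 -> has_Usum (fun i => lat i ^- 6) l6 ->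
  exists2 C : R, 0 <= C & forall z l, nm z <= c / 4 -> has_Usum (fun i => (z - lat i) ^- 4) l ->
  nm (l - (z ^- 4 + l4 + 4 * z * l5 + 10 * z ^+ 2 * l6)) <= C * nm z ^+ 3.
Proof.
move=> h4 h5 h6; have [K K0 KP] := @latX_dominated R c 7 c0 isT.
have [wt0 [S SP]] := @wt_bounded R K K0.
have S0 : 0 <= S by apply: le_trans (SP fset0); rewrite big_seq_fset0.
exists (848 * S); first exact: mulr_ge0 (ler0n _ _) S0.
move=> z l hz hl; pose T i := lat i ^- 4 + 4 * z * lat i ^- 5 + 10 * z ^+ 2 * lat i ^- 6.
have hT : has_Usum T (l4 + 4 * z * l5 + 10 * z ^+ 2 * l6).
  by apply: has_UsumD; [apply: has_UsumD|]; rewrite //; exact: has_UsumZ.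
have := has_UsumD (has_Usum_remove 0 hl) (has_UsumZ (-1) hT).
rewrite lat0 subr0 mulN1r -addrA -opprD => h.
have -> : l - (z ^- 4 + l4 + 4 * z * l5 + 10 * z ^+ 2 * l6) =
  l - (z ^- 4 + (l4 + 4 * z * l5 + 10 * z ^+ 2 * l6)) by rewrite !addrA.
have z30 : 0 <= 848 * nm z ^+ 3 by exact: mulr_ge0 (ler0n _ _) (exprn_ge0 _ (nm_ge0 _)).
rewrite -(mulrA 848) (mulrC S) (mulrA 848).
apply: (has_Usum_bound (b := fun i => 848 * nm z ^+ 3 * (K * wt R i)) _ _ h).
  move=> i; rewrite mulN1r /T; case: eqP => [->|/eqP i0].
    rewrite lat0 !expr0n /= invr0 !mulr0 !addr0 subr0 nm0.
    exact: mulr_ge0 z30 (wt0 0).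
  have n0 : lat i != 0 by rewrite -nm_gt0; apply: lt_le_trans (lat_min c0 i0); rewrite divr_gt0.
  have hz2 : nm z <= nm (lat i) / 2 by have := lat_min c0 i0; lra.
  by apply: (le_trans (pole_Taylor n0 hz2)); rewrite ler_wpM2l.
by move=> A; rewrite -mulr_sumr ler_wpM2l.
Qed.

End FourthOrderPole.

(** * The flat coordinate on the half-plane *)

Section FlatCoordinate.
Variables (R : realType) (c : R) (p : CC R -> CC R).
Local Notation L0 := (lattice c%:C (c%:C * rho R)).
Hypotheses (c0 : 0 < c) (hg2 : g2 L0 = 0) (hg3 : g3 L0 = 1) (hp : flat_covering L0 p).
Implicit Types (F : R[i] -> R[i]) (w z tau : R[i]) (g : 'M[int]_2).
Local Notation t := (@chi R 1).
Local Notation omega := (2 * (pi : R)%:C * 'i : R[i]).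
Local Notation in_lat := (in_lat c).

(** The covering [p], seen as a function between the algebraic types. *)
Definition fl tau : R[i] := p tau.

Lemma fl_holo tau : upperP tau -> cdf fl tau.
Proof.
move=> t0; have /derivableP h := flat_covering_holomorphic hp t0.
by exists ('D_1 p tau); apply/is_deriveP.
Qed.

Lemma fl_off tau : upperP tau -> ~ in_lat (fl tau).
Proof.
move=> t0 /latP h; have [im _] := flat_covering_map hp.
have : (~` L0) (p tau) by rewrite -im; exists tau.
exact.
Qed.

Lemma fl_lim : cusp_lim fl 0.
Proof.
move=> e e0; have [M [_ MP]] := flat_covering_cusp hp e0.
exists (M + 2) => tau ht; rewrite subr0.
have := MP (M + 1) _ tau _; rewrite ltrDl ltr01 => /(_ isT).
rewrite normc_nm ltcR => h; apply/ltW/h; lra.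
Qed.

Lemma fl_6 tau : upperP tau -> fl (tau + 6) = fl tau.
Proof.
move=> t0; have E : tau + 6 = mob (mx2 (-1) (-6) 0 (-1)) tau.
  by rewrite mobE /jf !mx2s mul0r add0r !mulrN1z invrN invr1; ring.
have u6 : upperP (tau + 6) by rewrite E; apply: mob_upper => //; exact: SL2Z_mx2.
apply/esym/(flat_covering_fibre hp t0 u6); exists (mx2 (-1) (-6) 0 (-1)) => //.
exact: GammaN_T6.
Qed.

Lemma fl_Gamma' g tau : Gamma' g -> upperP tau -> in_lat (fl (mob g tau) - fl tau).
Proof.
move=> Gg t0; apply/latP; have u := mob_upper (Gamma'_SL2Z Gg) t0.
by apply/(flat_covering_orbit hp t0 u); exists g.
Qed.

Lemma in_lat_small z : in_lat z -> nm z < c / 2 -> z = 0.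
Proof.
move=> [i ->] h; case: (eqVneq i 0) => [->|i0]; first exact: lat0.
by move: h; rewrite ltNge lat_min.
Qed.

(** The difference [p(g tau) - p(tau)] is continuous with values in the discrete
    lattice, so it is locally constant. *)
Lemma fl_der_Gamma' (p1 : R[i] -> R[i]) : (forall tau, upperP tau -> cder fl tau (p1 tau)) ->
  forall g tau, Gamma' g -> upperP tau -> p1 (mob g tau) = jf g tau ^+ 2 * p1 tau.
Proof.
move=> p1d g tau Gg t0; have Sg := Gamma'_SL2Z Gg; have j0 := jf_neq0 Sg t0.
pose h z := fl (mob g z) - fl z.
have hd : cder h tau (p1 (mob g tau) * jf g tau ^- 2 - p1 tau).
  apply: cderB; last exact: p1d.
  exact: (cder_comp (cder_mob Sg t0) (p1d _ (mob_upper Sg t0))).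
have c2 : 0 < c / 2 by rewrite divr_gt0.
have [d d0 dP] := @cder_cont _ _ _ _ hd _ c2.
have [e [e0 ed et]] := minr_pos d0 t0.
have hc : cder h tau 0.
  apply: (@cder_ext _ (fun=> h tau) _ tau _ e e0); last exact: cder_cst.
  move=> w hw; apply/eqP; rewrite eq_sym -subr_eq0; apply/eqP.
  have w0 : upperP w by apply: (@upper_near _ tau); exact: lt_le_trans et.
  apply: in_lat_small; last by apply: dP; exact: lt_le_trans ed.
  rewrite /h; have [i ->] := fl_Gamma' Gg w0; have [j ->] := fl_Gamma' Gg t0.
  by exists (i - j); rewrite latD latN.
have /eqP := cder_unique hd hc; rewrite subr_eq0 => /eqP <-.
by rewrite mulrCA divff ?mulr1 // expf_neq0.
Qed.

Lemma cusp_6 (P : R[i] -> Prop) : cusp (fun w => P (6 * w)) -> cusp P.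
Proof.
move=> [Y h]; exists (6 * Y) => tau ht.
have E : 6 * (tau / 6) = tau :> R[i] by field.
by rewrite -E; apply: h; have := Im_6 (tau / 6); rewrite E; lra.
Qed.

Lemma cusp_upper : cusp (fun w : R[i] => upperP w).
Proof. by exists 1 => w hw; rewrite /upperP; lra. Qed.

(** By the expansion [p = a t + O(t^2)], the quotient of the two forms of weight
    2 has a limit at the cusp, and it is invariant under [Gamma']. *)
Lemma fl_der_f4 (p1 : R[i] -> R[i]) : (forall tau, upperP tau -> cder fl tau (p1 tau)) ->
  (forall tau, upperP tau -> cdf p1 tau) ->
  exists s : R[i], forall tau, upperP tau -> p1 tau = s * f4 tau.
Proof.
move=> p1d p1h.
have [f1 [fd f1h]] := upper_derivative (@f4_holo R).
have [f2 [f1d _]] := upper_derivative f1h.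
have [J0 _ _ _] := f4_jets fd f1d.
pose P := cut fl.
have P1 : per1 P by apply: cut_per; exact: fl_6.
have Ph : holo (fun z => 0 < complex.Im z) P by exact: cut_holo fl_holo.
have [a [C C0 aP]] := cusp_expansion 1 P1 Ph (cut_upto0 fl_lim) (@ltr01 R).
have E2 : Ot 2 (fun w => P w - a 1%N * t w).
  exists C => //; exists 1 => w /aP; rewrite big_nat1 expr1; exact.
have Pd w : 0 < complex.Im w -> cder (fun w => P w - a 1%N * t w) w
    (6 * p1 (6 * w) - omega * a 1%N * t w).
  move=> w0; apply: cder_eq (cderB (cut_cder w0 (p1d _ (upper_6 w0))) (cderZ (a 1%N) (cder_chi 1 w))) _.
  by rewrite mulr1z; ring.
have E2' := Ot_divt (Ot_der Pd E2).
have J1 : Ot 1 (fun w => f4 (6 * w) / t w - 1).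
  apply: (Ot_eq (F := fun w => (f4 (6 * w) / t w - (1 + -4 * t w ^+ 6)) + (-4) * t w ^+ 6)).
    by move=> w; ring.
  by apply: OtD; [exact: Ot_le J0|exact: OtZt].
exists (omega * a 1%N / 6).
have q : Ot 1 (fun w => 6 * (p1 (6 * w) / f4 (6 * w) - omega * a 1%N / 6)).
  have V0 := jet_bounded (jetV J0 (oner_neq0 _)).
  have := OtM (OtD E2' (OtZ (- (omega * a 1%N)) J1)) V0.
  apply: Ot_ext; apply: cusp_imp cusp_upper => w w0; have t0 := chi_neq0 1 w.
  have f0 : f4 (6 * w) != 0 := f4_neq0 (upper_6 w0).
  move: (f4 (6 * w)) (p1 _) (t w) (omega * a 1%N) t0 f0 => x y u k u0 x0.
  by field; rewrite u0 x0.
have lim : cusp_lim (fun tau => p1 tau / f4 tau) (omega * a 1%N / 6).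
  move=> e e0; apply: cusp_6; have e6 : 0 < 6 * e by rewrite mulr_gt0.
  by apply: cusp_imp (Ot_small q e6) => w; rewrite nmM nm_nat ler_pM2l.
have qh tau : upperP tau -> cdf (fun tau => p1 tau / f4 tau) tau.
  move=> t0; apply: cdfM; first exact: p1h.
  by apply: cdfV; [exact: f4_neq0|exact: f4_holo].
have qg g tau : Gamma' g -> upperP tau -> p1 (mob g tau) / f4 (mob g tau) = p1 tau / f4 tau.
  move=> Gg t0; rewrite (fl_der_Gamma' p1d Gg t0) (f4_Gamma' Gg t0).
  by rewrite invfM mulrACA divff ?mul1r // expf_neq0 // jf_neq0 //; exact: Gamma'_SL2Z.
move=> tau t0; have f0 := f4_neq0 t0.
by rewrite -(rigid qh qg lim t0) (divfK f0).
Qed.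

(** Otherwise [p] would be constant with the value 0, its limit at the cusp,
    which belongs to the lattice. *)
Lemma fl_factor_neq0 s : (forall tau, upperP tau -> cder fl tau (s * f4 tau)) -> s != 0.
Proof.
move=> sd; apply/eqP => s0; have d0 tau : upperP tau -> cder fl tau 0.
  by move=> t0; have := sd _ t0; rewrite s0 mul0r.
have i0 : upperP ('i%C : R[i]) by rewrite /upperP ltr01.
apply: (fl_off i0); have -> : fl 'i%C = 0; last by exists 0; rewrite lat0.
apply: nm_eq0P => e e0; have [w [w0 hw]] := cusp_ex (cusp_and cusp_upper (fl_lim e0)).
by rewrite -(zero_der_upper d0 i0 w0) -[fl w]subr0.
Qed.

(** Integrates the expansion of [f4] term by term: [t - 4 t^7] becomes [t -
    (4/7) t^7]. *)
Lemma fl_jet s : (forall tau, upperP tau -> cder fl tau (s * f4 tau)) ->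
  jet (fun w => cut fl w / t w) (6 * s / omega) (- (4 / 7) * (6 * s / omega)).
Proof.
move=> sd; have w0 : omega != 0 := twopii_neq0 R; set a := 6 * s / omega.
have [f1 [fd f1h]] := upper_derivative (@f4_holo R).
have [f2 [f1d _]] := upper_derivative f1h.
have [_ _ _ E8] := f4_jets fd f1d.
apply: jet_divt; pose E w := cut fl w - (a * t w + - (4 / 7) * a * t w ^+ 7).
have dt (n : nat) w : cder (fun w => t w ^+ n) w (n%:R * omega * t w ^+ n).
  have -> : (fun w => t w ^+ n) = @chi R n by apply/funext => z; rewrite chiX.
  by apply: cder_eq (cder_chi n w) _; rewrite chiX -pmulrn; ring.
have Ed w : 0 < complex.Im w -> cder E w (6 * s * (f4 (6 * w) - (t w - 4 * t w ^+ 7))).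
  move=> hw; apply: cder_eq (cderB (cut_cder hw (sd _ (upper_6 hw)))
    (cderD (cderZ a (dt 1 w)) (cderZ (- (4 / 7) * a) (dt 7 w)))) _.
  rewrite expr1 /a; move: omega w0 => o o0; field; exact: o0.
apply: (Ot_int Ed); last exact: OtZ.
  move=> w hw; apply: cdf_cont; apply: cdfZ; apply: cdfB.
    apply: (@cdf_comp _ (@f4 R)); first by eexists; exact: cder_scale.
    exact: f4_holo (upper_6 hw).
  by apply: cdfB; [|apply: cdfZ; apply: cdfX]; eexists; exact: cder_chi.
apply/upto0P => e e0; have e2 : 0 < e / 2 by rewrite divr_gt0.
have P0 := (upto0P _).1 (cut_upto0 fl_lim) _ e2.
have tO : Ot 1 (fun w => a * t w + - (4 / 7) * a * t w ^+ 7).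
  by apply: OtD; [exact: (@OtZt _ 1 1)|exact: OtZt].
apply: cusp_imp (cusp_and P0 (Ot_small tO e2)) => w [h1 h2].
by rewrite /E (le_trans (nmB _ _)) //; lra.
Qed.

(** The functions [a^4 Z4(p)] and [X^2] have the same pole [t^(-4)] at the cusp,
    and no other terms of negative or zero order. So they are equal by [rigid],
    and so are their coefficients of [t^2], which are [16/7 + a^6/14] and [2 *
    248]. *)
Lemma fl_factor_pow6 s : (forall tau, upperP tau -> cder fl tau (s * f4 tau)) ->
  (6 * s / omega) ^+ 6 = 6912.
Proof.
move=> sd; have w0 : omega != 0 := twopii_neq0 R; have s0 := fl_factor_neq0 sd.
have J := fl_jet sd; set a := 6 * s / omega in J *.
have a0 : a != 0 by rewrite !mulf_neq0 ?invr_eq0 // pnatr_eq0.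
have [X [Xh Xg XJ]] := bracket_quotient R.
have [Z4 ZP] := Z4_ex c0.
have G4 : has_Usum (fun i => lat c i ^- 4) 0.
  have [l lP] := @lat_sum_ex R c 4 c0 isT; suff -> : 0 = l by [].
  have := hg2; rewrite /g2 (lattice_sumE c0 _ lP) // => /eqP.
  by rewrite mulf_eq0 pnatr_eq0 /= => /eqP.
have G5 : has_Usum (fun i => lat c i ^- 5) 0.
  by have [l lP] := @lat_sum_ex R c 5 c0 isT; rewrite -(G5_eq0 lP).
have G6 : has_Usum (fun i => lat c i ^- 6) (1 / 140).
  have [l lP] := @lat_sum_ex R c 6 c0 isT; suff -> : 1 / 140 = l by [].
  have h : 140 * l = 1 by have := hg3; rewrite /g3 (lattice_sumE c0 _ lP).
  by have -> : l = (140 * l) / 140; [field|rewrite h].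
have [C C0 CP] := pole_expansion c0 G4 G5 G6.
pose P := cut fl.
have Pt : jet (fun w => P w ^+ 6) 0 (a ^+ 6).
  apply: jet_eq (jet_ext _ (jetM (jetX 6 J) (jet_t6 R))) _ _.
  - apply: cusp_true => w; have t0 := chi_neq0 1 w; rewrite -exprMn divfK //.
  - by rewrite mulr0.
  - by rewrite mulr1 mulr0 addr0.
have P1 : Ot 1 P.
  apply: (Ot_eq (F := fun w => t w ^+ 1 * (P w / t w))); last exact: OtM (Ot_t R 1) (jet_bounded J).
  by move=> w; rewrite expr1 mulrC divfK // chi_neq0.
have c4 : 0 < c / 4 by rewrite divr_gt0.
have PU : cusp (fun w => [/\ upperP w, nm (P w) <= c / 4 & P w != 0]).
  apply: cusp_imp (cusp_and cusp_upper (Ot_small P1 c4)) => w [hw h]; split=> //.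
  rewrite /P cutE //; apply/eqP => E; apply: (fl_off (upper_6 hw)); rewrite E.
  by exists 0; rewrite lat0.
have ZJ : jet (fun w => P w ^+ 4 * Z4 (P w)) 1 (a ^+ 6 / 14).
  have P3 : Ot 3 (fun w => P w ^+ 3).
    apply: (Ot_eq (F := fun w => P w * (P w * P w))); first by move=> w; ring.
    exact: OtM P1 (OtM P1 P1).
  have O3 : Ot 3 (fun w => Z4 (P w) - (P w ^- 4 + 0 + 4 * P w * 0 + 10 * P w ^+ 2 * (1 / 140))).
    have [D D0 DP] := P3; exists (C * D); first exact: mulr_ge0.
    apply: cusp_imp (cusp_and DP PU) => w [h1 [hw h2 h3]].
    apply: (le_trans (CP _ _ h2 (ZP _ _))).
      by rewrite /P cutE //; exact: fl_off (upper_6 hw).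
    by rewrite -mulrA ler_wpM2l // -nmX.
  have P4 : Ot 4 (fun w => P w ^+ 4).
    by apply: Ot_eq (OtM P3 P1) => w; rewrite -exprSr.
  apply: jet_eq (jet_ext _ (jetD (jet_Ot _ (OtM P4 O3)) (jetD (jet_cst 1) (jetZ (1 / 14) Pt)))) _ _.
  - by apply: cusp_imp PU => w [_ _ P0]; field.
  - by [].
  - by rewrite mulr0 addr0 add0r.
  - by rewrite !add0r; field.
pose F tau := a ^+ 4 * Z4 (fl tau) - X tau ^+ 2.
have FJ : jet (fun w => F (6 * w) * t w ^+ 4) 0 (16 / 7 + a ^+ 6 / 14 - 496).
  have a4 : a ^+ 4 != 0 by rewrite expf_neq0.
  have := jetD (jetM (jetZ (a ^+ 4) (jetV (jetX 4 J) a4)) ZJ) (jetZ (-1) (jetX 2 XJ)).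
  move=> h; apply: jet_eq (jet_ext _ h) _ _.
  - apply: cusp_imp PU => w [hw _ P0]; rewrite /F; have t0 := chi_neq0 1 w.
    by rewrite /P cutE // in P0 *; field; rewrite t0 P0.
  - by field.
  - by rewrite /=; field.
have F2 : Ot 1 (fun w => F (6 * w)).
  have F6 : Ot 5 (fun w => F (6 * w) * t w ^+ 4).
    apply: (Ot_eq _ (OtD (Ot_le (isT : (5 <= 7)%N) FJ) (OtZt (16 / 7 + a ^+ 6 / 14 - 496) (isT : (5 <= 6)%N)))).
    by move=> w; rewrite add0r subrK.
  apply: Ot_eq (Ot_divt (Ot_divt (Ot_divt (Ot_divt F6)))) => w; have t0 := chi_neq0 1 w.
  by move: (F _) => y; field.
have lim : cusp_lim F 0.
  by move=> e e0; apply: cusp_6; apply: cusp_imp (Ot_small F2 e0) => w; rewrite subr0.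
have F0 tau : upperP tau -> F tau = 0.
  apply: rigid lim tau => [tau t0|g tau Gg t0].
    apply: cdfB; last by apply: cdfX; exact: Xh.
    apply: cdfZ; apply: (@cdf_comp _ Z4 fl); first exact: fl_holo.
    by apply: (Z4_holo c0 ZP); exact: fl_off.
  rewrite /F Xg //; congr (_ * _ - _); have [i E] := fl_Gamma' Gg t0.
  by rewrite -(subrK (fl tau) (fl (mob g tau))) E addrC (Z4_per ZP) //; exact: fl_off.
have [_ /eqP] := jet_unique (jet_ext (G := fun=> 0) (cusp_imp
  (fun w hw => etrans (congr1 (fun x => x * t w ^+ 4) (F0 _ (upper_6 hw))) (mul0r _)) cusp_upper) FJ).
rewrite subr_eq0 => /eqP h.
have -> : a ^+ 6 = 14 * ((16 / 7 + a ^+ 6 / 14) - 16 / 7) by field.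
by rewrite h; field.
Qed.

Theorem flat_derivative : exists s : R[i], [/\ s != 0,
  forall tau, upperP tau -> cder fl tau (s * f4 tau) & (6 * s / omega) ^+ 6 = 6912].
Proof.
have [p1 [p1d p1h]] := upper_derivative fl_holo.
have [s sE] := fl_der_f4 p1d p1h; exists s.
have sd tau : upperP tau -> cder fl tau (s * f4 tau) by move=> t0; rewrite -sE //; exact: p1d.
by split; [exact: fl_factor_neq0 sd|exact: sd|exact: fl_factor_pow6 sd].
Qed.

End FlatCoordinate.

(** * Charts of the punctured torus *)

Section Charts.
Variables (R : realType) (c : R) (p : CC R -> CC R) (s : R[i]).
Local Notation L0 := (lattice c%:C (c%:C * rho R)).
Hypotheses (c0 : 0 < c) (hp : flat_covering L0 p).
Hypotheses (s0 : s != 0) (pd : forall tau, upperP tau -> cder (fl p) tau (s * f4 tau)).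
Implicit Types (z w : R[i]) (y : upper R) (x : Tstar R) (U V N : set (Tstar R))
  (t tau : Tstar R -> upper R).

Lemma nbhs_nm z (P : set (CC R)) :
  nbhs (z : CC R) P <-> exists2 d : R, 0 < d & forall w, nm (w - z) < d -> P w.
Proof.
split.
  move=> /nbhs_normP[d /=]; rewrite ltcE /= => /andP[/eqP d1 d0] dP.
  exists (complex.Re d) => // w h; apply: dP.
  by rewrite /= normc_nm ltcE /= d1 eqxx /= nm_distC.
move=> [d d0 dP]; apply/(@nbhs_normP _ (CC R)); exists d%:C; first by rewrite /= ltcR.
by move=> w /=; rewrite normc_nm ltcR nm_distC; exact: dP.
Qed.

(** By Caratheodory's form of the derivative, [(q w - q z) phi (q w) = psi w (w
    - z)] with [phi] and [psi] continuous. *)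
Lemma cder_implicit (f q h : R[i] -> R[i]) z (l m : R[i]) d : l != 0 -> 0 < d ->
  cder f (q z) l -> cder h z m -> ccont q z ->
  (forall w, nm (w - z) < d -> f (q w) = h w) -> cder q z (m / l).
Proof.
move=> l0 d0 [phi [fE phil phic]] [psi [hE psim psic]] qc fq.
have cphi : ccont (fun w => phi (q w)) z by exact: ccont_comp qc phic.
have lp : 0 < nm l by rewrite nm_gt0.
have [d' d'0 d'P] := cphi _ lp; have [e [e0 ed ed']] := minr_pos d0 d'0.
have phin w : nm (w - z) < e -> phi (q w) != 0.
  move=> hw; have := d'P w (lt_le_trans hw ed'); rewrite phil -nm_gt0.
  by have := ler_nm_dist l (phi (q w)); rewrite nm_distC; lra.
apply: (@cder_ext _ (fun w => q z + psi w / phi (q w) * (w - z)) _ z _ e e0).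
  move=> w hw; have h1 : phi (q w) * (q w - q z) = psi w * (w - z).
    rewrite -fE -hE !fq ?subrr ?nm0 //; exact: lt_le_trans hw ed.
  by rewrite mulrAC -h1 mulrC mulKf ?phin // addrC subrK.
exists (fun w => psi w / phi (q w)); split.
- by move=> w; rewrite subrr mulr0 addr0 addrC addKr.
- by rewrite psim phil.
- by apply: ccontM => //; apply: ccontV => //; apply: phin; rewrite subrr nm0.
Qed.

Lemma upperE y : upperP (val y).
Proof. exact: (set_valP y). Qed.

Lemma upper_ex z : upperP z -> exists y, val y = z.
Proof. by move=> hz; exists (SigSub (mem_set hz : z \in upper R)). Qed.

(** The half-plane has the topology induced from the complex plane. *)
Lemma upper_nbhs y (M : set (upper R)) : nbhs y M ->
  exists2 d : R, 0 < d & forall y', nm (val y' - val y) < d -> M y'.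
Proof.
move=> [_ [/= [P oP <-] /= Py] PM].
have /nbhs_nm[d d0 dP] : nbhs (val y : CC R) P by exact: open_nbhs_nbhs.
by exists d => // y' /dP h; apply: PM.
Qed.

Lemma nbhs_upper y d : 0 < d -> nbhs y [set y' | nm (val y' - val y) < d].
Proof.
move=> d0; have : nbhs (val y : CC R) [set w : CC R | nm (w - val y) < d].
  by apply/nbhs_nm; exists d.
exact: (@initial_continuous (upper R) (CC R) set_val y).
Qed.

Lemma near_proj V t x N : local_inverse V t -> V x -> nbhs x N ->
  exists2 d : R, 0 < d & forall y, nm (val y - val (t x)) < d -> N (Tstar_proj y).
Proof.
move=> [_ tK _] Vx; rewrite -[x in nbhs x](tK x Vx) => /(@pi_continuous _ _ (t x)).
exact: upper_nbhs.
Qed.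

Lemma proj_orbit y y' : Tstar_proj y = Tstar_proj y' -> same_orbit Gamma' (val y) (val y').
Proof.
move=> E; apply/asboolP; rewrite -/(orbit_rel y y').
by have /eqmodP := E.
Qed.

(** The local inverse [tau] differs from the identity of the half-plane by
    elements of [Gamma'], hence [p o tau] from [p] by lattice vectors, which are
    constant by continuity. *)
Lemma lift_near V t U tau x : local_inverse V t -> V x -> local_inverse U tau -> U x ->
  exists2 d : R, 0 < d & forall y, nm (val y - val (t x)) < d ->
    U (Tstar_proj y) /\ fl p (val (tau (Tstar_proj y))) =
      fl p (val y) + (fl p (val (tau x)) - fl p (val (t x))).
Proof.
move=> Vt Vx Ut Ux; have [oU tauK tauC] := Ut.
have pc z : upperP z -> ccont (fl p) z by move=> /pd/cder_cont.
have c4 : 0 < c / 4 by rewrite divr_gt0.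
have [d1 d10 d1P] := pc _ (upperE (t x)) _ c4.
have [e e0 eP] := pc _ (upperE (tau x)) _ c4.
have nU : nbhs x (U `&` [set x' | nm (val (tau x') - val (tau x)) < e]).
  by apply: filterI; [exact: open_nbhs_nbhs|exact: tauC Ux _ (nbhs_upper _ e0)].
have [d2 d20 d2P] := near_proj Vt Vx nU.
have [d [d0 dd1 dd2]] := minr_pos d10 d20.
exists d => // y hy; have [Uy ty] := d2P _ (lt_le_trans hy dd2); split=> //.
have := proj_orbit (esym (tauK _ Uy)) => orb.
have := (flat_covering_orbit hp (upperE y) (upperE (tau (Tstar_proj y)))).2 orb.
have := proj_orbit (etrans (tauK _ Ux) (esym (let: And3 _ k _ := Vt in k _ Vx))) => orb'.
have := (flat_covering_orbit hp (upperE (tau x)) (upperE (t x))).2 orb'.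
move=> /latP[i iE] /latP[j jE].
set A := fl p _; set B := fl p _; set A0 := fl p _; set B0 := fl p _.
have h1 : nm (A - A0) < c / 4 by exact: eP ty.
have h2 : nm (B - B0) < c / 4 by apply: d1P; exact: lt_le_trans hy dd1.
have : A - B + (B0 - A0) = 0.
  apply: (in_lat_small c0); first by exists (j + i); rewrite latD -iE -jE.
  have -> : A - B + (B0 - A0) = (A - A0) - (B - B0) by ring.
  by have := nmB (A - A0) (B - B0); lra.
by move=> E; rewrite -[A]subr0 -E; ring.
Qed.

(** The point [t (proj y)] has the same image as [y] under [p], and for [y] near
    [t x] both lie on one sheet of the covering. *)
Lemma chart_inverse V t x : local_inverse V t -> V x -> exists2 d : R, 0 < d &
  forall y, nm (val y - val (t x)) < d -> V (Tstar_proj y) /\ t (Tstar_proj y) = y.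
Proof.
move=> Vt Vx; have [_ cov] := flat_covering_map hp.
have offL : (~` L0) (p (val (t x))).
  by move=> /latP h; exact: (fl_off hp (upperE (t x)) h).
have [B [oB Bp _ [I [W [oW _ WE WP]]]]] := cov _ offL.
have : (\bigcup_i W i) (val (t x)) by rewrite WE; split => //; exact: upperE.
move=> [i _ Wi]; have [[_ inj _] _ _] := WP i.
have /nbhs_nm[e e0 eP] : nbhs (val (t x) : CC R) (W i) by apply: open_nbhs_nbhs; split.
have [d1 d10 d1P] := lift_near Vt Vx Vt Vx.
have nV : nbhs x [set x' | nm (val (t x') - val (t x)) < e].
  by case: Vt => _ _ tC; exact: tC Vx _ (nbhs_upper _ e0).
have [d2 d20 d2P] := near_proj Vt Vx nV.
have [d3 [d30 h31 h32]] := minr_pos d10 d20; have [d [d0 hd3 hde]] := minr_pos d30 e0.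
exists d => // y hy; have y3 := lt_le_trans hy hd3.
have [Vy E] := d1P y (lt_le_trans y3 h31); split=> //.
apply/val_inj/inj; rewrite ?inE.
- by apply: eP; exact: d2P (lt_le_trans y3 h32).
- by apply: eP; exact: lt_le_trans hy hde.
by move: E; rewrite subrr addr0.
Qed.

(** Near [t x] the partial inverse of the coordinate is the projection to the
    punctured torus. *)
Lemma chart_pinv V t x : local_inverse V t -> V x -> exists2 d : R, 0 < d &
  forall y, nm (val y - val (t x)) < d ->
    'pinv_(fun=> x) V (chart_coord t) (val y) = Tstar_proj y.
Proof.
move=> Vt Vx; have [d d0 dP] := chart_inverse Vt Vx; exists d => // y /dP[Vy ty].
have inj : {in V &, injective (chart_coord t)}.
  case: Vt => _ tK _ x1 x2; rewrite !inE => V1 V2 /val_inj E.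
  by rewrite -(tK x1 V1) -(tK x2 V2) E.
have {1}-> : val y = chart_coord t (Tstar_proj y) by rewrite /chart_coord ty.
by rewrite pinvKV // inE.
Qed.

Lemma coord_cder V t x (f : Tstar R -> CC R) (G : R[i] -> R[i]) (l : R[i]) d :
  local_inverse V t -> V x -> 0 < d ->
  (forall y, nm (val y - val (t x)) < d -> f (Tstar_proj y) = G (val y)) ->
  cder G (val (t x)) l -> is_deriv_coord V (chart_coord t) f x l.
Proof.
move=> Vt Vx d0 fG Gd; apply/is_deriveP; have [d1 d10 d1P] := chart_pinv Vt Vx.
have [d2 [d20 h1 h2]] := minr_pos d0 d10.
have [d3 [d30 h3 h4]] := minr_pos d20 (upperE (t x)).
apply: (cder_ext d30 _ Gd) => w hw.
have [y yE] := upper_ex (upper_near (lt_le_trans hw h4)).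
have hw2 := lt_le_trans hw h3.
by rewrite /= -yE d1P -?fG // yE; [exact: lt_le_trans hw2 h1|exact: lt_le_trans hw2 h2].
Qed.

Lemma flat_in_chart V t U tau x : local_inverse V t -> V x -> local_inverse U tau -> U x ->
  is_deriv_coord V (chart_coord t) (fun x => p (chart_coord tau x)) x (s * f4 (val (t x))).
Proof.
move=> Vt Vx Ut Ux; have [d d0 dP] := lift_near Vt Vx Ut Ux.
pose k := fl p (val (tau x)) - fl p (val (t x)).
apply: (coord_cder (G := fun w => fl p w + k) Vt Vx d0).
  by move=> y /dP[].
by apply: (cder_eq (cderD (pd (upperE _)) (cder_cst _ _))); rewrite addr0.
Qed.

(** The transition function [q] satisfies [p (q w) = p w + const], and [p'] does
    not vanish. *)
Lemma chart_in_chart V t U tau x : local_inverse V t -> V x -> local_inverse U tau -> U x ->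
  is_deriv_coord V (chart_coord t) (chart_coord tau) x
    (s * f4 (val (t x)) / (s * f4 (val (tau x)))).
Proof.
move=> Vt Vx Ut Ux; have [d d0 dP] := lift_near Vt Vx Ut Ux.
pose k := fl p (val (tau x)) - fl p (val (t x)).
have [d1 d10 d1P] := chart_pinv Vt Vx.
pose q w : R[i] := chart_coord tau ('pinv_(fun=> x) V (chart_coord t) w).
have qE y : nm (val y - val (t x)) < d1 -> q (val y) = val (tau (Tstar_proj y)).
  by move=> /d1P E; rewrite /q E.
have projt : Tstar_proj (t x) = x by case: Vt => _ tK _; exact: tK.
have qx : q (val (t x)) = val (tau x) by rewrite qE ?subrr ?nm0 // projt.
have qc : ccont q (val (t x)).
  move=> e e0; have nU : nbhs x [set x' | nm (val (tau x') - val (tau x)) < e].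
    by case: Ut => _ _ tC; exact: tC Ux _ (nbhs_upper _ e0).
  have [d2 d20 d2P] := near_proj Vt Vx nU.
  have [d3 [d30 h1 h2]] := minr_pos d10 d20.
  have [d4 [d40 h3 h4]] := minr_pos d30 (upperE (t x)).
  exists d4 => // w hw; have [y yE] := upper_ex (upper_near (lt_le_trans hw h4)).
  have hw3 := lt_le_trans hw h3; rewrite qx -yE qE; last by rewrite yE; exact: lt_le_trans hw3 h1.
  by apply: d2P; rewrite yE; exact: lt_le_trans hw3 h2.
have l0 : s * f4 (val (tau x)) != 0 by rewrite mulf_neq0 // f4_neq0 //; exact: upperE.
have [d2 [d20 h1 h2]] := minr_pos d0 d10.
have [d3 [d30 h3 h4]] := minr_pos d20 (upperE (t x)).
apply/is_deriveP; apply: (@cder_implicit (fl p) q (fun w => fl p w + k) _ _ _ d3 l0 d30).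
- by rewrite qx; apply: pd; exact: upperE.
- by apply: (cder_eq (cderD (pd (upperE _)) (cder_cst _ _))); rewrite addr0.
- exact: qc.
move=> w hw; have [y yE] := upper_ex (upper_near (lt_le_trans hw h4)).
have hw2 := lt_le_trans hw h3.
rewrite -yE qE; last by rewrite yE; exact: lt_le_trans hw2 h2.
by have [] := dP y; rewrite ?yE; [exact: lt_le_trans hw2 h1|].
Qed.


End Charts.

(** * The constant and the theorem *)

Section Constant.
Variable R : realType.

(** Half the modulus of [s]. *)
Definition kreal : R := trigo.pi * (2 `^ (3^-1)) / Num.sqrt 3.

Lemma kreal_gt0 : 0 < kreal.
Proof. by rewrite divr_gt0 ?mulr_gt0 ?pi_gt0 ?powR_gt0 // sqrtr_gt0. Qed.

Lemma kreal6 : kreal ^+ 6 = (pi : R) ^+ 6 * 4 / 27.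
Proof.
have p3 : (2 `^ (3^-1) : R) ^+ 3 = 2.
  by rewrite -powR_mulrn ?powR_ge0 // -powRrM mulVf ?pnatr_eq0 // powRr1.
have s2 : (Num.sqrt 3 : R) ^+ 2 = 3 by rewrite sqr_sqrtr.
have -> : kreal ^+ 6 = pi ^+ 6 * (2 `^ (3^-1) ^+ 3) ^+ 2 / (Num.sqrt 3 ^+ 2) ^+ 3.
  by rewrite /kreal -!exprM exprMn exprVn exprMn.
by rewrite p3 s2; field.
Qed.

(** Here [6912 = 6^6 * 4 / 27], and [i^6 = -1] gives the sign. *)
Lemma constant_k (s : R[i]) : (6 * s / (2 * (pi : R)%:C * 'i)) ^+ 6 = 6912 ->
  exists k : R[i], k ^+ 6 = -1 /\ 2 * k * kreal%:C = s.
Proof.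
move=> h; have D0 : kreal%:C != 0 :> R[i] by rewrite -nm_gt0 nm_real normr_gt0 gt_eqF // kreal_gt0.
have P0 : (pi : R)%:C != 0 :> R[i] by rewrite -nm_gt0 nm_real normr_gt0 pi_neq0.
have D6 : kreal%:C ^+ 6 = (pi : R)%:C ^+ 6 * 4 / 27 :> R[i].
  by rewrite -rmorphXn /= kreal6 fmorph_div rmorphM /= rmorphXn /= !rmorph_nat.
have i6 : ('i : R[i]) ^+ 6 = -1 by rewrite (exprM _ 2 3) sqrCi -signr_odd /= expr1.
exists (s / (2 * kreal%:C)); split; last by field.
have sE : s ^+ 6 = - (64 * (4 / 27) * (pi : R)%:C ^+ 6).
  have i0 : ('i : R[i]) != 0 by rewrite -nm_gt0 nm_i ltr01.
  have alg (P j : R[i]) : P != 0 -> j != 0 ->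
      s ^+ 6 = (6 * s / (2 * P * j)) ^+ 6 * (2 / 6) ^+ 6 * P ^+ 6 * j ^+ 6.
    by move=> nP nj; field; rewrite nP nj.
  by rewrite (alg _ _ P0 i0) h i6; move: ((pi : R)%:C : R[i]) => P; field.
rewrite exprMn exprVn exprMn D6 sE; move: P0; move: ((pi : R)%:C : R[i]) => P P0.
by field; exact: P0.
Qed.

End Constant.

Theorem mainTheorem4 (R : realType) (c : R) (hc : 0 < c)
    (L0 : set (CC R)) (hL0 : L0 = lattice c%:C (c%:C * rho R))
    (hg2 : g2 L0 = 0) (hg3 : g3 L0 = 1)
    (p : CC R -> CC R) (hp : flat_covering L0 p) :
  exists k : CC R, k ^+ 6 = -1 /\
    let s : CC R := 2 * k * (trigo.pi * (2 `^ (3^-1)) / Num.sqrt 3)%:C in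
    forall (A : Type) (U : A -> set (Tstar R)) (tau : A -> Tstar R -> upper R),
      hyperbolic_atlas U tau ->
      let z a x := p (chart_coord (tau a) x) in
      let seta4 a x := s * dedekind_eta (chart_coord (tau a) x) ^+ 4 in
      (forall a x, U a x ->
         is_deriv_coord (U a) (chart_coord (tau a)) (z a) x (seta4 a x)) /\
      (forall a b x, U a x -> U b x ->
         [/\ form_eq x (fun=> 1) (z a) (seta4 a) (chart_coord (tau a)),
             form_eq x (seta4 a) (chart_coord (tau a)) (seta4 b) (chart_coord (tau b)) &
             form_eq x (seta4 b) (chart_coord (tau b)) (fun=> 1) (z b)]).
Proof.
subst L0; have [s [s0 pd s6]] := flat_derivative hc hg2 hg3 hp.
have [k [k6 kE]] := constant_k s6; exists k; split; first exact: k6.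
move=> s' A U tau [_ inv _] z seta4; have sE : s' = s := kE.
have etaA a x : seta4 a x = s * f4 (val (tau a x)) by rewrite /seta4 sE etaE.
have Fz a x V t : local_inverse V t -> V x -> U a x ->
    is_deriv_coord V (chart_coord t) (z a) x (s * f4 (val (t x))).
  by move=> Vt Vx Ua; exact: (flat_in_chart hc hp pd Vt Vx (inv a) Ua).
have Ft a x V t : local_inverse V t -> V x -> U a x ->
    is_deriv_coord V (chart_coord t) (chart_coord (tau a)) x
      (s * f4 (val (t x)) / (s * f4 (val (tau a x)))).
  by move=> Vt Vx Ua; exact: (chart_in_chart hc hp s0 pd Vt Vx (inv a) Ua).
have n0 a x : s * f4 (val (tau a x)) != 0.
  by rewrite mulf_neq0 // f4_neq0 //; exact: upperE.
have key (A' B' : R[i]) : B' != 0 -> B' * (A' / B') = A' by move=> B0; field.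
split=> [a x Ua|a b x Ua Ub]; first by rewrite etaA; exact: (Fz a x _ _ (inv a) Ua Ua).
split=> V t Vt Vx.
- exists (s * f4 (val (t x))), (s * f4 (val (t x)) / (s * f4 (val (tau a x)))).
  split; [exact: Fz|exact: Ft|].
  rewrite etaA; exact: etrans (mul1r _) (esym (key _ _ (n0 a x))).
- exists (s * f4 (val (t x)) / (s * f4 (val (tau a x)))),
    (s * f4 (val (t x)) / (s * f4 (val (tau b x)))); split; [exact: Ft|exact: Ft|].
  rewrite !etaA; exact: etrans (key _ _ (n0 a x)) (esym (key _ _ (n0 b x))).
- exists (s * f4 (val (t x)) / (s * f4 (val (tau b x)))), (s * f4 (val (t x))).
  split; [exact: Ft|exact: Fz|].
  rewrite etaA; exact: etrans (key _ _ (n0 b x)) (esym (mul1r _)).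
Qed.
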